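(* Let $d\ge1$, let $\Pi$ be a translation-invariant simple point process on $\mathbb{R}^d$ with intensity $\lambda\in(0,\infty)$, let $\alpha\in(0,\infty)$, and let $\Psi=\Psi_\Pi$ be a stable factor allocation to $[\Pi]$ with appetite $\alpha$. (i) A.s. all territories of $\Psi$ are bounded. (ii) A.s. every bounded subset of $\mathbb{R}^d$ intersects only finitely many territories of $\Psi$. (iii) $\Psi_\Pi$ may be chosen to be a stable isometry-equivariant factor of $\Pi$ in such a way that a.s. each territory is a union of finitely many open connected sets; that is, there exists an isometry-equivariant stable factor allocation with appetite $\alpha$ having this property.
   Context: $|\cdot|$ is the Euclidean norm and $\mathcal{L}$ is Lebesgue measure (volume) on $\mathbb{R}^d$. Elements of $\mathbb{R}^d$ are called sites. Let $\Xi\subset\mathbb{R}^d$ be discrete (every bounded subset of $\mathbb{R}^d$ contains only finitely many of its elements); elements of $\Xi$ are called centers. An allocation of $\mathbb{R}^d$ to $\Xi$ with appetite $\alpha$ is a measurable function $\psi:\mathbb{R}^d\to\Xi\cup\{\infty,\Delta\}$ (where $\infty,\Delta$ are two extra symbols) such that $\mathcal{L}[\psi^{-1}(\Delta)]=0$ and $\mathcal{L}[\psi^{-1}(\xi)]\le\alpha$ for all $\xi\in\Xi$. The set $\psi^{-1}(\xi)$, for $\xi\in\Xi$, is the territory of $\xi$. A center $\xi$ is sated if $\mathcal{L}[\psi^{-1}(\xi)]=\alpha$ and unsated otherwise. A site $x$ is claimed if $\psi(x)\in\Xi$ and unclaimed if $\psi(x)=\infty$. Stability: let $\xi$ be a center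 and $x$ a site with $\psi(x)\notin\{\xi,\Delta\}$. We say $x$ desires $\xi$ if $|x-\xi|<|x-\psi(x)|$ or $x$ is unclaimed. We say $\xi$ covets $x$ if $|x-\xi|<|x'-\xi|$ for some $x'\in\psi^{-1}(\xi)$, or $\xi$ is unsated. The pair $(x,\xi)$ is unstable for $\psi$ if $x$ desires $\xi$ and $\xi$ covets $x$. An allocation is stable if there are no unstable pairs. Point processes: $\Pi$ has law $\mathbf{P}$. For a simple point measure $\pi$, $[\pi]=\{z\in\mathbb{R}^d:\pi(\{z\})=1\}$ is its support; the centers are $\Xi=[\Pi]$, which is a.s. discrete since the intensity (mean number of points per unit volume) is finite. A factor allocation is a measurable map $\Psi_\bullet$ (meaning $(\pi,x)\mapsto\Psi_\pi(x)$ is measurable) assigning to $\mathbf{P}$-a.e. point measure $\pi$ an allocation $\Psi_\pi$ to $[\pi]$, which is translation-equivariant: for every translation $T$ of $\mathbb{R}^d$, if $\Psi_\pi(x)=\xi$ then $\Psi_{T\pi}(Tx)=T\xi$ (with $T\infty=\infty$, $T\Delta=\Delta$, and with $\Psi_{T\pi}$ defined if and only if $\Psi_\pi$ is). It is isometry-equivariant if this holds for all isometries $T$ of $\mathbb{R}^d$. A stable factor allocation is a factor allocation such that $\Psi_\Pi$ is a.s. stable. *)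

(* Defs.v *)
From HB Require Import structures.
From mathcomp Require Import all_boot all_order all_algebra.
From mathcomp Require Import all_classical all_reals all_analysis.
From mathcomp Require Import measurable_realfun.

Set Implicit Arguments.
Unset Strict Implicit.
Unset Printing Implicit Defensive.

Import Order.TTheory GRing.Theory Num.Theory.
Import numFieldNormedType.Exports.

Local Open Scope classical_set_scope.
Local Open Scope ring_scope.

(* R^d is 'rV[R]_d with the library topology. The library norm `|x| on 'rV[R]_d
   is the sup norm: it gives the usual open and bounded sets, but distances
   below are measured with the Euclidean norm. *)
Definition euclidean_norm (R : realType) (d : nat) (x : 'rV[R]_d) : R :=
  Num.sqrt (\sum_(i < d) x 0 i ^+ 2).

Section borel.
Context (R : realType) (d : nat).

Definition borel_rV : set (set 'rV[R]_d) := <<s @open 'rV[R]_d >>.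

Let borel_rV0 : borel_rV set0.
Proof. exact: sigma_algebra0. Qed.

Let borel_rVC (A : set 'rV[R]_d) : borel_rV A -> borel_rV (~` A).
Proof. exact: sigma_algebraC. Qed.

Let borel_rVU (F : (set 'rV[R]_d)^nat) :
  (forall i, borel_rV (F i)) -> borel_rV (\bigcup_i F i).
Proof. exact: sigma_algebra_bigcup. Qed.

Definition borel_rV_display : measure_display.
Proof. by constructor. Qed.

HB.instance Definition _ := @isMeasurable.Build borel_rV_display 'rV[R]_d
  borel_rV borel_rV0 borel_rVC borel_rVU.

End borel.

(* Lebesgue measure of a Borel subset of R^d, as the iterated product of the
   one-dimensional Lebesgue measure: the volume of A in R^(n+1) is the integral
   over t of the n-dimensional volume of the section {y | (t, y) \in A}; R^0
   carries the unit mass at its only point. *)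
Fixpoint volume (R : realType) (d : nat) : set 'rV[R]_d -> \bar R :=
  match d return set 'rV[R]_d -> \bar R with
  | 0 => fun A => \d_(0 : 'rV[R]_0) A
  | n.+1 => fun A => (\int[lebesgue_measure]_(t in [set: R])
      volume [set y : 'rV[R]_n | A (row_mx (const_mx t : 'rV[R]_1) y)])%E
  end.

(* Isometries of R^d; distance-preserving self-maps of R^d are automatically
   bijective. *)
Definition isometry (R : realType) (d : nat) (T : 'rV[R]_d -> 'rV[R]_d) : Prop :=
  forall x y, euclidean_norm (T x - T y) = euclidean_norm (x - y).

Section isometry_lemmas.
Context (R : realType) (d : nat).
Implicit Types (x y : 'rV[R]_d) (T : 'rV[R]_d -> 'rV[R]_d).

Definition translation (t x : 'rV[R]_d) : 'rV[R]_d := x + t.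

Lemma isometry_translation (t : 'rV[R]_d) : isometry (translation t).
Proof. by move=> x y; rewrite /translation opprD addrACA subrr addr0. Qed.

Lemma coord_le_euclidean_norm x (i : 'I_d) : `|x 0 i| <= euclidean_norm x.
Proof.
rewrite /euclidean_norm -sqrtr_sqr ler_wsqrtr// (bigD1 i)//= lerDl.
by apply: sumr_ge0 => j _; exact: sqr_ge0.
Qed.

Lemma norm_le_euclidean_norm x : `|x| <= euclidean_norm x.
Proof.
rewrite /Num.Def.normr /= mx_normrE; apply: bigmax_le; first exact: sqrtr_ge0.
by move=> [i j] _ /=; rewrite (ord1 i); exact: coord_le_euclidean_norm.
Qed.

Lemma coord_le_norm x (i : 'I_d) : `|x 0 i| <= `|x|.
Proof.
rewrite [leRHS]/Num.Def.normr /= mx_normrE.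
exact: (le_bigmax _ (fun ij : 'I_1 * 'I_d => `|x ij.1 ij.2|) (0, i)).
Qed.

Lemma euclidean_norm_le_norm x :
  euclidean_norm x <= Num.sqrt d%:R * `|x|.
Proof.
have -> : Num.sqrt d%:R * `|x| = Num.sqrt (\sum_(i < d) `|x| ^+ 2).
  by rewrite sumr_const card_ord -(mulr_natl (_ ^+ 2)) sqrtrM ?ler0n// sqrtr_sqr normr_id.
rewrite ler_wsqrtr//; apply: ler_sum => i _.
by rewrite -real_normK ?num_real// lerXn2r ?nnegrE// coord_le_norm.
Qed.

Lemma isometry_lipschitz T x y : isometry T ->
  `|T x - T y| <= Num.sqrt d%:R * `|x - y|.
Proof.
move=> hT; apply: le_trans (norm_le_euclidean_norm _) _.
by rewrite hT; exact: euclidean_norm_le_norm.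
Qed.

Lemma isometry_expand T x y : isometry T ->
  `|x - y| <= Num.sqrt d%:R * `|T x - T y|.
Proof.
move=> hT; apply: le_trans (norm_le_euclidean_norm _) _.
by rewrite -hT; exact: euclidean_norm_le_norm.
Qed.

Lemma isometry_continuous T : isometry T -> continuous T.
Proof.
move=> hT x; apply/(@cvgrPdist_lt _ _ _ (nbhs x)) => e e0.
have k0 : 0 < Num.sqrt d%:R + 1 :> R by rewrite ltr_wpDl ?sqrtr_ge0.
near=> y.
apply: le_lt_trans (isometry_lipschitz _ _ hT) _.
apply: (@le_lt_trans _ _ ((Num.sqrt d%:R + 1) * `|x - y|)).
  by rewrite ler_wpM2r// lerDl.
rewrite mulrC -ltr_pdivlMr//; near: y.
by apply: cvgr_dist_lt; [exact: cvg_id|exact: divr_gt0].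
Unshelve. all: end_near. Qed.

Lemma isometry_measurable T : isometry T -> measurable_fun [set: 'rV[R]_d] T.
Proof.
move=> hT; apply: (measurability (@open 'rV[R]_d)) => // _ [U oU <-].
rewrite setTI; apply: sub_sigma_algebra.
by apply: open_comp => // x _; exact: isometry_continuous.
Qed.

Lemma isometry_bounded T (B : set 'rV[R]_d) :
  isometry T -> bounded_set B -> bounded_set (T @^-1` B).
Proof.
move=> hT [M [_ hM]].
exists (Num.sqrt d%:R * (M + 1 + `|T 0|)); split; first exact: num_real.
move=> N hN x BTx /=; apply: le_trans (ltW hN).
rewrite -[x in leLHS]subr0; apply: le_trans (isometry_expand _ _ hT) _.
rewrite ler_wpM2l ?sqrtr_ge0//; apply: le_trans (ler_normB _ _) _.
by rewrite lerD2r; apply: (hM (M + 1)) => //; rewrite ltrDl.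
Qed.

End isometry_lemmas.

(* Locally finite measures with values in the natural numbers. Elements of this
   type that agree on Borel sets need not be equal, but then no measurable set
   of point measures separates them. *)
Record point_measure (R : realType) (d : nat) := PointMeasure {
  point_measure_val :> {measure set 'rV[R]_d -> \bar R} ;
  point_measure_nat : forall B : set 'rV[R]_d, measurable B -> bounded_set B ->
    exists n : nat, point_measure_val B = n%:R%:E
}.

Section point_measure_measurable.
Context (R : realType) (d : nat).

Let zero_nat (B : set 'rV[R]_d) : measurable B -> bounded_set B ->
  exists n : nat, (mzero : {measure set 'rV[R]_d -> \bar R}) B = n%:R%:E.
Proof. by move=> _ _; exists 0%N. Qed.

HB.instance Definition _ := gen_eqMixin (point_measure R d).
HB.instance Definition _ := gen_choiceMixin (point_measure R d).
HB.instance Definition _ :=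
  isPointed.Build (point_measure R d) (PointMeasure zero_nat).

(* The sigma-algebra generated by the counts pi |-> pi A, A Borel. *)
Definition point_measure_measurable : set (set (point_measure R d)) :=
  <<s \bigcup_(A in [set A : set 'rV[R]_d | measurable A])
        preimage_set_system [set: point_measure R d]
          (fun pi : point_measure R d => pi A) measurable >>.

Let point_measure_measurable0 : point_measure_measurable set0.
Proof. exact: sigma_algebra0. Qed.

Let point_measure_measurableC (U : set (point_measure R d)) :
  point_measure_measurable U -> point_measure_measurable (~` U).
Proof. exact: sigma_algebraC. Qed.

Let point_measure_measurableU (F : (set (point_measure R d))^nat) :
  (forall i, point_measure_measurable (F i)) ->
  point_measure_measurable (\bigcup_i F i).
Proof. exact: sigma_algebra_bigcup. Qed.

Definition point_measure_display : measure_display.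
Proof. by constructor. Qed.

HB.instance Definition _ := @isMeasurable.Build point_measure_display
  (point_measure R d) point_measure_measurable point_measure_measurable0
  point_measure_measurableC point_measure_measurableU.

End point_measure_measurable.

Section point_measure_ops.
Context (R : realType) (d : nat).
Implicit Type pi : point_measure R d.

Definition centers pi : set 'rV[R]_d := [set z | pi [set z] = 1%E].

Definition simple_point_measure pi : Prop :=
  forall z : 'rV[R]_d, (pi [set z] <= 1)%E.

Section image.
Variables (T : 'rV[R]_d -> 'rV[R]_d) (hT : isometry T) (pi : point_measure R d).

Let mT (A : set 'rV[R]_d) : measurable A -> measurable (T @^-1` A).
Proof. by move=> mA; rewrite -[X in measurable X]setTI; exact: isometry_measurable. Qed.

Let map := pushforward pi T.

Let map0 : map set0 = 0%E.
Proof. by rewrite /map /pushforward preimage_set0 measure0. Qed.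

Let map_ge0 A : (0 <= map A)%E.
Proof. exact: (measure_ge0 (point_measure_val pi)). Qed.

Let map_sigma_additive : semi_sigma_additive map.
Proof.
move=> F mF tF mUF; rewrite /map /pushforward preimage_bigcup.
apply: measure_semi_sigma_additive.
- by move=> n; exact: mT.
- apply/trivIsetP => /= i j _ _ ij; rewrite -preimage_setI.
  by move/trivIsetP : tF => /(_ _ _ _ _ ij) ->//; rewrite preimage_set0.
- by rewrite -preimage_bigcup; exact: mT.
Qed.

HB.instance Definition _ := isMeasure.Build _ _ _ map
  map0 map_ge0 map_sigma_additive.

Let map_nat (B : set 'rV[R]_d) : measurable B -> bounded_set B ->
  exists n : nat, map B = n%:R%:E.
Proof.
by move=> mB bB; apply: point_measure_nat; [exact: mT|exact: isometry_bounded].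
Qed.

(* T pi, that is (T pi)(A) = pi(T^-1(A)). *)
Definition image_point_measure : point_measure R d := PointMeasure map_nat.

End image.

Definition translate (t : 'rV[R]_d) pi : point_measure R d :=
  image_point_measure (isometry_translation t) pi.

End point_measure_ops.

(* The values of an allocation: a center, or one of the symbols oo and Delta. *)
Inductive allotment (R : realType) (d : nat) : Type :=
  | Center of 'rV[R]_d
  | Unclaimed
  | Delta.
Arguments Unclaimed {R d}.
Arguments Delta {R d}.

Section allotment_measurable.
Context (R : realType) (d : nat).

HB.instance Definition _ := gen_eqMixin (allotment R d).
HB.instance Definition _ := gen_choiceMixin (allotment R d).
HB.instance Definition _ := isPointed.Build (allotment R d) Delta.

(* The disjoint-union sigma-algebra: the two symbols are measurable points. *)
Definition allotment_measurable : set (set (allotment R d)) :=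
  [set Y | measurable (@Center R d @^-1` Y)].

Let allotment_measurable0 : allotment_measurable set0.
Proof. by rewrite /allotment_measurable /= preimage_set0. Qed.

Let allotment_measurableC (Y : set (allotment R d)) :
  allotment_measurable Y -> allotment_measurable (~` Y).
Proof. by rewrite /allotment_measurable /= preimage_setC => /measurableC. Qed.

Let allotment_measurableU (F : (set (allotment R d))^nat) :
  (forall i, allotment_measurable (F i)) -> allotment_measurable (\bigcup_i F i).
Proof.
by move=> mF; rewrite /allotment_measurable /= preimage_bigcup; exact: bigcupT_measurable.
Qed.

Definition allotment_display : measure_display.
Proof. by constructor. Qed.

HB.instance Definition _ := @isMeasurable.Build allotment_display
  (allotment R d) allotment_measurable allotment_measurable0
  allotment_measurableC allotment_measurableU.

Definition map_allotment (T : 'rV[R]_d -> 'rV[R]_d) (v : allotment R d) :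
    allotment R d :=
  match v with
  | Center xi => Center (T xi)
  | Unclaimed => Unclaimed
  | Delta => Delta
  end.

End allotment_measurable.

Section allocations.
Context (R : realType) (d : nat).
Implicit Types (Xi : set 'rV[R]_d) (alpha : R) (psi : 'rV[R]_d -> allotment R d)
  (x xi : 'rV[R]_d).

Definition discrete_centers Xi : Prop :=
  forall B : set 'rV[R]_d, bounded_set B -> finite_set (B `&` Xi).

Definition territory psi xi : set 'rV[R]_d := psi @^-1` [set Center xi].

Definition allocation Xi alpha psi : Prop :=
  [/\ discrete_centers Xi,
      measurable_fun [set: 'rV[R]_d] psi,
      forall x xi, psi x = Center xi -> Xi xi,
      volume (psi @^-1` [set Delta]) = 0%E &
      forall xi, Xi xi -> (volume (territory psi xi) <= alpha%:E)%E].

Definition sated alpha psi xi : Prop := volume (territory psi xi) = alpha%:E.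

Definition desires psi x xi : Prop :=
  (exists2 eta, psi x = Center eta &
     euclidean_norm (x - xi) < euclidean_norm (x - eta))
  \/ psi x = Unclaimed.

Definition covets alpha psi xi x : Prop :=
  (exists2 x', territory psi xi x' &
     euclidean_norm (x - xi) < euclidean_norm (x' - xi))
  \/ ~ sated alpha psi xi.

Definition unstable_pair Xi alpha psi x xi : Prop :=
  [/\ Xi xi, psi x <> Center xi, psi x <> Delta,
      desires psi x xi & covets alpha psi xi x].

Definition stable Xi alpha psi : Prop :=
  forall x xi, ~ unstable_pair Xi alpha psi x xi.

End allocations.

Section point_processes.
Context (R : realType) (d : nat) (dOmega : measure_display)
  (Omega : measurableType dOmega) (Pr : probability Omega R)
  (Pi : {RV Pr >-> point_measure R d}).

Definition simple_process : Prop :=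
  {ae Pr, forall w, simple_point_measure (Pi w)}.

Definition translation_invariant : Prop :=
  forall (t : 'rV[R]_d) (A : set (point_measure R d)), measurable A ->
    Pr [set w | A (translate t (Pi w))] = Pr [set w | A (Pi w)].

Definition unit_cube : set 'rV[R]_d := [set x | forall i, 0 <= x 0 i < 1].

Definition intensity : \bar R := (\int[Pr]_w Pi w unit_cube)%E.

End point_processes.

(* A factor map is partially defined: dom is the set of the point measures pi
   for which Psi pi is defined, and the values of Psi outside dom are junk. *)
Section factor_allocations.
Context (R : realType) (d : nat).
Implicit Types (dom : set (point_measure R d))
  (Psi : point_measure R d -> 'rV[R]_d -> allotment R d).

Definition equivariant_under dom Psi (T : 'rV[R]_d -> 'rV[R]_d)
    (hT : isometry T) : Prop :=
  forall pi : point_measure R d,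
    (dom (image_point_measure hT pi) <-> dom pi) /\
    (dom pi -> forall x,
       Psi (image_point_measure hT pi) (T x) = map_allotment T (Psi pi x)).

Definition translation_equivariant dom Psi : Prop :=
  forall t : 'rV[R]_d, equivariant_under dom Psi (isometry_translation t).

Definition isometry_equivariant dom Psi : Prop :=
  forall (T : 'rV[R]_d -> 'rV[R]_d) (hT : isometry T),
    equivariant_under dom Psi hT.

Definition factor_allocation (P : probability (point_measure R d) R) (alpha : R)
    dom Psi : Prop :=
  [/\ measurable dom,
      {ae P, forall pi, dom pi},
      measurable_fun (dom `*` [set: 'rV[R]_d])
        (fun p : point_measure R d * 'rV[R]_d => Psi p.1 p.2),
      forall pi, dom pi -> allocation (centers pi) alpha (Psi pi) &
      translation_equivariant dom Psi].

Definition stable_factor_allocation (dOmega : measure_display)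
    (Omega : measurableType dOmega) (Pr : probability Omega R)
    (Pi : {RV Pr >-> point_measure R d}) (alpha : R) dom Psi : Prop :=
  factor_allocation (distribution Pr Pi) alpha dom Psi /\
  {ae Pr, forall w, stable (centers (Pi w)) alpha (Psi (Pi w))}.

End factor_allocations.

Definition finite_union_of_open_connected (X : topologicalType) (A : set X) :
    Prop :=
  exists F : set (set X),
    [/\ finite_set F, forall U, F U -> open U /\ connected U &
        A = \bigcup_(U in F) U].

(* Main.v *)
(* For (i) and (ii): moving an orthant outwards shrinks the event that it meets
   a lattice window with a given equivariant property, but does not change its
   probability. Hence a.s. such a property, once it holds at some window, holds
   at windows arbitrarily deep inside every orthant.

   If sites in a bounded region belong to centers tending to infinity in some
   orthant, then by stability the distances to the owners are bounded near every
   window deep inside that orthant, so by recurrence near every window. Call a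
   site r-pinched if no center closer than r owns sites farther away than it. A
   site whose owner is at distance at least r is r-pinched, r-pinched sites form
   a closed set, and they are isolated where the distances to the owners are
   less than r, because balls are strictly convex. So a convergent sequence of
   such sites is eventually constant, contradicting that the owners diverge.

   If a center owns remote sites, then these are isolated pinched sites, hence
   measurable functions of the point measure. Owning remote sites is therefore
   an event attached to windows, and it recurs in the orthant around the center
   that contains a remote site x: another such center is closer to x, and
   stability is violated.

   For (iii): in the Gale-Shapley allocation, a site belongs to y if it is within
   the acceptance radius of y and outside the acceptance radii of the centers
   that are at least as close. A bounded territory is thus a finite union of sets
   defined by finitely many inequalities c|x|^2 + a.x + b > 0. Such a set has
   finitely many components near any point p, because the inversion at p makes
   the constraints that vanish at p affine, so by compactness it has finitely
   many components. *)
Require Import Defs.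
From HB Require Import structures.
From mathcomp Require Import finmap.
From mathcomp Require Import all_boot all_order all_algebra.
From mathcomp Require Import all_classical all_reals all_analysis.
From mathcomp Require Import measurable_realfun ring lra zify.

Set Implicit Arguments.
Unset Strict Implicit.
Unset Printing Implicit Defensive.

Import Order.TTheory GRing.Theory Num.Theory.
Import numFieldNormedType.Exports.

Local Open Scope classical_set_scope.
Local Open Scope ring_scope.

(** The obstacle to boundedness is measurability. A territory may reach far out through a null set
    of sites, so volumes do not detect its remote sites, and the event that a remote site belongs to
    a center of a given window is a projection of a measurable set. Pinchedness is therefore stated
    up to null sets: at a fixed point it is an event by Fubini, and an isolated pinched site is a
    limit of rational, approximately pinched points. Recurrence is used on two levels: for
    [dominating], a volume condition implied by a center with remote sites in the window, which
    isolates such remote sites; and for [spread], the ownership of remote sites itself, which this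
    isolation reduces to a countable search.

    Isometry equivariance needs the rotation invariance of an integral iterated along the coordinate
    axes; it comes from the uniqueness of translation-invariant measures, normalized on a ball. In
    the Gale-Shapley construction, quantifiers over centers are expressed by counts of the point
    measure, again to avoid projections. *)

Section measurable_sets.
Context d (T : measurableType d) (R : realType).

Lemma measurable_lt_set (f g : T -> R) :
  measurable_fun [set: T] f -> measurable_fun [set: T] g ->
  measurable [set x | f x < g x].
Proof.
move=> mf mg; have := measurable_fun_ltr mf mg measurableT (Y := [set true]) I.
by rewrite setTI.
Qed.

Lemma measurable_le_set (f g : T -> R) :
  measurable_fun [set: T] f -> measurable_fun [set: T] g ->
  measurable [set x | f x <= g x].
Proof.
move=> mf mg; have := measurable_fun_ler mf mg measurableT (Y := [set true]) I.
by rewrite setTI.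
Qed.

Lemma measurable_eq_set (f g : T -> R) :
  measurable_fun [set: T] f -> measurable_fun [set: T] g ->
  measurable [set x | f x = g x].
Proof.
move=> mf mg.
rewrite (_ : mkset _ = [set x | f x <= g x] `&` [set x | g x <= f x]).
  by apply: measurableI; exact: measurable_le_set.
by apply/seteqP; split => x /= => [->|[fg gf]]; [|apply: le_anti; apply/andP].
Qed.

Lemma measurable_preimage d' (T' : measurableType d') (f : T -> T') (A : set T') :
  measurable_fun [set: T] f -> measurable A -> measurable (f @^-1` A).
Proof. by move=> mf mA; rewrite -[X in measurable X]setTI; exact: mf. Qed.

End measurable_sets.

(** * Measurability of maps into R^d *)

Section row_vectors.
Context (R : realType) (d : nat).
Implicit Types (x y : 'rV[R]_d).

Lemma open_measurable_rV (U : set 'rV[R]_d) : open U -> measurable U.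
Proof. exact: sub_sigma_algebra. Qed.

Lemma measurable_coord (i : 'I_d) :
  measurable_fun [set: 'rV[R]_d] (fun x => x 0 i).
Proof.
apply: (measurability _ (RGenOpens.measurableE R)) => // _ [U oU <-].
rewrite setTI; apply: open_measurable_rV.
case: oU => a [b ->].
by have /continuousP := @coord_continuous R 1 d 0 i; apply; exact: interval_open.
Qed.

Lemma norm_lt_coordP x (e : R) : 0 < e -> (`|x| < e) <-> (forall i, `|x 0 i| < e).
Proof.
move=> e0; split=> [xe i|xe]; first exact: le_lt_trans (coord_le_norm x i) xe.
rewrite /Num.Def.normr /= mx_normrE; apply: bigmax_lt => //= -[i j] _ /=.
by rewrite (ord1 i).
Qed.

Lemma norm_le_coordP x (e : R) : 0 <= e -> (`|x| <= e) <-> (forall i, `|x 0 i| <= e).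
Proof.
move=> e0; split=> [xe i|xe]; first exact: le_trans (coord_le_norm x i) xe.
rewrite /Num.Def.normr /= mx_normrE; apply: bigmax_le => //= -[i j] _ /=.
by rewrite (ord1 i).
Qed.

Definition rat_rV (q : 'rV[rat]_d) : 'rV[R]_d := map_mx ratr q.

Lemma rat_rV_dense x (e : R) : 0 < e -> exists q, `|x - rat_rV q| < e.
Proof.
move=> e0.
have /choice[q hq] : forall i : 'I_d, exists q : rat, `|x 0 i - ratr q| < e.
  move=> i; have [q] : exists q : rat, ratr q \in `]x 0 i - e, x 0 i + e[.
    by apply: rat_in_itvoo; rewrite ltrBlDr -addrA ltrDl addr_gt0.
  rewrite in_itv /= => /andP[q1 q2]; exists q.
  by rewrite ltr_distlC q1 q2.
exists (\row_i q i); apply/norm_lt_coordP => // i.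
by rewrite !mxE.
Qed.

(** An open set is the countable union of the rational sup-norm balls that it contains, and
    membership in such a ball is a finite conjunction of conditions on coordinates. *)
Lemma measurable_fun_rV d' (T : measurableType d') (D : set T) (f : T -> 'rV[R]_d) :
  (forall i, measurable_fun D (fun t => f t 0 i)) -> measurable_fun D f.
Proof.
move=> mf mD.
apply: (measurability (@open 'rV[R]_d)) => // _ [U oU <-].
pose B (p : 'rV[rat]_d * rat) := [set x : 'rV[R]_d | `|x - rat_rV p.1| < ratr p.2].
pose J := [set p : 'rV[rat]_d * rat | 0 < (ratr p.2 : R) /\ B p `<=` U].
have -> : U = \bigcup_p (if `[< J p >] then B p else set0).
  apply/seteqP; split=> [x Ux|x [p _]]; last first.
    by case: asboolP => // -[_]; apply.
  have [e /= e0 xeU] : exists2 e : R, 0 < e & ball x e `<=` U.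
    by apply/nbhs_ballP; exact: open_nbhs_nbhs.
  have [r] : exists r : rat, ratr r \in `]0 : R, e / 2[.
    by apply: rat_in_itvoo; rewrite divr_gt0.
  rewrite in_itv /= => /andP[r0 re].
  have [q xq] := rat_rV_dense x r0.
  exists (q, r) => //; rewrite asboolT; first exact: xq.
  split=> // y /= yq; apply: xeU; rewrite -ball_normE /ball_ /=.
  rewrite (splitr e) -(subrK (rat_rV q) x) -addrA.
  apply: le_lt_trans (ler_normD _ _) _; rewrite ltrD //.
    exact: lt_trans xq re.
  by rewrite distrC; exact: lt_trans yq re.
rewrite preimage_bigcup setI_bigcupr.
apply: countable_bigcupT_measurable => [|p]; first exact: countableP.
case: asboolP => [[p0 _]|_]; last by rewrite preimage_set0 setI0.
(* The last factor [D] matters for dimension 0, where the intersection runs over no index. *)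
have -> : D `&` f @^-1` B p = \bigcap_i (D `&`
    [set t | `|f t 0 i - ratr (p.1 0 i)| < ratr p.2]) `&` D.
  apply/seteqP; split=> [t [Dt /norm_lt_coordP/= h]|t [/= h Dt]].
    by split=> // i _; split=> //; have := h p0 i; rewrite !mxE.
  by split=> //; apply/norm_lt_coordP => // i; rewrite !mxE; have [] := h i I.
apply: measurableI => //; apply: fin_bigcap_measurable => // i _.
have m1 : measurable_fun D (fun t => `|f t 0 i - ratr (p.1 0 i)|).
  apply: measurableT_comp => //; exact: measurable_funB.
have m2 : measurable_fun D (fun _ : T => ratr p.2 : R) by exact: measurable_cst.
by have := measurable_fun_ltr m1 m2 mD (Y := [set true]) I.
Qed.

End row_vectors.

(** * Volume and its isometry invariance *)

Section volume_measure.
Context (R : realType).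

Definition cons_rV n (p : measurableTypeR R * 'rV[R]_n) : 'rV[R]_n.+1 :=
  row_mx (const_mx p.1 : 'rV[R]_1) p.2.

Definition uncons_rV n (x : 'rV[R]_n.+1) : measurableTypeR R * 'rV[R]_n :=
  (x 0 0, \row_i x 0 (lift 0 i)).

Lemma cons_rV0 n (p : measurableTypeR R * 'rV[R]_n) : cons_rV p 0 0 = p.1.
Proof.
have e : (0 : 'I_(1 + n)) = lshift n 0 by exact/val_inj.
by have := row_mxEl (const_mx p.1 : 'rV[R]_1) p.2 0 0; rewrite -e /cons_rV => ->; rewrite mxE.
Qed.

Lemma cons_rVS n (p : measurableTypeR R * 'rV[R]_n) i :
  cons_rV p 0 (lift 0 i) = p.2 0 i.
Proof.
have e : (lift 0 i : 'I_(1 + n)) = rshift 1 i by exact/val_inj.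
by have := row_mxEr (const_mx p.1 : 'rV[R]_1) p.2 0 i; rewrite -e.
Qed.

Lemma cons_rVK n : cancel (@cons_rV n) (@uncons_rV n).
Proof.
move=> p; rewrite /uncons_rV cons_rV0; case: p => t y /=; congr pair.
by apply/rowP => i; rewrite mxE cons_rVS.
Qed.

Lemma measurable_cons_rV n : measurable_fun [set: _] (@cons_rV n).
Proof.
apply: measurable_fun_rV => i; case: (unliftP 0 i) => [j|] ->.
  rewrite (_ : (fun _ => _) = (fun y : 'rV[R]_n => y 0 j) \o snd); last first.
    by apply/funext => p /=; rewrite cons_rVS.
  exact: measurableT_comp (measurable_coord _) measurable_snd.
rewrite (_ : (fun _ => _) = fst); last by apply/funext => p; rewrite cons_rV0.
exact: measurable_fst.
Qed.

Lemma measurable_uncons_rV n : measurable_fun [set: _] (@uncons_rV n).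
Proof.
apply/measurable_fun_pairP; split; first exact: measurable_coord.
apply: measurable_fun_rV => i.
apply: (eq_measurable_fun (fun x : 'rV[R]_n.+1 => x 0 (lift 0 i))).
  by move=> x _; rewrite /= mxE.
exact: measurable_coord.
Qed.

Section volumeS.
Context (n : nat) (m : {sigma_finite_measure set 'rV[R]_n -> \bar R}).

Definition volumeS := pushforward (lebesgue_measure \x m)%E (@cons_rV n).

Let mcons A : measurable A -> measurable (@cons_rV n @^-1` A).
Proof. by apply: measurable_preimage; exact: measurable_cons_rV. Qed.

Let volumeS0 : volumeS set0 = 0%E.
Proof. by rewrite /volumeS /pushforward preimage_set0 measure0. Qed.

Let volumeS_ge0 A : (0 <= volumeS A)%E.
Proof. exact: measure_ge0. Qed.

Let volumeS_semi_sigma_additive : semi_sigma_additive volumeS.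
Proof.
move=> F mF tF mUF; rewrite /volumeS /pushforward preimage_bigcup.
apply: measure_semi_sigma_additive.
- by move=> i; exact: mcons.
- apply/trivIsetP => /= i j _ _ ij; rewrite -preimage_setI.
  by move/trivIsetP : tF => /(_ _ _ _ _ ij) ->//; rewrite preimage_set0.
- by rewrite -preimage_bigcup; exact: mcons.
Qed.

HB.instance Definition _ := isMeasure.Build _ _ _ volumeS
  volumeS0 volumeS_ge0 volumeS_semi_sigma_additive.

Let volumeS_sigma_finite : sigma_finite setT volumeS.
Proof.
have /sigma_finiteP[F [TF ndF Foo]] := sigma_finiteT (@lebesgue_measure R).
have /sigma_finiteP[G [TG ndG Goo]] := sigma_finiteT m.
exists (fun k => @uncons_rV n @^-1` (F k `*` G k)).
  rewrite -preimage_bigcup (_ : \bigcup_k (F k `*` G k) = setT) ?preimage_setT //.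
  rewrite -subTset => -[t y] _.
  have [k _ Fk] : (\bigcup_k F k) t by rewrite -TF.
  have [l _ Gl] : (\bigcup_k G k) y by rewrite -TG.
  exists (maxn k l) => //; split.
    by move: t Fk; apply/subsetPset/ndF/leq_maxl.
  by move: y Gl; apply/subsetPset/ndG/leq_maxr.
move=> k; have [mF Fk] := Foo k; have [mG Gk] := Goo k; split.
  apply: measurable_preimage; first exact: measurable_uncons_rV.
  exact: measurableX.
rewrite /volumeS /pushforward -comp_preimage (_ : _ \o _ = id); last first.
  by apply/funext => p /=; rewrite cons_rVK.
by rewrite preimage_id product_measure1E// lte_mul_pinfty// ge0_fin_numE.
Qed.

HB.instance Definition _ := Measure_isSigmaFinite.Build _ _ _ volumeS
  volumeS_sigma_finite.

End volumeS.

(** Induction on the dimension: the sections of a set pulled back along [cons_rV] are those in the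
    recursive clause of [volume], so the image of the product measure computes it. *)
Lemma volume_measure_ex n : exists m : {sigma_finite_measure set 'rV[R]_n -> \bar R},
  forall A, measurable A -> volume A = m A.
Proof.
elim: n => [|n [m mE]].
  by exists (\d_(0 : 'rV[R]_0)).
exists (volumeS m) => A mA /=.
rewrite /volumeS /pushforward.
rewrite /product_measure1 /=; apply: eq_integral => t _ /=.
have -> : [set y : 'rV[R]_n | A (row_mx (const_mx t : 'rV[R]_1) y)] =
    xsection (@cons_rV n @^-1` A) t.
  by apply/seteqP; split => y; rewrite /xsection /= inE.
apply: mE; apply: measurable_xsection.
by apply: measurable_preimage => //; exact: measurable_cons_rV.
Qed.

(* [volume] itself is only known to be a measure on Borel sets. *)
Definition vol n : {sigma_finite_measure set 'rV[R]_n -> \bar R} :=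
  projT1 (cid (volume_measure_ex n)).

Lemma volumeE n (A : set 'rV[R]_n) : measurable A -> volume A = vol n A.
Proof. by rewrite /vol; case: cid => m /= mE; exact: mE. Qed.

Lemma volS n (A : set 'rV[R]_n.+1) : measurable A ->
  vol n.+1 A = (lebesgue_measure \x vol n)%E (@cons_rV n @^-1` A).
Proof.
move=> mA; rewrite -volumeE //= /product_measure1; apply: eq_integral => t _ /=.
have -> : [set y : 'rV[R]_n | A (row_mx (const_mx t : 'rV[R]_1) y)] =
    xsection (@cons_rV n @^-1` A) t.
  by apply/seteqP; split => y; rewrite /xsection /= inE.
apply: volumeE; apply: measurable_xsection.
by apply: measurable_preimage => //; exact: measurable_cons_rV.
Qed.

Lemma vol0E (A : set 'rV[R]_0) : measurable A -> vol 0 A = \d_(0 : 'rV[R]_0) A.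
Proof. by move=> mA; rewrite -volumeE. Qed.

End volume_measure.

(* The measure structure of [pushforward m f] depends on the measurability proof,
   so it cannot be inferred from the bare function. *)
Definition image_measure d1 d2 (T1 : measurableType d1) (T2 : measurableType d2)
    (R : realType) (m : {measure set T1 -> \bar R}) (f : T1 -> T2)
    (mf : measurable_fun [set: T1] f) : {measure set T2 -> \bar R} :=
  measure_function_pushforward__canonical__measure_function_Measure m mf.

(** * Euclidean geometry and the affine form of isometries *)

Section dot_product.
Context (R : realType) (d : nat).
Implicit Types (u v w x y : 'rV[R]_d).

Definition dotp u v : R := \sum_(i < d) u 0 i * v 0 i.

Lemma dotpC u v : dotp u v = dotp v u.
Proof. by apply: eq_bigr => i _; rewrite mulrC. Qed.

Lemma dotpDl u v w : dotp (u + v) w = dotp u w + dotp v w.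
Proof. by rewrite -big_split; apply: eq_bigr => i _; rewrite mxE mulrDl. Qed.

Lemma dotpZl (a : R) u v : dotp (a *: u) v = a * dotp u v.
Proof. by rewrite mulr_sumr; apply: eq_bigr => i _; rewrite mxE mulrA. Qed.

Lemma dotpNl u v : dotp (- u) v = - dotp u v.
Proof. by rewrite -scaleN1r dotpZl mulN1r. Qed.

Lemma dotpBl u v w : dotp (u - v) w = dotp u w - dotp v w.
Proof. by rewrite dotpDl dotpNl. Qed.

Lemma dotpDr u v w : dotp w (u + v) = dotp w u + dotp w v.
Proof. by rewrite !(dotpC w) dotpDl. Qed.

Lemma dotpZr (a : R) u v : dotp u (a *: v) = a * dotp u v.
Proof. by rewrite !(dotpC u) dotpZl. Qed.

Lemma dotpNr u v : dotp u (- v) = - dotp u v.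
Proof. by rewrite !(dotpC u) dotpNl. Qed.

Lemma dotpBr u v w : dotp w (u - v) = dotp w u - dotp w v.
Proof. by rewrite dotpDr dotpNr. Qed.

Lemma dot0p u : dotp 0 u = 0.
Proof. by rewrite -(scale0r 0) dotpZl mul0r. Qed.

Lemma dotpp_ge0 u : 0 <= dotp u u.
Proof. by apply: sumr_ge0 => i _; rewrite -expr2 sqr_ge0. Qed.

Lemma dotpp_eq0 u : dotp u u = 0 -> u = 0.
Proof.
move=> /eqP; rewrite psumr_eq0 => [/allP h|i _]; last by rewrite -expr2 sqr_ge0.
apply/rowP => i; rewrite mxE; apply/eqP; rewrite -[_ == _]orbb -mulf_eq0.
by apply: h; rewrite mem_index_enum.
Qed.

Lemma dotpp_gt0 u : u != 0 -> 0 < dotp u u.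
Proof.
by move=> u0; rewrite lt_neqAle dotpp_ge0 andbT eq_sym; apply: contra_neq u0;
  exact: dotpp_eq0.
Qed.

Lemma euclidean_normE u : euclidean_norm u = Num.sqrt (dotp u u).
Proof. by congr Num.sqrt; apply: eq_bigr => i _; rewrite expr2. Qed.

Lemma euclidean_norm_ge0 u : 0 <= euclidean_norm u.
Proof. exact: sqrtr_ge0. Qed.

Lemma sqr_euclidean_norm u : euclidean_norm u ^+ 2 = dotp u u.
Proof. by rewrite euclidean_normE sqr_sqrtr // dotpp_ge0. Qed.

Lemma euclidean_norm0 : euclidean_norm (0 : 'rV[R]_d) = 0.
Proof. by rewrite euclidean_normE dot0p sqrtr0. Qed.

Lemma euclidean_normN u : euclidean_norm (- u) = euclidean_norm u.
Proof. by rewrite !euclidean_normE dotpNl dotpNr opprK. Qed.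

Lemma euclidean_distC u v : euclidean_norm (u - v) = euclidean_norm (v - u).
Proof. by rewrite -euclidean_normN opprB. Qed.

Lemma euclidean_norm_eq0 u : euclidean_norm u = 0 -> u = 0.
Proof. by move=> u0; apply: dotpp_eq0; rewrite -sqr_euclidean_norm u0 expr0n. Qed.

Lemma euclidean_norm_leE u v :
  (euclidean_norm u <= euclidean_norm v) = (dotp u u <= dotp v v).
Proof.
by rewrite -!sqr_euclidean_norm ler_pXn2r // nnegrE euclidean_norm_ge0.
Qed.

Lemma euclidean_norm_ltE u v :
  (euclidean_norm u < euclidean_norm v) = (dotp u u < dotp v v).
Proof.
by rewrite -!sqr_euclidean_norm ltr_pXn2r // nnegrE euclidean_norm_ge0.
Qed.

Lemma dotp_le_norm u v : dotp u v <= euclidean_norm u * euclidean_norm v.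
Proof.
have [->|v0] := eqVneq v 0; first by rewrite dotpC dot0p euclidean_norm0 mulr0.
have vv : 0 < dotp v v := dotpp_gt0 v0.
apply: le_trans (ler_norm _) _.
rewrite -(@ler_pXn2r _ 2) ?nnegrE ?mulr_ge0 ?euclidean_norm_ge0 //.
rewrite exprMn !sqr_euclidean_norm real_normK ?num_real //.
have := dotpp_ge0 (dotp v v *: u - dotp u v *: v).
rewrite dotpBl !dotpBr !dotpZl !dotpZr (dotpC v u).
set a := dotp u u; set b := dotp u v; set c := dotp v v in vv *.
have -> : c * (c * a) - c * (b * b) - (b * (c * b) - b * (b * c)) =
  c * (a * c - b ^+ 2) by ring.
by rewrite pmulr_rge0 // subr_ge0.
Qed.

Lemma euclidean_normD u v :
  euclidean_norm (u + v) <= euclidean_norm u + euclidean_norm v.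
Proof.
rewrite -(@ler_pXn2r _ 2) ?nnegrE ?addr_ge0 ?euclidean_norm_ge0 //.
rewrite sqrrD !sqr_euclidean_norm dotpDl !dotpDr (dotpC v u).
have := dotp_le_norm u v; set a := dotp u u; set b := dotp u v; set c := dotp v v.
set e := _ * _; lra.
Qed.

Lemma euclidean_dist_triangle u v w :
  euclidean_norm (u - w) <= euclidean_norm (u - v) + euclidean_norm (v - w).
Proof. by apply: le_trans (euclidean_normD _ _); rewrite addrA subrK. Qed.

Lemma dotpp_sum_sqr u v :
  dotp (u - v) (u - v) = dotp u u - 2 * dotp u v + dotp v v.
Proof. by rewrite dotpBl !dotpBr (dotpC v u); ring. Qed.

Lemma dotpE_dist u v :
  dotp u v = (dotp u u + dotp v v - dotp (u - v) (u - v)) / 2.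
Proof. by rewrite dotpp_sum_sqr; field. Qed.

Lemma continuous_dotp u : continuous (dotp u).
Proof.
move=> x; apply: (@cvg_big _ _ _ _ _ _ _ (nbhs x)) => [|i _]; first exact: add_continuous.
apply: cvgM; first exact: cvg_cst.
exact: coord_continuous.
Qed.

Lemma continuous_euclidean_dist u : continuous (fun x => euclidean_norm (x - u)).
Proof.
move=> x; have k0 : 0 < Num.sqrt d%:R + 1 :> R by rewrite ltr_wpDl ?sqrtr_ge0.
apply/(@cvgrPdist_lt _ _ _ (nbhs x)) => e e0; near=> y.
have : euclidean_norm (x - y) < e.
  apply: le_lt_trans (euclidean_norm_le_norm _) _.
  apply: (@le_lt_trans _ _ ((Num.sqrt d%:R + 1) * `|x - y|)).
    by rewrite ler_wpM2r// lerDl.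
  rewrite mulrC -ltr_pdivlMr//; near: y.
  by apply: cvgr_dist_lt; [exact: cvg_id|exact: divr_gt0].
have := euclidean_dist_triangle x y u; have := euclidean_dist_triangle y x u.
rewrite (euclidean_distC y x) ltr_norml; move=> h1 h2 h3.
apply/andP; split; lra.
Unshelve. all: end_near. Qed.

End dot_product.

Section isometries.
Context (R : realType) (d : nat).
Implicit Types (x y : 'rV[R]_d) (T : 'rV[R]_d -> 'rV[R]_d).

(** By polarization the centered map preserves dot products. It is therefore determined by the
    images of the standard basis, which are the rows of an orthogonal matrix. *)
Lemma isometry_affine T : Defs.isometry T ->
  exists M : 'M[R]_d, M *m M^T = 1%:M /\ forall x, T x = x *m M + T 0.
Proof.
move=> hT; pose L x := T x - T 0.
have LB x y : dotp (L x - L y) (L x - L y) = dotp (x - y) (x - y).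
  rewrite -!sqr_euclidean_norm -(hT x y); congr (euclidean_norm _ ^+ 2).
  by rewrite /L opprB addrA subrK.
have L0 : L 0 = 0 by rewrite /L subrr.
have LL x : dotp (L x) (L x) = dotp x x.
  by have := LB x 0; rewrite L0 !subr0.
have Ldot x y : dotp (L x) (L y) = dotp x y.
  by rewrite dotpE_dist LB !LL -dotpE_dist.
pose M : 'M[R]_d := \matrix_i L (delta_mx 0 i).
have rowM i : row i M = L (delta_mx 0 i) by rewrite rowK.
have dd x (i : 'I_d) : dotp x (delta_mx 0 i) = x 0 i.
  rewrite /dotp (bigD1 i) //= mxE !eqxx mulr1 big1 ?addr0 // => j ji.
  by rewrite mxE (negbTE ji) andbF mulr0.
have LM x : L x *m M^T = x.
  apply/rowP => i; rewrite mxE -[RHS]dd -Ldot; apply: eq_bigr => j _.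
  by congr (_ * _); rewrite -rowM !mxE.
have MM : M *m M^T = 1%:M.
  by apply/row_matrixP => i; rewrite row_mul rowM LM row1.
exists M; split=> // x; apply/eqP; rewrite -subr_eq; apply/eqP.
by rewrite -/(L x) -[in RHS](LM x) -mulmxA (mulmx1C MM) mulmx1.
Qed.

Lemma isometry_surj T : Defs.isometry T -> forall y, exists x, T x = y.
Proof.
move=> /isometry_affine[M [MM hT]] y; exists ((y - T 0) *m M^T).
by rewrite hT -mulmxA (mulmx1C MM) mulmx1 subrK.
Qed.

Lemma isometry_inj T : Defs.isometry T -> injective T.
Proof.
move=> hT x y e; apply/eqP; rewrite -subr_eq0; apply/eqP/euclidean_norm_eq0.
by rewrite -hT e subrr euclidean_norm0.
Qed.

End isometries.

Section volume_theory.
Context (R : realType).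

Definition cube n (k : R) : set 'rV[R]_n := [set x | forall i, (- k <= x 0 i <= k)].
Arguments cube : clear implicits.

Lemma measurable_cube n k : measurable (cube n k).
Proof.
rewrite (_ : cube n k = \bigcap_i
    ([set x | (- k <= x 0 i)] `&` [set x | (x 0 i <= k)])).
  apply: fin_bigcap_measurable => // i _; apply: measurableI;
    apply: measurable_le_set; try exact: measurable_cst; exact: measurable_coord.
apply/seteqP; split=> x /= h i => [_|]; first by apply/andP; exact: h.
by apply/andP; have := h i Logic.I.
Qed.

Lemma cons_cube n k : @cons_rV R n @^-1` (cube n.+1 k) =
  `[(- k), k]%classic `*` cube n k.
Proof.
apply/seteqP; split => [[t y] /= h|[t y] /= [ht h] i].
  split; first by have := h 0; rewrite cons_rV0 in_itv.
  by move=> i; have := h (lift 0 i); rewrite cons_rVS.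
by case: (unliftP 0 i) => [j|] ->; rewrite ?cons_rV0 ?cons_rVS //= -in_itv.
Qed.

Lemma vol_cube n k : (0 < k) -> exists2 r : R, (0 < r) & vol R n (cube n k) = r%:E.
Proof.
move=> k0; elim: n => [|n [r r0 IH]].
  exists 1 => //; rewrite vol0E; last exact: measurable_cube.
  by rewrite diracE mem_set // => -[].
exists ((k + k) * r); first by rewrite mulr_gt0 // addr_gt0.
rewrite volS; last exact: measurable_cube.
rewrite cons_cube product_measure1E //; last exact: measurable_cube.
rewrite IH /= lebesgue_measure_itv /= lte_fin gtrN // EFinM.
by rewrite -EFinB opprK.
Qed.

Lemma bounded_cube n (A : set 'rV[R]_n) : bounded_set A ->
  exists2 k, (0 < k) & A `<=` cube n k.
Proof.
move=> [M [_ hM]]; exists (Num.max 1 (M + 1)); first by rewrite lt_max ltr01.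
move=> x Ax i; rewrite -ler_norml; apply: le_trans (coord_le_norm x i) _.
by apply: (hM _ _ x Ax); rewrite lt_max ltrDl ltr01 orbT.
Qed.

Lemma vol_bounded n (A : set 'rV[R]_n) : measurable A -> bounded_set A ->
  (vol R n A < +oo)%E.
Proof.
move=> mA /bounded_cube[k k0 Ak]; have [r _ rE] := vol_cube n k0.
apply: le_lt_trans (ltry r); rewrite -rE.
by apply: le_measure => //; rewrite inE //; exact: measurable_cube.
Qed.

Lemma lebesgue_translate (a : R) (A : set (measurableTypeR R)) : measurable A ->
  lebesgue_measure ((fun t : measurableTypeR R => (t + a)) @^-1` A) = lebesgue_measure A.
Proof.
have mf : measurable_fun [set: measurableTypeR R] (fun t => (t + a) : measurableTypeR R).
  exact: measurable_funD.
move=> mA; apply/esym; apply: (lebesgue_measure_unique (mu := image_measure lebesgue_measure mf)) mA.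
move=> _ [[x y] /= _ <-]; rewrite /pushforward.
rewrite (_ : _ @^-1` _ = `](x - a), (y - a)]%classic); last first.
  by apply/seteqP; split => t /=; rewrite !in_itv /= ltrBlDr lerBrDr.
by rewrite !lebesgue_measure_itv /= !lte_fin ltrD2r -!EFinB opprB addrA subrK.
Qed.

Lemma measurable_translate n (a : 'rV[R]_n) :
  measurable_fun [set: 'rV[R]_n] (fun x => x + a).
Proof. exact: (isometry_measurable (isometry_translation a)). Qed.

Lemma vol_translate n (a : 'rV[R]_n) (A : set 'rV[R]_n) : measurable A ->
  vol R n ((fun x => x + a) @^-1` A) = vol R n A.
Proof.
elim: n => [|n IH] in a A *.
  move=> mA; rewrite (_ : (fun _ => _) = id) ?preimage_id //.
  by apply/funext => x; apply/rowP => -[].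
move=> mA.
have mAa : measurable ((fun x => x + a) @^-1` A).
  exact: measurable_preimage (measurable_translate a) mA.
have mcA : measurable (@cons_rV R n @^-1` A).
  exact: measurable_preimage (@measurable_cons_rV R n) mA.
have mf : measurable_fun [set: measurableTypeR R]
    (fun t => (t + a 0 0) : measurableTypeR R) by exact: measurable_funD.
rewrite !volS // /product_measure1.
pose g (t : measurableTypeR R) := vol R n (xsection (@cons_rV R n @^-1` A) t).
transitivity (\int[lebesgue_measure]_(t in [set: measurableTypeR R])
    (g \o (fun t => t + a 0 0)%R) t)%E.
  apply: eq_integral => t _; rewrite /g /=.
  rewrite -[RHS](IH (\row_i a 0 (lift 0 i))); last exact: measurable_xsection.
  have e y : cons_rV (t + a 0 0, y + \row_i a 0 (lift 0 i)) = cons_rV (t, y) + a.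
    apply/rowP => i.
    by case: (unliftP 0 i) => [k|] ->; rewrite [RHS]mxE !(cons_rV0,cons_rVS) //= !mxE.
  by congr (vol R n _); apply/seteqP; split => y; rewrite /xsection /= !inE /= e.
have mg : measurable_fun [set: measurableTypeR R] g by exact: measurable_fun_xsection.
have -> : (\int[lebesgue_measure]_(t in [set: measurableTypeR R])
    (g \o (fun t => t + a 0 0)%R) t =
    \int[image_measure lebesgue_measure mf]_(t in [set: measurableTypeR R]) g t)%E.
  rewrite -[X in (\int[_]_(t in X) _)%E](preimage_setT (fun t : R => t + a 0 0)).
  by apply/esym/ge0_integral_pushforward => // t _; exact: measure_ge0.
transitivity (\int[lebesgue_measure]_(t in [set: measurableTypeR R]) g t)%E.
  by apply: eq_measure_integral => B mB _; exact: lebesgue_translate.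
by [].
Qed.

End volume_theory.

(** * Spheres and bisectors are null sets *)

Section null_quadrics.
Context (R : realType).

(** A common form for spheres (c = 1) and bisecting hyperplanes (c = 0) that is stable under fixing
    the first coordinate, as the induction on the dimension requires. *)
Definition quadric n (c : R) (a : 'rV[R]_n) (b : R) : set 'rV[R]_n :=
  [set x | c * dotp x x + dotp a x = b].

Lemma measurable_dotp n (u : 'rV[R]_n) : measurable_fun [set: 'rV[R]_n] (dotp u).
Proof.
apply: measurable_sum => i; apply: measurable_funM => //.
exact: measurable_coord.
Qed.

Lemma measurable_dotpp n d (T : measurableType d) (f g : T -> 'rV[R]_n) :
  measurable_fun [set: T] f -> measurable_fun [set: T] g ->
  measurable_fun [set: T] (fun x => dotp (f x) (g x)).
Proof.
move=> mf mg; apply: measurable_sum => i; apply: measurable_funM.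
  exact: measurableT_comp (measurable_coord i) mf.
exact: measurableT_comp (measurable_coord i) mg.
Qed.

Lemma measurable_quadric n c (a : 'rV[R]_n) b : measurable (quadric c a b).
Proof.
apply: measurable_eq_set; last exact: measurable_cst.
apply: measurable_funD; last exact: measurable_dotp.
by apply: measurable_funM => //; exact: measurable_dotpp.
Qed.

Lemma dotp_cons n (u : 'rV[R]_n.+1) (p : measurableTypeR R * 'rV[R]_n) :
  dotp u (cons_rV p) = u 0 0 * p.1 + dotp (\row_i u 0 (lift 0 i)) p.2.
Proof.
rewrite /dotp big_ord_recl cons_rV0; congr (_ + _).
by apply: eq_bigr => i _; rewrite cons_rVS mxE.
Qed.

Lemma xsection_quadric n c (a : 'rV[R]_n.+1) b t :
  xsection (@cons_rV R n @^-1` quadric c a b) t =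
  quadric c (\row_i a 0 (lift 0 i)) (b - c * t ^+ 2 - a 0 0 * t).
Proof.
apply/seteqP; split => y; rewrite /xsection /quadric /= !inE /= !dotp_cons cons_rV0 /=.
  set v := (\row_i cons_rV _ _ _); have -> : v = y.
    by apply/rowP => i; rewrite mxE cons_rVS.
  by move=> <-; ring.
set v := (\row_i cons_rV _ _ _); have -> : v = y.
  by apply/rowP => i; rewrite mxE cons_rVS.
have {2}-> : b = b - c * t ^+ 2 - a 0 0 * t + c * t ^+ 2 + a 0 0 * t by ring.
by move=> <-; ring.
Qed.

Lemma roots_quadratic0 (c a b : R) : (c != 0) || (a != 0) ->
  lebesgue_measure ([set t | c * t ^+ 2 + a * t = b] : set (measurableTypeR R)) = 0%E.
Proof.
move=> ca; have [[t1 ht1]|/set0P/negP/negPn/eqP ->] :=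
  pselect ([set t | c * t ^+ 2 + a * t = b] !=set0); last exact: measure0.
apply: countable_lebesgue_measure0; apply: finite_set_countable.
(* The second root by Vieta; for c = 0 the division returns 0 and the extra element is harmless. *)
apply: (@sub_finite_set _ _ [set t1; - a / c - t1]) => [t /= ht|].
  have : (t - t1) * (c * (t + t1) + a) = 0.
    transitivity (c * t ^+ 2 + a * t - (c * t1 ^+ 2 + a * t1)); first by ring.
    by rewrite ht ht1 subrr.
  move=> /eqP; rewrite mulf_eq0 subr_eq0 => /orP[/eqP|/eqP h]; first by left.
  right; have c0 : c != 0.
    by apply: contraL ca => /eqP c0; move: h; rewrite c0 mul0r add0r => ->; rewrite eqxx.
  apply: (mulfI c0); rewrite mulrBr mulrCA divff // mulr1.
  by apply/eqP; rewrite eq_sym subr_eq -mulrDr; apply/eqP; rewrite -[RHS]addr0 -(subrr a) addrA h sub0r.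
exact: finite_set2.
Qed.

(** When the equation involves only the first coordinate, the sections are empty except over the
    roots of a polynomial in one variable. *)
Lemma vol_quadric_degenerate n c (a : 'rV[R]_n.+1) b :
  (c != 0) || (a 0 0 != 0) ->
  (forall y, c * dotp y y + dotp (\row_i a 0 (lift 0 i)) y = 0) ->
  vol R n.+1 (quadric c a b) = 0%E.
Proof.
move=> ca h; rewrite volS; last exact: measurable_quadric.
pose Z : set (measurableTypeR R) := [set t | c * t ^+ 2 + a 0 0 * t = b].
have mZ : measurable Z.
  by apply: measurable_eq_set => //; apply: measurable_funD; apply: measurable_funM.
rewrite /product_measure1 (ae_eq_integral (cst 0%E)) //.
- exact: integral0.
- apply: measurable_fun_xsection.
  exact: measurable_preimage (@measurable_cons_rV R n) (measurable_quadric _ _ _).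
- exists Z; split=> //; first exact: roots_quadratic0.
  move=> t /=; rewrite not_implyE => -[_]; apply: contra_notP => tZ.
  rewrite xsection_quadric (_ : quadric _ _ _ = set0) ?measure0 // -subset0 => y.
  rewrite /quadric /= h => e; apply: tZ; rewrite /Z /=.
  have -> : b = b - c * t ^+ 2 - a 0 0 * t + c * t ^+ 2 + a 0 0 * t by ring.
  by rewrite -e add0r.
Qed.

(** Each section along the first coordinate is a quadric with the same c and the truncated a. Either
    these are nondegenerate, hence null by induction, or only the first coordinate occurs. *)
Lemma vol_quadric n c (a : 'rV[R]_n.+1) b : (c != 0) || (a != 0) ->
  vol R n.+1 (quadric c a b) = 0%E.
Proof.
elim: n => [|n IH] in c a b * => ca.
  apply: vol_quadric_degenerate => [|y]; last first.
    by rewrite /dotp !big_ord0 mulr0 addr0.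
  case/orP: ca => [->//|a0]; apply/orP; right; apply: contra_neq a0 => a0.
  by apply/rowP => i; rewrite (ord1 i) mxE.
have [ca'|ca'] := boolP ((c == 0) && (\row_i a 0 (lift 0 i) == 0)).
  apply: vol_quadric_degenerate => [|y]; last first.
    by case/andP: ca' => /eqP-> /eqP->; rewrite mul0r dot0p addr0.
  case/orP: ca => [->//|a0]; apply/orP; right; apply: contra_neq a0 => a0.
  case/andP: ca' => _ /eqP/rowP h; apply/rowP => i.
  by case: (unliftP 0 i) => [j|] ->; [have := h j; rewrite !mxE|rewrite mxE].
rewrite volS; last exact: measurable_quadric.
apply: integral0_eq => t _ /=; rewrite xsection_quadric; apply: IH.
by rewrite negb_and in ca'.
Qed.

Lemma vol_sphere n (y : 'rV[R]_n.+1) r :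
  vol R n.+1 [set x | euclidean_norm (x - y) = r] = 0%E.
Proof.
rewrite (_ : mkset _ = if 0 <= r then quadric 1 (- 2 *: y) (r ^+ 2 - dotp y y) else set0).
  by case: ifP => _; rewrite ?measure0// vol_quadric// oner_eq0.
case: ifP => [r0|/negbT r0]; apply/seteqP; split=> x //=.
- by move=> <-; rewrite sqr_euclidean_norm /quadric /= dotpp_sum_sqr dotpZl (dotpC y); ring.
- rewrite /quadric /= dotpZl => h; apply/eqP; rewrite -(@eqrXn2 _ 2) ?euclidean_norm_ge0 //.
  rewrite sqr_euclidean_norm dotpp_sum_sqr (dotpC x); apply/eqP.
  have -> : r ^+ 2 = r ^+ 2 - dotp y y + dotp y y by ring.
  by rewrite -h; ring.
- by move=> xr; move: r0; rewrite -xr euclidean_norm_ge0.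
Qed.

Lemma vol_bisector n (y z : 'rV[R]_n.+1) : y != z ->
  vol R n.+1 [set x | euclidean_norm (x - y) = euclidean_norm (x - z)] = 0%E.
Proof.
move=> yz.
rewrite (_ : mkset _ = quadric 0 (2 *: (z - y)) (dotp z z - dotp y y)).
  rewrite vol_quadric// eqxx /= scaler_eq0 negb_or subr_eq0 (eq_sym z) yz.
  by rewrite pnatr_eq0.
have e x : (euclidean_norm (x - y) = euclidean_norm (x - z)) <->
    dotp (x - y) (x - y) = dotp (x - z) (x - z).
  by split=> [h|h]; [rewrite -!sqr_euclidean_norm h|rewrite !euclidean_normE h].
apply/seteqP; split=> x /=; rewrite e !dotpp_sum_sqr /quadric /= dotpZl dotpBl
  (dotpC y) (dotpC z) => h; lra.
Qed.

End null_quadrics.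

(** * Uniqueness of translation-invariant measures *)

Section haar_uniqueness.
Context (R : realType) (n : nat).
Implicit Types (A B : set 'rV[R]_n) (m : {sigma_finite_measure set 'rV[R]_n -> \bar R}).

Lemma measurable_opprV : measurable_fun [set: 'rV[R]_n] -%R.
Proof.
apply: measurable_fun_rV => i.
apply: (eq_measurable_fun (fun y : 'rV[R]_n => - y 0 i)) => [y _|].
  by rewrite mxE.
by apply: measurable_funN; exact: measurable_coord.
Qed.

Lemma measurable_addrV : measurable_fun [set: 'rV[R]_n * 'rV[R]_n] (fun p => p.1 + p.2).
Proof.
apply: measurable_fun_rV => i; under eq_fun do rewrite !mxE.
apply: measurable_funD; exact: measurableT_comp (measurable_coord i) _.
Qed.

Lemma measurable_subrV : measurable_fun [set: 'rV[R]_n * 'rV[R]_n] (fun p => p.1 - p.2).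
Proof.
apply: measurable_fun_rV => i; under eq_fun do rewrite !mxE.
apply: measurable_funB; exact: measurableT_comp (measurable_coord i) _.
Qed.

Lemma tonelli_sections m1 m2 (D : set ('rV[R]_n * 'rV[R]_n)) : measurable D ->
  (\int[m1]_x m2 (xsection D x) = \int[m2]_y m1 (ysection D y))%E.
Proof.
move=> mD; have := indic_fubini_tonelli m1 m2 mD.
by rewrite indic_fubini_tonelli_FE // indic_fubini_tonelli_GE.
Qed.

Definition translation_invariant_measure m := forall t A, measurable A ->
  m ((fun x => x + t) @^-1` A) = m A.

(** The classical uniqueness argument for Haar measure: Tonelli for the set of (x, y) with x in A
    and x + y in B, sheared by x -> x + y into the set with x in B and x - y in A. *)
Lemma haar_exchange m1 m2 A B :
  translation_invariant_measure m1 -> translation_invariant_measure m2 ->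
  measurable A -> measurable B ->
  (m1 A * m2 B = m1 B * m2 (-%R @^-1` A))%E.
Proof.
move=> t1 t2 mA mB.
pose D : set ('rV[R]_n * 'rV[R]_n) := [set p | A p.1 /\ B (p.1 + p.2)].
pose E : set ('rV[R]_n * 'rV[R]_n) := [set p | B p.1 /\ A (p.1 - p.2)].
have mD : measurable D.
  apply: measurableI; first exact: measurable_preimage measurable_fst mA.
  exact: measurable_preimage measurable_addrV mB.
have mE : measurable E.
  apply: measurableI; first exact: measurable_preimage measurable_fst mB.
  exact: measurable_preimage measurable_subrV mA.
have mNA : measurable (-%R @^-1` A).
  exact: measurable_preimage measurable_opprV mA.
have -> : (m1 A * m2 B = \int[m1]_x m2 (xsection D x))%E.
  rewrite muleC -(setIT A) -integral_indic // -ge0_integralZl //; last first.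
    by apply/measurable_EFinP.
  apply: eq_integral => x _; rewrite indicE.
  have [xA|xA] := boolP (x \in A).
    rewrite mule1 -(t2 x B mB); congr (m2 _).
    apply/seteqP; split => y; rewrite /xsection /D /= inE /= addrC => //.
    + by split=> //; rewrite inE in xA.
    + by case.
  rewrite mule0 (_ : xsection _ _ = set0) ?measure0 // -subset0 => y.
  by rewrite /xsection /= inE => -[Ax _]; move: xA; rewrite notin_setE.
rewrite tonelli_sections //.
have -> : (\int[m2]_y m1 (ysection D y) = \int[m2]_y m1 (ysection E y))%E.
  apply: eq_integral => y _; rewrite -[RHS](t1 y); last exact: measurable_ysection.
  congr (m1 _); apply/seteqP; split => x; rewrite /ysection /D /E /= !inE /=;
    by rewrite addrK => -[].
rewrite -tonelli_sections //.
rewrite muleC -(setIT B) -integral_indic // -ge0_integralZl //; last first.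
  by apply/measurable_EFinP.
apply: eq_integral => x _; rewrite indicE.
have [xB|xB] := boolP (x \in B).
  rewrite mule1 -(t2 (- x) _ mNA); congr (m2 _).
  apply/seteqP; split => y; rewrite /xsection /E /= inE /= opprD opprK addrC => //.
  + by case.
  + by split=> //; rewrite inE in xB.
rewrite mule0 (_ : xsection _ _ = set0) ?measure0 // -subset0 => y.
by rewrite /xsection /= inE => -[Bx _]; move: xB; rewrite notin_setE.
Qed.

End haar_uniqueness.

Section isometry_invariance.
Context (R : realType).

Lemma muleI (r : R) (x y : \bar R) : r != 0 -> (r%:E * x = r%:E * y)%E -> x = y.
Proof.
move=> r0 xy.
have /eqP <- : ((r^-1)%:E * (r%:E * y))%E == x by rewrite eqe_pdivrMl // xy.
by apply/eqP; rewrite eqe_pdivrMl.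
Qed.

Lemma vol_translation_invariant n : translation_invariant_measure (vol R n).
Proof. by move=> t A mA; exact: vol_translate. Qed.

Lemma vol_opp n (A : set 'rV[R]_n) : measurable A ->
  vol R n (-%R @^-1` A) = vol R n A.
Proof.
move=> mA; have [r r0 rE] := vol_cube n (@ltr01 R).
have := @haar_exchange _ _ (vol R n) (vol R n) A (@cube R n 1)
  (@vol_translation_invariant n) (@vol_translation_invariant n) mA (@measurable_cube R n 1).
by rewrite [LHS]muleC rE => /muleI ->//; rewrite gt_eqF.
Qed.

Lemma haar_unique n (m : {sigma_finite_measure set 'rV[R]_n -> \bar R}) A B :
  translation_invariant_measure m -> measurable A -> measurable B ->
  (m A * vol R n B = m B * vol R n A)%E.
Proof.
move=> mt mA mB; rewrite -(vol_opp mA); apply: haar_exchange => //.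
exact: vol_translation_invariant.
Qed.

Definition eball n (y : 'rV[R]_n) (r : R) : set 'rV[R]_n :=
  [set x | euclidean_norm (x - y) < r].

Lemma open_eball n (y : 'rV[R]_n) r : open (eball y r).
Proof.
rewrite (_ : eball y r = (fun x => euclidean_norm (x - y)) @^-1` [set t | t < r]) //.
by apply: open_comp => [x _|]; [exact: continuous_euclidean_dist|exact: open_lt].
Qed.

Lemma measurable_eball n (y : 'rV[R]_n) r : measurable (eball y r).
Proof. by apply: open_measurable_rV; exact: open_eball. Qed.

Lemma bounded_eball n (y : 'rV[R]_n) r : bounded_set (eball y r).
Proof.
exists (r + `|y|); split; first exact: num_real.
move=> M hM x xy; rewrite /= in xy *; apply: le_trans (ltW hM).
rewrite -(subrK y x); apply: le_trans (ler_normD _ _) _; rewrite lerD2r.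
exact: le_trans (norm_le_euclidean_norm _) (ltW xy).
Qed.

Lemma vol_eball_fin n (y : 'rV[R]_n) r : (vol R n (eball y r) < +oo)%E.
Proof. by apply: vol_bounded; [exact: measurable_eball|exact: bounded_eball]. Qed.

Lemma vol_eball_gt0 n (y : 'rV[R]_n) r : 0 < r -> (0 < vol R n (eball y r))%E.
Proof.
move=> r0; pose k := r / (Num.sqrt n%:R + 1).
have s0 : 0 < Num.sqrt n%:R + 1 :> R by rewrite ltr_wpDl ?sqrtr_ge0.
have k0 : 0 < k by rewrite divr_gt0.
have [v v0 vE] := vol_cube n k0.
apply: (@lt_le_trans _ _ (vol R n (@cube R n k))); first by rewrite vE lte_fin.
rewrite -(@vol_translate R n y (eball y r)); last exact: measurable_eball.
apply: le_measure; rewrite ?inE.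
- exact: measurable_cube.
- exact: measurable_preimage (measurable_translate y) (measurable_eball _ _).
move=> x xk; rewrite /eball /= addrK.
have xk' : `|x| <= k by apply/norm_le_coordP => [|i]; [exact: ltW|rewrite ler_norml xk].
apply: le_lt_trans (euclidean_norm_le_norm x) _.
apply: (@le_lt_trans _ _ (Num.sqrt n%:R * k)); first by rewrite ler_wpM2l ?sqrtr_ge0.
rewrite -[ltRHS](@divfK _ (Num.sqrt n%:R + 1)) ?gt_eqF // -/k mulrC ltr_pM2l //.
by rewrite ltrDl.
Qed.

Section isometry.
Context (n : nat) (T : 'rV[R]_n -> 'rV[R]_n) (hT : Defs.isometry T).

Definition vol_image := pushforward (vol R n) T.

HB.instance Definition _ := Measure.copy vol_image
  (image_measure (vol R n) (isometry_measurable hT)).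

Let vol_image_sigma_finite : sigma_finite setT vol_image.
Proof.
exists (fun k : nat => eball 0 k%:R).
  apply/esym; rewrite -subTset => x _; exists (Num.bound (euclidean_norm x)) => //.
  by rewrite /eball /= subr0 archi_boundP // euclidean_norm_ge0.
move=> k; split; first exact: measurable_eball.
apply: vol_bounded; last by apply: isometry_bounded => //; exact: bounded_eball.
exact: measurable_preimage (isometry_measurable hT) (measurable_eball _ _).
Qed.

HB.instance Definition _ := Measure_isSigmaFinite.Build _ _ _ vol_image
  vol_image_sigma_finite.

(** The image of [vol] under T is translation invariant because T is affine, so it is a multiple of
    [vol]; the preimage of the unit ball is again a unit ball, so the factor is 1. *)
Lemma vol_isometry A : measurable A -> vol R n (T @^-1` A) = vol R n A.
Proof.
move=> mA.
have tT : translation_invariant_measure vol_image.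
  move=> t B mB; rewrite /= /vol_image /pushforward.
  have [M [MM TE]] := isometry_affine hT.
  rewrite -[RHS](vol_translate (t *m M^T)); last first.
    exact: measurable_preimage (isometry_measurable hT) mB.
  have e x : T (x + t *m M^T) = T x + t.
    by rewrite TE (TE x) mulmxDl -mulmxA (mulmx1C MM) mulmx1 addrAC.
  by congr (vol R n _); apply/seteqP; split => x /=; rewrite e.
have [y Ty] := isometry_surj hT 0.
have mB := measurable_eball (0 : 'rV[R]_n) 1.
have := haar_unique tT mA mB; rewrite /= /vol_image /pushforward.
have -> : vol R n (T @^-1` eball 0 1) = vol R n (eball 0 1).
  rewrite -[RHS](vol_translate (- y)) //; congr (vol R n _).
  have e x : euclidean_norm (T x - 0) = euclidean_norm (x - y - 0).
    by rewrite -{1}Ty hT subr0.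
  by apply/seteqP; split => x; rewrite /eball /= e.
rewrite muleC -(@fineK _ (vol R n (eball 0 1))); last first.
  by rewrite ge0_fin_numE; [exact: vol_eball_fin|exact: measure_ge0].
by apply: muleI; rewrite gt_eqF // fine_gt0 // vol_eball_gt0 // vol_eball_fin.
Qed.

End isometry.
End isometry_invariance.

(** * Recurrence in orthants *)

Section allotments.
Context (R : realType) (d : nat).

Definition center_of (v : allotment R d) : 'rV[R]_d :=
  if v is Center c then c else 0.

Lemma measurable_center_of : measurable_fun [set: allotment R d] center_of.
Proof. by move=> _ Y mY; rewrite setTI. Qed.

Definition claimed (v : allotment R d) : Prop := exists c, v = Center c.

Lemma measurable_claimed : measurable [set v : allotment R d | claimed v].
Proof.
rewrite /measurable /= /allotment_measurable /= (_ : _ @^-1` _ = setT) //.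
by rewrite -subTset => c _; exists c.
Qed.

Lemma measurable_Unclaimed : measurable [set v : allotment R d | v = Unclaimed].
Proof.
rewrite /measurable /= /allotment_measurable /= (_ : _ @^-1` _ = set0) //.
by rewrite -subset0 => c.
Qed.

Lemma measurable_claimed_set (P : set ('rV[R]_d * 'rV[R]_d)) : measurable P ->
  measurable [set p : allotment R d * 'rV[R]_d |
    exists2 c, p.1 = Center c & P (c, p.2)].
Proof.
move=> mP; rewrite (_ : mkset _ = (fst @^-1` [set v | claimed v]) `&`
    (fun p => (center_of p.1, p.2)) @^-1` P); last first.
  apply/seteqP; split => [[v z] /= [c -> Pcz]|[v z] /= [[c ->]] /= Pcz].
    by split=> //; exists c.
  by exists c.
apply: measurableI.
  exact: measurable_preimage measurable_fst measurable_claimed.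
apply: measurable_preimage mP; apply/measurable_fun_pairP; split.
  exact: measurableT_comp measurable_center_of measurable_fst.
exact: measurable_snd.
Qed.

Lemma measurable_euclidean_norm d' (T : measurableType d') (f : T -> 'rV[R]_d) :
  measurable_fun [set: T] f ->
  measurable_fun [set: T] (fun x => euclidean_norm (f x)).
Proof.
move=> mf; apply: (@measurableT_comp _ _ _ _ _ _ (fun x => euclidean_norm x)) => //.
rewrite (_ : (fun _ => _) = Num.sqrt \o (fun x : 'rV[R]_d => dotp x x)); last first.
  by apply/funext => x; rewrite euclidean_normE.
apply: measurableT_comp; [|exact: measurable_dotpp].
by apply: continuous_measurable_fun; exact: sqrt_continuous.
Qed.

Lemma measurable_euclidean_dist d' (T : measurableType d') (f g : T -> 'rV[R]_d) :
  measurable_fun [set: T] f -> measurable_fun [set: T] g ->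
  measurable_fun [set: T] (fun x => euclidean_norm (f x - g x)).
Proof.
move=> mf mg; apply: measurable_euclidean_norm.
apply: (@measurableT_comp _ _ _ _ _ _ (fun p : 'rV[R]_d * 'rV[R]_d => p.1 - p.2) _
  (fun x => (f x, g x))); first exact: measurable_subrV.
exact: measurable_fun_pair.
Qed.

End allotments.

Section point_measure_translations.
Context (R : realType) (d : nat) (dOmega : measure_display)
  (Omega : measurableType dOmega) (Pr : probability Omega R)
  (Pi : {RV Pr >-> point_measure R d}) (invariant_Pi : translation_invariant Pi).

Definition lattice (k : 'rV[int]_d) : 'rV[R]_d := map_mx intr k.

Definition in_orthant (s : {ffun 'I_d -> bool}) (N : int) (k : 'rV[int]_d) : Prop :=
  forall i, N <= (-1) ^+ s i * k 0 i.

(* Shifting the orthant only enlarges the event that it contains a good cube,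
   without changing its probability. *)
Lemma orthant_recurrence (B : 'rV[int]_d -> set (point_measure R d)) :
  (forall k, measurable (B k)) ->
  (forall j k pi, B (k + j) (translate (lattice j) pi) <-> B k pi) ->
  {ae Pr, forall w, (exists k, B k (Pi w)) ->
    forall s N, exists2 k, in_orthant s N k & B k (Pi w)}.
Proof.
move=> mB eB.
pose A s N : set (point_measure R d) := \bigcup_(k in in_orthant s N) B k.
have mA s N : measurable (A s N).
  rewrite /A bigcup_mkcond; apply: countable_bigcupT_measurable; first exact: countableP.
  by move=> k; case: ifP.
have PrA s (N : int) (n : nat) : Pr (Pi @^-1` A s (N - n%:Z)) = Pr (Pi @^-1` A s N).
  (* Translation by [j] carries the orthant at depth N - n onto the one at depth N. *)
  pose j : 'rV[int]_d := \row_i ((-1) ^+ s i * n%:Z).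
  rewrite -[RHS](invariant_Pi (lattice j)) //; congr (Pr _).
  have sj k i : (-1) ^+ s i * (k + j) 0 i = (-1) ^+ s i * k 0 i + n%:Z.
    by rewrite !mxE mulrDr mulrA -expr2 sqrr_sign mul1r.
  apply/seteqP; split => w /= [k].
    move=> sk Bk; exists (k + j); last by apply/eB.
    by move=> i; rewrite sj -lerBlDr.
  move=> sk Bk; exists (k - j); last by apply/(eB j); rewrite subrK.
  by move=> i; rewrite lerBlDr -sj subrK.
have null s (N : int) (n : nat) : Pr (Pi @^-1` (A s (N - n%:Z) `\` A s N)) = 0%E.
  rewrite (_ : Pi @^-1` _ = Pi @^-1` A s (N - n%:Z) `\` Pi @^-1` A s N) // measureD.
  - rewrite (_ : _ `&` _ = Pi @^-1` A s N); last first.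
      apply: setIidr => w [k sk Bk]; exists k => // i.
      by apply: le_trans (sk i); rewrite lerBlDr lerDl.
    transitivity (Pr (Pi @^-1` A s N) - Pr (Pi @^-1` A s N))%E.
      by congr (_ - _)%E; exact: PrA.
    apply: subee.
    by apply: fin_num_measure; exact: measurable_preimage.
  - exact: measurable_preimage.
  - exact: measurable_preimage.
  - by rewrite -ge0_fin_numE // fin_num_measure //; exact: measurable_preimage.
pose M (p : {ffun 'I_d -> bool} * int * nat) :=
  Pi @^-1` (A p.1.1 (p.1.2 - p.2%:Z) `\` A p.1.1 p.1.2).
exists (\bigcup_n (if unpickle n is Some p then M p else set0)); split.
- apply: bigcupT_measurable => n; case: unpickle => [p|] //.
  by apply: measurable_preimage => //; exact: measurableD.
- apply/negligibleP.
    apply: bigcupT_measurable => n; case: unpickle => [p|] //.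
    by apply: measurable_preimage => //; exact: measurableD.
  apply: negligible_bigcup => n; case: unpickle => [[[s N] m]|]; last exact: negligible_set0.
  apply/negligibleP; first by apply: measurable_preimage => //; exact: measurableD.
  exact: null.
- move=> w /=; apply: contra_notP => nM [k Bk] s N.
  apply: contra_notP nM => nA.
  (* Large enough for the orthant at depth N - n to contain [k], whatever the signs. *)
  pose n := (\sum_i (absz (k 0%R i) + absz N))%N.
  exists (pickle (s, N, n)); first exact: Logic.I.
  rewrite pickleK; split; last first.
    by case=> k' sk' Bk'; apply: nA; exists k'.
  exists k => // i /=.
  have : (absz (k 0%R i) + absz N <= n)%N by rewrite /n (bigD1 i) //= leq_addr.
  case: (s i); rewrite ?expr1 ?expr0; move: (k _ i) => x; lia.
Qed.

End point_measure_translations.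

(** * Stable allocations and pinched sites *)

Section sequences_in_finite_sets.

(** Pigeonhole, in the form that replaces the extraction of subsequences below. *)
Lemma infinitely_often_finite (T : Type) (F : set T) (f : nat -> T) :
  finite_set F -> (forall n, F (f n)) ->
  exists2 c, F c & forall N, exists2 n, (N <= n)%N & f n = c.
Proof.
move=> finF fF; apply: contrapT => nc.
have /choice[g hg] : forall c, exists N, F c -> forall n, (N <= n)%N -> f n <> c.
  move=> c; have [Fc|nFc] := pselect (F c); last by exists 0%N.
  apply: contrapT => h; apply: nc; exists c => // N; apply: contrapT => h'.
  by apply: h; exists N => _ n Nn fn; apply: h'; exists n.
have [M hM] : exists M, forall c, F c -> (g c <= M)%N.
  have := finite_image g finF => /finite_seqP[A gA].
  exists (\max_(n <- A) n)%N => c Fc; apply: leq_bigmax_seq => //.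
  have : (g @` F) (g c) by exists c.
  by rewrite gA.
exact: (hg (f M) (fF M) M (hM _ (fF M))).
Qed.

End sequences_in_finite_sets.

Section deterministic.
Context (R : realType) (d : nat).
Implicit Types (x y z xi eta c : 'rV[R]_d) (psi : 'rV[R]_d -> allotment R d).

Definition same_orthant (s : {ffun 'I_d -> bool}) (M : R) x : Prop :=
  forall i, M <= (-1) ^+ s i * x 0 i.

Lemma orthant_exists x : exists s, same_orthant s 0 x.
Proof.
exists [ffun i => x 0 i < 0] => i; rewrite ffunE.
by have [x0|x0] := ltP (x 0 i) 0; rewrite ?expr1 ?expr0 ?mul1r// mulN1r oppr_ge0 ltW.
Qed.

(** The Euclidean norm is at most the sum of the absolute coordinates, and inside the orthant these
    are the signed coordinates. *)
Lemma dotp_same_orthant s (M : R) x y : 0 <= M ->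
  same_orthant s M x -> same_orthant s 0 y -> M * euclidean_norm y <= dotp x y.
Proof.
move=> M0 sx sy; pose y1 := \sum_i `|y 0 i|.
have y10 : 0 <= y1 by apply: sumr_ge0.
apply: (@le_trans _ _ (M * y1)).
  rewrite ler_wpM2l // -(@ler_pXn2r _ 2) ?nnegrE ?euclidean_norm_ge0 //.
  rewrite sqr_euclidean_norm expr2 {2}/y1 mulr_sumr; apply: ler_sum => i _.
  rewrite -expr2 -real_normK ?num_real // expr2 ler_wpM2r //.
  by rewrite /y1 (bigD1 i) //= lerDl sumr_ge0.
rewrite mulr_sumr; apply: ler_sum => i _.
have -> : x 0 i * y 0 i = ((-1) ^+ s i * x 0 i) * ((-1) ^+ s i * y 0 i).
  by rewrite mulrACA -expr2 sqrr_sign mul1r.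
have -> : `|y 0 i| = (-1) ^+ s i * y 0 i.
  by rewrite -[RHS]ger0_norm ?sy // normrM normr_sign mul1r.
by rewrite ler_wpM2r.
Qed.

(* Moving the reference point from [xi] to [k], deep inside the orthant that
   contains [x - xi], brings it closer to every sufficiently remote [x]. *)
Lemma closer_in_orthant s (C : R) xi k x : 0 <= C ->
  same_orthant s (C + 1) (k - xi) -> same_orthant s 0 (x - xi) ->
  dotp (k - xi) (k - xi) / 2 < euclidean_norm (x - xi) ->
  C < euclidean_norm (x - xi) ->
  euclidean_norm (x - k) < euclidean_norm (x - xi) - C.
Proof.
move=> C0 sk sx hx xC.
have C1 : 0 <= C + 1 by rewrite addr_ge0.
have hq := dotp_same_orthant C1 sk sx.
rewrite -(@ltr_pXn2r _ 2) ?nnegrE ?euclidean_norm_ge0 // ?subr_ge0 ?ltW //.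
rewrite sqr_euclidean_norm sqrrB sqr_euclidean_norm.
have -> : x - k = (x - xi) - (k - xi) by rewrite opprB addrA subrK.
rewrite dotpp_sum_sqr (dotpC (x - xi) (k - xi)) -mulr_natl.
have C2 : 0 <= C ^+ 2 by exact: sqr_ge0.
move: hx hq; set p := dotp (k - xi) (k - xi); set q := dotp (k - xi) (x - xi).
set r := euclidean_norm _; set t := dotp _ _ => hx hq.
(* With p < 2 r and q >= (C + 1) r: r^2 - 2 q + p < r^2 - 2 C r <= (r - C)^2. *)
by lra.
Qed.

End deterministic.

Section pinched_sites.
Context (R : realType) (d : nat).
Implicit Types (x y z xi eta c : 'rV[R]_d) (psi : 'rV[R]_d -> allotment R d)
  (Xi : set 'rV[R]_d).

(** The form in which stability is used: [eta] covets [y] because it owns the farther site [x], so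
    [y] must not desire [eta]. *)
Lemma stable_owner Xi alpha psi eta x y :
  stable Xi alpha psi -> Xi eta -> psi x = Center eta -> psi y <> Delta ->
  euclidean_norm (y - eta) < euclidean_norm (x - eta) ->
  exists2 c, psi y = Center c & euclidean_norm (y - c) <= euclidean_norm (y - eta).
Proof.
move=> st Xeta xeta yD lt_yx; case yc : (psi y) => [c||].
- exists c => //; rewrite leNgt; apply/negP => lt_ec; apply: (st y eta); split=> //.
  + by rewrite yc => -[ce]; rewrite ce ltxx in lt_ec.
  + by left; exists c.
  + by left; exists x.
- exfalso; apply: (st y eta); split=> //; first by rewrite yc.
  + by right.
  + by left; exists x.
- by case: (yD yc).
Qed.

Lemma measurable_sites psi (Q : set (allotment R d * 'rV[R]_d)) :
  measurable_fun [set: 'rV[R]_d] psi -> measurable Q ->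
  measurable [set z | Q (psi z, z)].
Proof.
move=> mpsi mQ.
by apply: (measurable_preimage (f := fun z => (psi z, z))) mQ; exact: measurable_fun_pair.
Qed.

(** Encoded on pairs (allotment, site), so that one measurability proof serves both a fixed
    allocation and, through Fubini, a random one. *)
Definition unowned (rho : R) : set (allotment R d * 'rV[R]_d) :=
  [set p | p.1 <> Delta /\
    ~ exists2 c, p.1 = Center c & euclidean_norm (p.2 - c) <= rho].

Lemma measurable_not_Delta : measurable [set v : allotment R d | v <> Delta].
Proof.
rewrite (_ : mkset _ = [set v | claimed v] `|` [set v | v = Unclaimed]).
  by apply: measurableU; [exact: measurable_claimed|exact: measurable_Unclaimed].
apply/seteqP; split => [[c||]//=|v [[c ->]//|->//]] _; first by left; exists c.
by right.
Qed.

Lemma measurable_unowned rho : measurable (unowned rho).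
Proof.
apply: measurableI.
  exact: measurable_preimage measurable_fst measurable_not_Delta.
apply: measurableC.
apply: (measurable_claimed_set (P := [set q | euclidean_norm (q.2 - q.1) <= rho])).
apply: measurable_le_set; last exact: measurable_cst.
exact: measurable_euclidean_dist.
Qed.

(* [y] is [r]-pinched when no center [c] closer than [r] to [y] essentially owns
   a site farther from [c] than [y] is; [e] is a slack. *)
Definition pinch_violation (r e : R) y : set (allotment R d * 'rV[R]_d) :=
  [set p | exists2 c, p.1 = Center c &
    euclidean_norm (y - c) < Num.min r (euclidean_norm (p.2 - c)) - e].

(** A null set instead of an empty one: pinchedness at a fixed point then depends measurably on the
    allocation. *)
Definition pinched psi r e y : Prop :=
  vol R d [set z | pinch_violation r e y (psi z, z)] = 0%E.

Lemma measurable_pinch_violation r e y : measurable (pinch_violation r e y).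
Proof.
apply: (measurable_claimed_set (P := [set q |
  euclidean_norm (y - q.1) < Num.min r (euclidean_norm (q.2 - q.1)) - e])).
apply: measurable_lt_set; first exact: measurable_euclidean_dist.
by apply: measurable_funB => //; apply: measurable_minr => //; exact: measurable_euclidean_dist.
Qed.

Lemma vol0_subset (A B : set 'rV[R]_d) : measurable A -> measurable B ->
  A `<=` B -> vol R d B = 0%E -> vol R d A = 0%E.
Proof.
move=> mA mB AB B0; apply/eqP; rewrite eq_le measure_ge0 andbT -B0.
by apply: le_measure; rewrite ?inE.
Qed.

(** A violation at [y] is a strict inequality. Half of its margin pays for moving to an
    approximating point, the other half for the slack there, so the violations at [y] lie in a
    countable union of null sets. *)
Lemma pinched_closed psi r y : measurable_fun [set: 'rV[R]_d] psi ->
  (forall e, 0 < e -> exists y' e', [/\ e' < e, euclidean_norm (y' - y) < e &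
    pinched psi r e' y']) ->
  pinched psi r 0 y.
Proof.
move=> mpsi hy.
have /choice[f] : forall n : nat, exists p : 'rV[R]_d * R, [/\ p.2 < n.+1%:R^-1,
    euclidean_norm (p.1 - y) < n.+1%:R^-1 & pinched psi r p.2 p.1].
  move=> n; have n0 : 0 < n.+1%:R^-1 :> R by rewrite invr_gt0.
  by have [y' [e' h]] := hy _ n0; exists (y', e').
move=> hf; apply: (@vol0_subset _
    (\bigcup_n [set z | pinch_violation r (f n).2 (f n).1 (psi z, z)])).
- exact: measurable_sites (measurable_pinch_violation _ _ _).
- by apply: bigcupT_measurable => n;
    exact: measurable_sites (measurable_pinch_violation _ _ _).
- move=> z [c /= zc]; rewrite subr0 => lt_yc.
  set m := Num.min r _ in lt_yc.
  have [n hn] : exists n : nat, 2 * n.+1%:R^-1 < m - euclidean_norm (y - c).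
    have h0 : 0 < (m - euclidean_norm (y - c)) / 2 by rewrite divr_gt0 // subr_gt0.
    exists (Num.bound ((m - euclidean_norm (y - c)) / 2)^-1).
    rewrite mulrC -ltr_pdivlMr // invf_plt ?posrE //.
    apply: le_lt_trans (ler_norm _) _; rewrite ger0_norm ?invr_ge0 ?ltW //.
    apply: lt_trans (archi_boundP _) _; first by rewrite invr_ge0 ltW.
    by rewrite ltr_nat.
  exists n => //; exists c => //=; have [h1 h2 _] := hf n.
  have := euclidean_dist_triangle (f n).1 y c; rewrite -/m.
  by move: h1 h2 hn; set t := _^-1; lra.
- apply/negligibleP; first by apply: bigcupT_measurable => n;
    exact: measurable_sites (measurable_pinch_violation _ _ _).
  apply: negligible_bigcup => n; apply/negligibleP.
    exact: measurable_sites (measurable_pinch_violation _ _ _).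
  by have [] := hf n.
Qed.

Lemma negligible_seq_union (s : seq 'rV[R]_d) (A : 'rV[R]_d -> set 'rV[R]_d) :
  (forall c, c \in s -> (vol R d).-negligible (A c)) ->
  (vol R d).-negligible [set z | exists2 c, c \in s & A c z].
Proof.
elim: s => [_|c s IH h]; first by apply: negligibleS (negligible_set0 _) => z [].
apply: (@negligibleS _ _ _ _ (A c `|` [set z | exists2 c, c \in s & A c z])).
  move=> z [c']; rewrite inE => /orP[/eqP->|c's] Az; first by left.
  by right; exists c'.
apply: negligibleU; first by apply: h; rewrite inE eqxx.
by apply: IH => c' c's; apply: h; rewrite inE c's orbT.
Qed.

(** A non-null set of sites is required because [pinched] ignores null sets. *)
Definition owns_near psi (rho : R) c y := forall tau, 0 < tau ->
  ~ (vol R d).-negligible [set z | [/\ eball y tau z, psi z = Center c &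
      euclidean_norm (z - c) <= rho]].

(** Almost every site near [y] has its owner within [rho], and only finitely many centers qualify,
    so in each small ball one of them owns a non-null part. By pigeonhole one center serves
    arbitrarily small balls, hence all. *)
Lemma owner_nearby Xi psi rho delta x y :
  measurable_fun [set: 'rV[R]_d] psi ->
  (forall z c, psi z = Center c -> Xi c) -> discrete_centers Xi ->
  (vol R d).-negligible (psi @^-1` [set Delta]) ->
  (vol R d).-negligible [set z | eball x delta z /\ unowned rho (psi z, z)] ->
  euclidean_norm (y - x) < delta ->
  exists2 c, (Xi `&` eball x (delta + rho + 1)) c & owns_near psi rho c y.
Proof.
move=> mpsi cXi dXi D0 U0 yx.
set F := Xi `&` eball x (delta + rho + 1).
have finF : finite_set F.
  by rewrite /F setIC; apply: dXi; exact: bounded_eball.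
pose t (n : nat) := Num.min (delta - euclidean_norm (y - x)) n.+1%:R^-1.
have t0 n : 0 < t n by rewrite lt_min subr_gt0 yx invr_gt0 ltr0n.
have /choice[f hf] : forall n, exists c, F c /\
    ~ (vol R d).-negligible [set z | [/\ eball y (t n) z, psi z = Center c &
      euclidean_norm (z - c) <= rho]].
  move=> n; apply: contrapT => h.
  have /finite_seqP[s sF] := finF.
  suff : (vol R d).-negligible (eball y (t n)).
    move/negligibleP => /(_ (measurable_eball _ _)).
    by apply/eqP; rewrite gt_eqF // vol_eball_gt0.
  apply: (@negligibleS _ _ _ _ (psi @^-1` [set Delta] `|`
      [set z | eball x delta z /\ unowned rho (psi z, z)] `|`
      [set z | exists2 c, c \in s & [set z | [/\ eball y (t n) z, psi z = Center c &
      euclidean_norm (z - c) <= rho]] z])).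
    move=> z zy; have [zD|zD] := pselect (psi z = Delta); first by left; left.
    have zx : eball x delta z.
      rewrite /eball /=; apply: le_lt_trans (euclidean_dist_triangle z y x) _.
      by rewrite -ltrBrDr; apply: lt_le_trans zy _; rewrite ge_min lexx.
    have [[c zc zrho]|nc] := pselect (exists2 c, psi z = Center c &
      euclidean_norm (z - c) <= rho); last by left; right.
    right; exists c => //; have : F c.
      split; first exact: cXi zc.
      rewrite /eball /=; apply: le_lt_trans (euclidean_dist_triangle c z x) _.
      by move: zx zrho; rewrite euclidean_distC /eball /=; lra.
    by rewrite sF.
  apply: negligibleU; first exact: negligibleU.
  apply: negligible_seq_union => c cs; apply: contrapT => nc; apply: h.
  by exists c; split=> //; rewrite sF.
have [c Fc hc] := infinitely_often_finite finF (fun n => (hf n).1).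
exists c => // tau tau0 neg; have [n Nn fn] := hc (Num.bound tau^-1).
have [_] := hf n; rewrite fn; apply; apply: (negligibleS _ neg) => z [zy zc zr]; split=> //.
apply: lt_trans zy _; rewrite gt_min; apply/orP; right.
rewrite invf_plt ?posrE //; apply: lt_le_trans (archi_boundP _) _.
  by rewrite invr_ge0 ltW.
by rewrite ler_nat leqW.
Qed.

(** If [x] were closer to [c] than [y] is, then so would it be than a non-null set of sites of [c]
    near [y]; as these are within rho < r of [c], they violate the pinchedness of [x]. *)
Lemma pinched_owner psi r rho c x y : measurable_fun [set: 'rV[R]_d] psi ->
  rho < r -> owns_near psi rho c y -> pinched psi r 0 x ->
  euclidean_norm (y - c) <= euclidean_norm (x - c).
Proof.
move=> mpsi rho_r oc px; rewrite leNgt; apply/negP => lt_xy.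
apply: (oc (euclidean_norm (y - c) - euclidean_norm (x - c))); first by rewrite subr_gt0.
exists [set z | pinch_violation r 0 x (psi z, z)]; split=> //.
  exact: measurable_sites (measurable_pinch_violation _ _ _).
move=> z [zy zc zrho]; exists c => //=; rewrite subr0 lt_min.
have := euclidean_dist_triangle y z c; rewrite (euclidean_distC y z) => h.
have h1 : euclidean_norm (x - c) < euclidean_norm (z - c) by move: zy h; rewrite /eball /=; lra.
by rewrite h1 andbT (lt_trans h1) // (le_lt_trans zrho).
Qed.

(* If [w] is pinched near the pinched site [x], then the sites close to [2w - x]
   belong to a center [c] that is no farther from [x] or from [2w - x] than from
   the midpoint [w]; balls being strictly convex, [w = x]. *)
Lemma pinched_isolated Xi psi r rho delta x (w : nat -> 'rV[R]_d) :
  measurable_fun [set: 'rV[R]_d] psi ->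
  (forall z c, psi z = Center c -> Xi c) -> discrete_centers Xi ->
  (vol R d).-negligible (psi @^-1` [set Delta]) ->
  0 < delta -> rho < r ->
  (vol R d).-negligible [set z | eball x delta z /\ unowned rho (psi z, z)] ->
  pinched psi r 0 x -> (forall n, pinched psi r 0 (w n)) ->
  (forall n, euclidean_norm (w n - x) < n.+1%:R^-1) ->
  exists n, w n = x.
Proof.
move=> mpsi cXi dXi D0 delta0 rho_r U0 px pw wx; apply: contrapT => nw.
pose x' n := w n + (w n - x).
have x'x n : euclidean_norm (x' n - x) < 2 * n.+1%:R^-1.
  rewrite (_ : x' n - x = (w n - x) + (w n - x)); last by rewrite /x' addrAC.
  apply: le_lt_trans (euclidean_normD _ _) _.
  by rewrite mulr_natl mulr2n ltrD.
pose N := Num.bound (2 / delta).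
have x'N n : euclidean_norm (x' (N + n)%N - x) < delta.
  apply: lt_trans (x'x _) _; rewrite -ltr_pdivlMl // mulrC.
  rewrite invf_plt ?posrE ?divr_gt0 // invf_div.
  apply: lt_le_trans (archi_boundP _) _; first by rewrite divr_ge0 // ltW.
  by rewrite ler_nat -addnS leq_addr.
have /choice[f hf] : forall n, exists c, (Xi `&` eball x (delta + rho + 1)) c /\
    owns_near psi rho c (x' (N + n)%N).
  by move=> n; have [c h1 h2] := owner_nearby mpsi cXi dXi D0 U0 (x'N n); exists c.
have finF : finite_set (Xi `&` eball x (delta + rho + 1)).
  by rewrite setIC; apply: dXi; exact: bounded_eball.
have [c _ hc] := infinitely_often_finite finF (fun n => (hf n).1).
have [n _ fn] := hc 0%N; have [_] := hf n; rewrite fn => on.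
set k := (N + n)%N in on.
have xx' := pinched_owner mpsi rho_r on px.
(* The center [c] owns sites near infinitely many of the reflected points, which converge to [x];
   comparing these with the pinched site [w k] gives the bound in the limit. *)
have wxc : euclidean_norm (x - c) <= euclidean_norm (w k - c).
  rewrite leNgt; apply/negP => lt_wx.
  pose e := euclidean_norm (x - c) - euclidean_norm (w k - c).
  have e0 : 0 < e by rewrite subr_gt0.
  have [m Nm fm] := hc (Num.bound (2 / e)); have [_] := hf m; rewrite fm => om.
  have := pinched_owner mpsi rho_r om (pw k).
  have := euclidean_dist_triangle x (x' (N + m)%N) c.
  have : euclidean_norm (x' (N + m)%N - x) < e.
    apply: lt_trans (x'x _) _; rewrite -ltr_pdivlMl // mulrC.
    rewrite invf_plt ?posrE ?divr_gt0 // invf_div.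
    apply: lt_le_trans (archi_boundP _) _; first by rewrite divr_ge0 // ltW.
    by rewrite ler_nat ltnW // ltnS (leq_trans Nm) // leq_addl.
  by rewrite euclidean_distC /e; lra.
move: xx' wxc; rewrite !euclidean_norm_leE.
have -> : x' k - c = (w k - c) + (w k - x) by rewrite /x' addrAC.
have -> : x - c = (w k - c) - (w k - x) by rewrite opprB [RHS]addrC addrA subrK.
have : 0 < dotp (w k - x) (w k - x).
  by apply: dotpp_gt0; rewrite subr_eq0; apply/eqP => wk; apply: nw; exists k.
(* |u + v| <= |u - v| gives u.v <= 0, while |u - v| <= |u| gives |v|^2 <= 2 u.v, against |v| > 0. *)
move: (w k - c) (w k - x) => u v; rewrite dotpp_sum_sqr dotpDl !dotpDr (dotpC v u).
by lra.
Qed.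

End pinched_sites.

Section bounded_sequences.
Context (R : realType) (d : nat).

Lemma bounded_sequence_cluster (u : nat -> 'rV[R]_d) (M : R) :
  (forall n, `|u n| <= M) ->
  exists2 y, `|y| <= M & forall e N, 0 < e -> exists2 n, (N <= n)%N &
    euclidean_norm (u n - y) < e.
Proof.
move=> uM; pose A := [set y : 'rV[R]_d | `|y| <= M].
have cA : compact A.
  apply: bounded_closed_compact.
    exists M; split; first exact: num_real.
    by move=> M' MM' y Ay; exact: le_trans Ay (ltW MM').
  rewrite /A (_ : mkset _ = (fun y : 'rV[R]_d => `|y|) @^-1` [set t : R | t <= M]) //.
  by apply: closed_comp => [y _|]; [exact: norm_continuous|exact: closed_le].
have [] := cA (u @ \oo) _; first by exists 0%N => // n _; exact: uM.
move=> y [Ay cy]; exists y => // e N e0.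
have k0 : 0 < Num.sqrt d%:R + 1 :> R by rewrite ltr_wpDl ?sqrtr_ge0.
have [||z [[n Nn <-] hz]] := cy (u @` [set n | (N <= n)%N]) (ball y (e / (Num.sqrt d%:R + 1))).
- by exists N => // n Nn; exists n.
- by apply: nbhsx_ballx; rewrite divr_gt0.
exists n => //; move: hz; rewrite -ball_normE /ball_ /= distrC ltr_pdivlMr // => h.
apply: le_lt_trans (euclidean_norm_le_norm _) _; apply: le_lt_trans h.
by rewrite mulrC ler_wpM2l // lerDl.
Qed.

End bounded_sequences.

Section sup_inf_shift.
Context (R : realType).

Lemma sup_shift (A : set R) (t : R) : has_sup A ->
  sup [set a + t | a in A] = sup A + t.
Proof.
move=> supA; rewrite -[in RHS](sup1 t) -(sup_sumE supA (has_sup1 t)).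
congr sup; apply/seteqP; split => [_ [a Aa <-]|_ [a Aa [_ -> <-]]].
  by exists a => //; exists t.
by exists a.
Qed.

Lemma inf_shift (A : set R) (t : R) : has_inf A ->
  inf [set a + t | a in A] = inf A + t.
Proof.
move=> infA; rewrite -[in RHS](inf1 t) -(inf_sumE infA (has_inf1 t)).
congr inf; apply/seteqP; split => [_ [a Aa <-]|_ [a Aa [_ -> <-]]].
  by exists a => //; exists t.
by exists a.
Qed.

End sup_inf_shift.

(** * Measurable selection of isolated pinched sites *)

Section selector.
Context (R : realType) (d : nat).
Implicit Types (x y z : 'rV[R]_d) (psi : 'rV[R]_d -> allotment R d)
  (c q : 'rV[rat]_d) (rad r : rat).

(** Rational points keep the search countable; they need not be pinched exactly, hence the slack 1 /
    (m + 1). *)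
Definition candidate psi c rad r (m : nat) q : Prop :=
  (forall i, `|q 0 i - c 0 i| <= rad) /\
  pinched psi (ratr r) (m.+1%:R^-1) (rat_rV R q).

(** Points that are not candidates get the left end of the box, which makes the supremum over all
    rational points well defined without hiding a candidate. *)
Definition candidate_coord psi c rad r m i q : R :=
  if `[< candidate psi c rad r m q >] then ratr (q 0 i) else ratr (c 0 i - rad).

Definition selector_step psi c rad r m i : R :=
  sup [set candidate_coord psi c rad r m i q | q in [set: 'rV[rat]_d]].

(* When the box with center [c] and radius [rad] contains exactly one [r]-pinched
   site of [psi], this is that site; otherwise the value is irrelevant. *)
Definition selector psi c rad r : 'rV[R]_d :=
  \row_i inf [set selector_step psi c rad r m i | m in [set: nat]].

Lemma candidate_coord_ge psi c rad r m i q :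
  ratr (c 0 i - rad) <= candidate_coord psi c rad r m i q.
Proof.
rewrite /candidate_coord; case: asboolP => // -[/(_ i) + _].
by rewrite ler_distl ler_rat => /andP[].
Qed.

Lemma candidate_coord_le psi c rad r m i q :
  candidate_coord psi c rad r m i q <= ratr (c 0 i + `|rad|).
Proof.
rewrite /candidate_coord; case: asboolP => [[/(_ i) + _]|_]; rewrite ler_rat.
  by rewrite ler_distl => /andP[_ h]; apply: le_trans h _; rewrite lerD2l ler_norm.
by rewrite lerD2l; apply: le_trans (ler_norm _) _; rewrite normrN.
Qed.

Lemma has_sup_candidates psi c rad r m i :
  has_sup [set candidate_coord psi c rad r m i q | q in [set: 'rV[rat]_d]].
Proof.
split; first by exists (candidate_coord psi c rad r m i 0); exists 0.
by exists (ratr (c 0 i + `|rad|)) => _ [q _ <-]; exact: candidate_coord_le.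
Qed.

Lemma candidate_le_step psi c rad r m i q :
  candidate_coord psi c rad r m i q <= selector_step psi c rad r m i.
Proof. by apply: (ub_le_sup (has_sup_candidates _ _ _ _ _ _).2); exists q. Qed.

Lemma step_ge psi c rad r m i : ratr (c 0 i - rad) <= selector_step psi c rad r m i.
Proof.
exact: le_trans (candidate_coord_ge _ _ _ _ _ _ 0) (candidate_le_step _ _ _ _ _ _ 0).
Qed.

Lemma has_inf_steps psi c rad r i :
  has_inf [set selector_step psi c rad r m i | m in [set: nat]].
Proof.
split; first by exists (selector_step psi c rad r 0 i); exists 0%N.
by exists (ratr (c 0 i - rad)) => _ [m _ <-]; exact: step_ge.
Qed.

(** As the slack tends to 0, candidates accumulate only at pinched sites of the box, that is at [x];
    conversely, rational points close enough to [x] are candidates for any given slack. *)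
Lemma selector_correct psi r x (e : R) :
  measurable_fun [set: 'rV[R]_d] psi -> 0 < e ->
  pinched psi (ratr r) 0 x ->
  (forall w, euclidean_norm (w - x) < e -> pinched psi (ratr r) 0 w -> w = x) ->
  exists c rad, selector psi c rad r = x.
Proof.
move=> mpsi e0 px iso.
have k0 : 0 < Num.sqrt d%:R + 1 :> R by rewrite ltr_wpDl ?sqrtr_ge0.
have small y (t : R) : `|y| < t / (Num.sqrt d%:R + 1) -> euclidean_norm y < t.
  rewrite ltr_pdivlMr // => h; apply: le_lt_trans (euclidean_norm_le_norm _) _.
  by apply: le_lt_trans h; rewrite mulrC ler_wpM2l // lerDl.
(* The box is centered within rad / 2 of [x]: it contains a neighborhood of [x] and stays within
   Euclidean distance [e] of it, where [x] is the only pinched site. *)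
have [rad] : exists q : rat, ratr q \in `]0 : R, e / (Num.sqrt d%:R + 1) / 2[.
  by apply: rat_in_itvoo; rewrite !divr_gt0.
rewrite in_itv /= => /andP[rad0 rade].
have rad2 : 0 < ratr rad / 2 :> R by rewrite divr_gt0.
have [c xc] := rat_rV_dense x rad2.
have ratB (a b : rat) : ratr (a - b) = ratr a - ratr b :> R by rewrite rmorphB.
have box q : (forall i, `|q 0 i - c 0 i| <= rad) <-> `|rat_rV R q - rat_rV R c| <= ratr rad.
  rewrite (norm_le_coordP _ (ltW rad0)); split=> h i; have := h i;
    by rewrite !mxE -rmorphB /= -ratr_norm ler_rat.
exists c, rad; apply/rowP => i; rewrite mxE; apply/eqP; rewrite eq_le; apply/andP; split.
- rewrite leNgt; apply/negP => lt_x.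
  pose eta := (inf [set selector_step psi c rad r m i | m in [set: nat]] - x 0 i) / 2.
  have eta0 : 0 < eta by rewrite divr_gt0 // subr_gt0.
  have xL : ratr (c 0 i - rad) <= x 0 i.
    have := le_lt_trans (coord_le_norm _ i) xc; rewrite !mxE ratB.
    by rewrite ltr_distlC => /andP[]; move: rad0; lra.
  have /choice[u hu] : forall m, exists q, candidate psi c rad r m q /\ x 0 i + eta < ratr (q 0 i).
    move=> m; have : x 0 i + eta < selector_step psi c rad r m i.
      apply: (@lt_le_trans _ _ (inf [set selector_step psi c rad r m i | m in [set: nat]])).
        by rewrite /eta; lra.
      by apply: (ge_inf (has_inf_steps _ _ _ _ _).2); exists m.
    move=> /(sup_gt (has_sup_candidates _ _ _ _ _ _).1)[_ [q _ <-]].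
    rewrite /candidate_coord; case: asboolP => [hq h|_ h]; first by exists q.
    by move: h xL eta0; lra.
  have uM n : `|rat_rV R (u n) - rat_rV R c| <= ratr rad by apply/box; have [[]] := hu n.
  have [y0 y0M cy] := bounded_sequence_cluster uM.
  pose y := y0 + rat_rV R c.
  have uy n : rat_rV R (u n) - y = rat_rV R (u n) - rat_rV R c - y0.
    by rewrite /y opprD addrA addrAC.
  have yx : y = x.
    apply: iso.
      apply: small; rewrite /y -addrA; apply: le_lt_trans (ler_normD _ _) _.
      by rewrite distrC; move: y0M xc rade; lra.
    apply: pinched_closed => // t t0.
    have [n Nn hn] := cy t (Num.bound t^-1) t0.
    exists (rat_rV R (u n)), n.+1%:R^-1; split; last by have [[]] := hu n.
      rewrite invf_plt ?posrE //; apply: lt_le_trans (archi_boundP _) _.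
        by rewrite invr_ge0 ltW.
      by rewrite ler_nat leqW.
    by rewrite uy.
  have [n _ hn] := cy eta 0%N eta0.
  have := le_lt_trans (coord_le_euclidean_norm _ i) hn; rewrite -uy yx !mxE.
  have [_ h] := hu n; rewrite ltr_distl => /andP[]; move: h; lra.
- apply: lb_le_inf; first by have [] := has_inf_steps psi c rad r i.
  move=> _ [m _ <-]; apply/ler_addgt0Pr => eta eta0.
  pose t := Num.min eta (Num.min (ratr rad / 2) (m.+1%:R^-1 / (Num.sqrt d%:R + 1))).
  have t0 : 0 < t by rewrite !lt_min eta0 rad2 divr_gt0 // invr_gt0 ltr0n.
  have [q] := rat_rV_dense x t0; rewrite !lt_min => /and3P[q1 q2 q3].
  have cq : candidate psi c rad r m q.
    split; first apply/box.
      rewrite -[_ - _](subrKA x); apply: le_trans (ler_normD _ _) _.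
      by rewrite distrC; move: q2 xc; lra.
    apply: (vol0_subset _ _ _ px).
    + exact: measurable_sites (measurable_pinch_violation _ _ _).
    + exact: measurable_sites (measurable_pinch_violation _ _ _).
    move=> z [c' /= zc' h]; exists c' => //=; rewrite subr0.
    apply: le_lt_trans (euclidean_dist_triangle x (rat_rV R q) c') _.
    by move: h; rewrite ltrBrDl; apply: lt_trans; rewrite ltrD2r small.
  have := candidate_le_step psi c rad r m i q; rewrite /candidate_coord asboolT //.
  have := le_lt_trans (coord_le_norm _ i) q1; rewrite !mxE ltr_distl => /andP[].
  lra.
Qed.

End selector.

Section lattice_windows.
Context (R : realType) (d : nat).
Implicit Types (x y z : 'rV[R]_d) (k : 'rV[int]_d).

Definition window (a : R) k : set 'rV[R]_d :=
  [set z | forall i, `|z 0 i - (k 0 i)%:~R| <= a].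

Lemma window_lattice k : window 0 k (lattice R k).
Proof. by move=> i; rewrite mxE subrr normr0. Qed.

Lemma window_exists x : exists k, window 1 k x.
Proof.
exists (\row_i Num.floor (x 0 i)) => i; rewrite mxE.
have := ge_floor (x 0 i); have := lt_succ_floor (x 0 i).
rewrite intrD ler_norml => h1 h2; apply/andP; split; lra.
Qed.

Lemma window_orthant s (M : R) x (a : R) : exists N, forall k y,
  in_orthant s N k -> window a k y -> same_orthant s M (y - x).
Proof.
pose N := Num.bound `|M + `|x| + a|; exists N%:Z => k y sk ky i; rewrite !mxE.
have kN : N%:R <= (-1) ^+ s i * (k 0 i)%:~R :> R.
  have := sk i; rewrite -(ler_int R) intrM; congr (_ <= _ * _).
  by rewrite rmorphXn /= rmorphN1.
have MN : M + `|x| + a < N%:R.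
  apply: le_lt_trans (ler_norm _) _.
  exact: archi_boundP (normr_ge0 _).
have yk := ky i; have xi := coord_le_norm x i.
have -> : y 0 i + - x 0 i = (k 0 i)%:~R + (y 0 i - (k 0 i)%:~R) - x 0 i by ring.
move: yk xi; rewrite !ler_norml => /andP[h1 h2] /andP[h3 h4].
by case: (s i) kN; rewrite ?expr1 ?expr0; lra.
Qed.

Lemma window_subset k x z : window 1 k x -> eball x 1 z -> window 2 k z.
Proof.
move=> kx; rewrite /eball /= => xz i; have := kx i.
have := le_lt_trans (coord_le_euclidean_norm _ i) xz; rewrite !mxE.
by rewrite ltr_norml !ler_norml => /andP[h1 h2] /andP[h3 h4]; apply/andP; split; lra.
Qed.

Lemma window_dist (a : R) k z : 0 <= a -> window a k z ->
  euclidean_norm (z - lattice R k) <= Num.sqrt d%:R * a.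
Proof.
move=> a0 kz; apply: le_trans (euclidean_norm_le_norm _) _.
rewrite ler_wpM2l ?sqrtr_ge0 //; apply/norm_le_coordP => // i.
by have := kz i; rewrite !mxE.
Qed.

Lemma window_bounded (a : R) k : exists K : R, forall z, window a k z ->
  euclidean_norm z <= K.
Proof.
exists (Num.sqrt d%:R * `|a| + euclidean_norm (lattice R k)) => z kz.
rewrite -[z in leLHS](subrK (lattice R k)); apply: le_trans (euclidean_normD _ _) _.
rewrite lerD2r; apply: window_dist => // i.
exact: le_trans (kz i) (ler_norm _).
Qed.

Lemma measurable_window (a : R) k : measurable (window a k).
Proof.
rewrite (_ : window a k = \bigcap_i [set z | `|z 0 i - (k 0 i)%:~R| <= a]).
  apply: fin_bigcap_measurable => // i _; apply: measurable_le_set => //.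
  by apply: measurableT_comp => //; apply: measurable_funB => //; exact: measurable_coord.
by apply/seteqP; split=> z /= h i; [move=> _|]; exact: h.
Qed.

End lattice_windows.

(** * Local finiteness and boundedness for one stable allocation *)

Section stable_allocations.
Context (R : realType) (d : nat).
Implicit Types (x y z xi eta c : 'rV[R]_d) (k : 'rV[int]_d).

(** The distances to the owners are essentially unbounded on the window. Half-side 2 lets it contain
    the unit balls around the points of [window 1 k]. *)
Definition bad_window (psi : 'rV[R]_d -> allotment R d) k : Prop := forall N : nat,
  vol R d [set z | window 2 k z /\ unowned N%:R (psi z, z)] <> 0%E.

(** No site is undominated if [window 1 k] contains a center with remote sites: sqrt d bounds the
    distance from that center to the lattice point. *)
Definition undominated k : set (allotment R d * 'rV[R]_d) := [set p | p.1 <> Delta /\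
  ~ exists2 c, p.1 = Center c & euclidean_norm (p.2 - c) <=
                                euclidean_norm (p.2 - lattice R k) + Num.sqrt d%:R].

Lemma measurable_undominated k : measurable (undominated k).
Proof.
apply: measurableI; first exact: measurable_preimage measurable_fst (@measurable_not_Delta R d).
apply: measurableC; apply: (measurable_claimed_set (P := [set q |
  euclidean_norm (q.2 - q.1) <= euclidean_norm (q.2 - lattice R k) + Num.sqrt d%:R])).
apply: measurable_le_set; first exact: measurable_euclidean_dist.
by apply: measurable_funD => //; exact: measurable_euclidean_dist.
Qed.

Definition dominating (psi : 'rV[R]_d -> allotment R d) k : Prop :=
  vol R d [set z | undominated k (psi z, z)] = 0%E.

(** Remote sites of centers in the window, searched only among the countably many selectors, so that
    the condition is an event. *)
Definition spread (psi : 'rV[R]_d -> allotment R d) k : Prop := forall N : nat,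
  exists (c : 'rV[rat]_d) (rad r : rat), N%:R < euclidean_norm (selector psi c rad r) /\
    exists2 xi, psi (selector psi c rad r) = Center xi & window 1 k xi.

(** The conclusion of [orthant_recurrence] for a single realization; the arguments of this section
    are deterministic given it. *)
Definition recurrent (P : 'rV[int]_d -> Prop) : Prop :=
  (exists k, P k) -> forall s N, exists2 k, in_orthant s N k & P k.

Context (Xi : set 'rV[R]_d) (alpha : R) (psi : 'rV[R]_d -> allotment R d).
Context (mpsi : measurable_fun [set: 'rV[R]_d] psi).
Context (cXi : forall z c, psi z = Center c -> Xi c).
Context (dXi : discrete_centers Xi).
Context (D0 : (vol R d).-negligible (psi @^-1` [set Delta])).
Context (st : stable Xi alpha psi).

Definition far_sites xi := forall M : R, exists2 x, psi x = Center xi & M < euclidean_norm x.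

Lemma unbounded_far_sites xi : ~ bounded_set (territory psi xi) -> far_sites xi.
Proof.
move=> nb M; apply: contrapT => h; apply: nb.
exists M; split; first exact: num_real.
move=> M' MM' x xxi; apply: le_trans (norm_le_euclidean_norm _) _.
by rewrite leNgt; apply/negP => Mx; apply: h; exists x => //; exact: lt_trans MM' Mx.
Qed.

Lemma far_sites_dist xi M : far_sites xi ->
  exists2 x, psi x = Center xi & M < euclidean_norm (x - xi).
Proof.
move=> fxi; have [x xxi hx] := fxi (M + euclidean_norm xi); exists x => //.
by have := euclidean_normD (x - xi) xi; rewrite subrK; move: hx; lra.
Qed.

Lemma far_sites_cover xi y : Xi xi -> far_sites xi -> psi y <> Delta ->
  exists2 c, psi y = Center c & euclidean_norm (y - c) <= euclidean_norm (y - xi).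
Proof.
move=> Xxi /(far_sites_dist (euclidean_norm (y - xi)))[x xxi hx] yD.
exact: stable_owner st Xxi xxi yD hx.
Qed.

(** A center [c] violating pinchedness covets [x], so by stability [x] is at least as close to [xi]
    as to [c]; but [c] is closer than [r]. *)
Lemma pinched_of_owner r x xi : psi x = Center xi -> r <= euclidean_norm (x - xi) ->
  pinched psi r 0 x.
Proof.
move=> xxi rx; rewrite /pinched (_ : mkset _ = set0) ?measure0 // -subset0 => z [c /= zc].
rewrite subr0 lt_min => /andP[xr xz].
have [|c' ] := stable_owner st (cXi zc) zc _ xz; first by rewrite xxi.
by rewrite xxi => -[<-]; rewrite leNgt (lt_le_trans xr).
Qed.

Lemma far_centers (A : set 'rV[R]_d) : A `<=` Xi -> ~ finite_set A ->
  forall M : R, exists2 xi, A xi & M < euclidean_norm xi.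
Proof.
move=> AXi nfin M; apply: contrapT => h; apply: nfin.
apply: (@sub_finite_set _ _ (eball 0 (M + 1) `&` Xi)); last first.
  by apply: dXi; exact: bounded_eball.
move=> xi Axi; split; last exact: AXi.
rewrite /eball /= subr0 ltNge; apply/negP => Mxi; apply: h; exists xi => //.
by apply: lt_le_trans Mxi; rewrite ltrDl.
Qed.

(* A bounded sequence of sites owned by centers going to infinity in some
   orthant covers every window deep inside that orthant. *)
Lemma no_bad_window (x xi : nat -> 'rV[R]_d) x0 :
  recurrent (bad_window psi) ->
  (forall n, psi (x n) = Center (xi n)) -> (forall n, n%:R < euclidean_norm (xi n)) ->
  (forall n, euclidean_norm (x n - x0) < 1) ->
  forall k, ~ bad_window psi k.
Proof.
move=> rec xxi xin xx0 k0 bad0.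
have /choice[sgn hsgn] : forall n, exists s, same_orthant s 0 (xi n - x n).
  by move=> n; exact: orthant_exists.
have finS : finite_set [set: {ffun 'I_d -> bool}] by exact: finite_finset.
have [s _ hs] := infinitely_often_finite finS (fun n => Logic.I : [set: _] (sgn n)).
have [N hN] := window_orthant s 2 x0 2.
have [k sk badk] := rec (ex_intro _ k0 bad0) s N.
have [K1 hK1] := window_bounded (2 : R) k.
pose K := K1 + euclidean_norm x0 + 1.
have hK z n : window 2 k z -> euclidean_norm (z - x n) <= K.
  move=> kz; have := hK1 z kz.
  have := euclidean_dist_triangle z x0 (x n).
  have := euclidean_normD z (- x0); rewrite euclidean_normN.
  have := xx0 n; rewrite (euclidean_distC (x n)) /K; lra.
(* From this index on, |xi n - x n| exceeds K^2 and so the quadratic threshold in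
   [closer_in_orthant]. *)
have [n hn sn] := hs (Num.bound (K ^+ 2 + euclidean_norm x0 + 1)).
have far : K ^+ 2 < euclidean_norm (xi n - x n).
  have h1 : K ^+ 2 + euclidean_norm x0 + 1 < n%:R.
    apply: lt_le_trans (archi_boundP _) _; last by rewrite ler_nat; exact: hn.
    by rewrite !addr_ge0 ?sqr_ge0 ?euclidean_norm_ge0.
  have := euclidean_normD (xi n - x n) (x n); rewrite subrK.
  have := euclidean_normD (x n - x0) x0; rewrite subrK.
  have := xin n; have := xx0 n; move: h1; lra.
have := badk (Num.bound (euclidean_norm (xi n - x n))); apply.
rewrite (_ : mkset _ = set0) ?measure0 // -subset0 => z [kz [zD]]; apply.
have lt_z : euclidean_norm (xi n - z) < euclidean_norm (xi n - x n).
  (* Here the reference point [x n] moves to the site [z] and the remote point is the center [xi n],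
     with C = 0. *)
  rewrite -[ltRHS]subr0; apply: (@closer_in_orthant _ _ s) => //.
  - move=> i; have := hN k z sk kz i; rewrite !mxE.
    have := le_lt_trans (coord_le_euclidean_norm _ i) (xx0 n); rewrite !mxE ltr_norml.
    by case: (s i); rewrite ?expr1 ?expr0 => /andP[h1 h2]; lra.
  - by rewrite -sn.
  - apply: le_lt_trans far; rewrite -sqr_euclidean_norm.
    have h0 : 0 <= euclidean_norm (z - x n) ^+ 2 by exact: sqr_ge0.
    have : euclidean_norm (z - x n) ^+ 2 <= K ^+ 2.
      by rewrite ler_pXn2r ?nnegrE ?euclidean_norm_ge0 ?(le_trans (euclidean_norm_ge0 _) (hK z n kz)) // hK.
    by move: h0; lra.
  - by apply: le_lt_trans far; exact: sqr_ge0.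
have [|c zc hc] := stable_owner st (cXi (xxi n)) (xxi n) zD.
  by rewrite euclidean_distC (euclidean_distC (x n)).
exists c => //=; apply: le_trans hc _; rewrite euclidean_distC; apply/ltW/(lt_trans lt_z).
exact: archi_boundP (euclidean_norm_ge0 _).
Qed.

Lemma locally_finite_territories : recurrent (bad_window psi) ->
  forall B : set 'rV[R]_d, bounded_set B ->
    finite_set [set xi | Xi xi /\ (B `&` territory psi xi) !=set0].
Proof.
move=> rec B [M [_ hM]]; apply: contrapT => nfin.
have /choice[p hp] : forall n : nat, exists p : 'rV[R]_d * 'rV[R]_d,
    [/\ B p.1, psi p.1 = Center p.2 & n%:R < euclidean_norm p.2].
  move=> n; have [|xi [Xxi [x [Bx xxi]]] nxi] := far_centers _ nfin n%:R.
    by move=> xi [].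
  by exists (x, xi).
have pM n : `|(p n).1| <= M + 1.
  by have [Bp _ _] := hp n; apply: (hM (M + 1)) => //; rewrite ltrDl.
have [x0 _ cx0] := bounded_sequence_cluster pM.
have /choice[m hm] : forall n : nat, exists m, (n <= m)%N /\
    euclidean_norm ((p m).1 - x0) < n.+1%:R^-1.
  move=> n; have n0 : 0 < n.+1%:R^-1 :> R by rewrite invr_gt0 ltr0n.
  by have [m nm h] := cx0 _ n n0; exists m.
pose x n := (p (m n)).1; pose xi n := (p (m n)).2.
have xxi n : psi (x n) = Center (xi n) by have [] := hp (m n).
have xin n : n%:R < euclidean_norm (xi n).
  have [_ _ h] := hp (m n); apply: le_lt_trans h.
  by rewrite ler_nat; have [] := hm n.
have xx0 n : euclidean_norm (x n - x0) < n.+1%:R^-1 by have [] := hm n.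
have inv_le1 n : n.+1%:R^-1 <= 1 :> R by rewrite invf_le1 ?ler1n ?ltr0n.
have xx01 n : euclidean_norm (x n - x0) < 1 := lt_le_trans (xx0 n) (inv_le1 n).
have [k kx0] := window_exists x0.
have := no_bad_window rec xxi xin xx01 (k := k).
(* [N0] essentially bounds the distances to the owners within distance 1 of the cluster point
   [x0]. *)
rewrite /bad_window -existsNE => -[N0] /contrapT UN.
pose r : R := N0%:R + 1.
pose n1 := Num.bound (r + euclidean_norm x0 + 1).
have pin n : (n1 <= n)%N -> pinched psi r 0 (x n).
  move=> n1n; apply: (pinched_of_owner (xxi n)).
  have h1 : r + euclidean_norm x0 + 1 < n%:R.
    apply: lt_le_trans (archi_boundP _) _; last by rewrite ler_nat; exact: n1n.
    by rewrite !addr_ge0 ?euclidean_norm_ge0.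
  have := euclidean_normD (xi n - x n) (x n); rewrite subrK.
  have := euclidean_normD (x n - x0) x0; rewrite subrK.
  rewrite (euclidean_distC (x n) (xi n)).
  have := xin n; have := xx01 n; move: h1; lra.
have pin0 : pinched psi r 0 x0.
  apply: pinched_closed => // e e0.
  pose n := maxn n1 (Num.bound e^-1); exists (x n), 0; split=> //.
    apply: lt_trans (xx0 n) _; rewrite invf_plt ?posrE //.
    apply: lt_le_trans (archi_boundP _) _; first by rewrite invr_ge0 ltW.
    by rewrite ler_nat leqW // leq_maxr.
  by apply: pin; exact: leq_maxl.
have hit n2 : exists2 n, (n2 <= n)%N & x n = x0.
  have U0 : (vol R d).-negligible [set z | eball x0 1 z /\ unowned N0%:R (psi z, z)].
    apply: (@negligibleS _ _ _ _ [set z | window 2 k z /\ unowned N0%:R (psi z, z)]).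
      by move=> z [zx0 zU]; split=> //; exact: window_subset kx0 zx0.
    apply/negligibleP => //; apply: measurableI; first exact: measurable_window.
    exact: measurable_sites (measurable_unowned _).
  have := @pinched_isolated _ _ Xi psi r N0%:R 1 x0 (fun n => x (maxn n1 n2 + n)%N).
  case=> //.
  - by rewrite /r ltrDl.
  - by move=> n; apply: pin; rewrite (leq_trans (leq_maxl n1 n2)) // leq_addr.
  - move=> n; apply: lt_le_trans (xx0 _) _.
    by rewrite lef_pV2 ?posrE ?ltr0n // ler_nat ltnS leq_addl.
  - move=> n hn; exists (maxn n1 n2 + n)%N => //.
    by rewrite (leq_trans (leq_maxr n1 n2)) // leq_addr.
(* Both indices give the site [x0], hence the same owner, but [b] is so large that the owner at [b]
   is farther out than the one at [a]. *)
have [a _ xa] := hit 0%N; have [b ab xb] := hit (Num.bound (euclidean_norm (xi a))).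
have : xi a = xi b by have := xxi a; rewrite xa -xb xxi => -[].
move=> e; have := xin b; rewrite -e ltNge; case/negP.
apply/ltW/(lt_le_trans (archi_boundP (euclidean_norm_ge0 _))).
by rewrite ler_nat.
Qed.

Lemma dominating_window xi k : Xi xi -> far_sites xi -> window 1 k xi ->
  dominating psi k.
Proof.
move=> Xxi fxi kxi; rewrite /dominating (_ : mkset _ = set0) ?measure0 // -subset0.
move=> z [/= zD]; apply; have [c zc hc] := far_sites_cover Xxi fxi zD.
exists c => //; apply: le_trans hc _.
apply: le_trans (euclidean_dist_triangle z (lattice R k) xi) _; rewrite lerD2l.
by rewrite euclidean_distC -[leRHS]mulr1; exact: window_dist.
Qed.

(* A remote site [x] of [xi] is an isolated pinched site: near [x], almost every
   site belongs to a center strictly closer than [xi]. *)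
Lemma spread_window xi k : Xi xi -> far_sites xi -> window 1 k xi ->
  recurrent (dominating psi) -> spread psi k.
Proof.
move=> Xxi fxi kxi rec N.
(* sqrt d pays for the slack in [undominated]; the extra 1 leaves a gap between the owner distances
   near [x] and [r]. *)
pose C : R := Num.sqrt d%:R + 1.
have C0 : 0 <= C by rewrite addr_ge0 // sqrtr_ge0.
have dom := dominating_window Xxi fxi kxi.
have /choice[kk hkk] : forall s, exists k', same_orthant s (C + 1) (lattice R k' - xi) /\
    dominating psi k'.
  move=> s; have [N' hN'] := window_orthant s (C + 1) xi 0.
  have [k' sk' domk'] := rec (ex_intro _ k dom) s N'; exists k'; split=> //.
  by apply: hN' sk' _; exact: window_lattice.
(* A bound for all orthants at once, so that [x] can be chosen before its orthant is known. *)
pose K := \sum_s dotp (lattice R (kk s) - xi) (lattice R (kk s) - xi).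
have hK s : dotp (lattice R (kk s) - xi) (lattice R (kk s) - xi) <= K.
  by rewrite /K (bigD1 s) //= lerDl sumr_ge0 // => s' _; exact: dotpp_ge0.
have K0 : 0 <= K by apply: sumr_ge0 => s _; exact: dotpp_ge0.
have [x xxi hx] := far_sites_dist (K + C + N%:R + euclidean_norm xi) fxi.
have N0 : 0 <= N%:R :> R by [].
have xi0 := euclidean_norm_ge0 xi.
have [s sx] := orthant_exists (x - xi).
have [sk domk] := hkk s.
have xk : euclidean_norm (x - lattice R (kk s)) < euclidean_norm (x - xi) - C.
  apply: closer_in_orthant sk sx _ _ => //; last by move: hx; lra.
  by have := hK s; have := dotpp_ge0 (lattice R (kk s) - xi); move: hx; lra.
set D := euclidean_norm (x - xi) in hx xk.
have [r] : exists q : rat, ratr q \in `]D - 2^-1, D[.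
  by apply: rat_in_itvoo; rewrite ltrBlDr ltrDl invr_gt0.
rewrite in_itv /= => /andP[rD Dr].
have px : pinched psi (ratr r) 0 x by apply: pinched_of_owner xxi (ltW Dr).
have [e e0 iso] : exists2 e, 0 < e & forall w, euclidean_norm (w - x) < e ->
    pinched psi (ratr r) 0 w -> w = x.
  apply: contrapT => niso.
  have /choice[w hw] : forall n : nat, exists w, [/\ euclidean_norm (w - x) < n.+1%:R^-1,
      pinched psi (ratr r) 0 w & w <> x].
    move=> n; apply: contrapT => nw; apply: niso; exists n.+1%:R^-1.
      by rewrite invr_gt0 ltr0n.
    by move=> w wx pw; apply: contrapT => wnx; apply: nw; exists w.
  (* Within 1/4 of [x], almost every owner is at distance at most (D - sqrt d - 1) + 1/4 + sqrt d =
     D - 3/4, whereas r > D - 1/2. *)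
  have U0 : (vol R d).-negligible
      [set z | eball x 4^-1 z /\ unowned (D - 3 / 4) (psi z, z)].
    apply: (@negligibleS _ _ _ _ [set z | undominated (kk s) (psi z, z)]).
      move=> z [zx [/= zD nown]]; split=> //= -[c zc hc]; apply: nown; exists c => //.
      have := euclidean_dist_triangle z x (lattice R (kk s)).
      move: zx xk hc; rewrite /eball /= /C; lra.
    apply/negligibleP => //; exact: measurable_sites (measurable_undominated _).
  have [| | | |n] := @pinched_isolated _ _ Xi psi (ratr r) (D - 3 / 4) 4^-1 x w mpsi
    cXi dXi D0 _ _ U0 px.
  - by rewrite invr_gt0.
  - by apply: lt_trans rD; lra.
  - by move=> n; have [] := hw n.
  - by move=> n; have [] := hw n.
  - by have [] := hw n.
have [c [rad sel]] := selector_correct mpsi e0 px iso.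
exists c, rad, r; rewrite sel; split; last by exists xi.
have := euclidean_normD x (- xi); rewrite euclidean_normN -/D.
by move: hx; lra.
Qed.

(** The owners of the selected sites may vary with the distance, but the window contains finitely
    many centers, so one of them recurs. *)
Lemma spread_far_sites k : spread psi k ->
  exists2 xi, Xi xi /\ window 1 k xi & far_sites xi.
Proof.
move=> spr; have /choice[p hp] : forall n : nat, exists p : 'rV[R]_d * 'rV[R]_d,
    [/\ psi p.1 = Center p.2, window 1 k p.2 & n%:R < euclidean_norm p.1].
  by move=> n; have [c [rad [r [h [xi sxi kxi]]]]] := spr n;
    exists (selector psi c rad r, xi).
have [K hK] := window_bounded (1 : R) k.
have finF : finite_set (eball 0 (K + 1) `&` Xi) by apply: dXi; exact: bounded_eball.
have F n : (eball 0 (K + 1) `&` Xi) (p n).2.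
  have [h1 h2 _] := hp n; split; last exact: cXi h1.
  rewrite /eball /= subr0; apply: le_lt_trans (hK _ h2) _.
  by rewrite ltrDl.
have [xi [_ Xxi] hxi] := infinitely_often_finite finF F.
exists xi.
  by have [n _ <-] := hxi 0%N; have [_ h2 _] := hp n; split=> //; have [] := F n.
move=> M; have [n Mn nxi] := hxi (Num.bound `|M|); have [h1 _ h3] := hp n.
exists (p n).1; first by rewrite h1 nxi.
apply: le_lt_trans h3; apply: le_trans (ler_norm _) _.
by apply/ltW/(lt_le_trans (archi_boundP (normr_ge0 _))); rewrite ler_nat.
Qed.

Lemma bounded_territories : recurrent (dominating psi) -> recurrent (spread psi) ->
  forall xi, Xi xi -> bounded_set (territory psi xi).
Proof.
move=> rec1 rec2 xi Xxi; apply: contrapT => /unbounded_far_sites fxi.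
have [k kxi] := window_exists xi.
have spr := spread_window Xxi fxi kxi rec1.
have /choice[eta heta] : forall s, exists eta, [/\ Xi eta, far_sites eta &
    same_orthant s (0 + 1) (eta - xi)].
  move=> s; have [N hN] := window_orthant s (0 + 1) xi 1.
  have [k' sk' sprk'] := rec2 (ex_intro _ k spr) s N.
  have [eta [Xeta keta] feta] := spread_far_sites sprk'.
  by exists eta; split=> //; exact: hN keta.
pose K := \sum_s dotp (eta s - xi) (eta s - xi).
have K0 : 0 <= K by apply: sumr_ge0 => s _; exact: dotpp_ge0.
have hK s : dotp (eta s - xi) (eta s - xi) <= K.
  by rewrite /K (bigD1 s) //= lerDl sumr_ge0 // => s' _; exact: dotpp_ge0.
have [x xxi hx] := far_sites_dist K fxi.
have [s sx] := orthant_exists (x - xi).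
have [Xeta feta seta] := heta s.
have : euclidean_norm (x - eta s) < euclidean_norm (x - xi).
  rewrite -[ltRHS]subr0; apply: closer_in_orthant seta sx _ _ => //.
    by have := hK s; have := dotpp_ge0 (eta s - xi); move: hx; lra.
  exact: le_lt_trans hx.
have [|c] := far_sites_cover Xeta feta (y := x); first by rewrite xxi.
by rewrite xxi => -[<-]; rewrite leNgt => /negP.
Qed.

End stable_allocations.

(** * Territories of a stable factor allocation *)

Section shifts.
Context (R : realType) (d : nat).
Implicit Types (psi : 'rV[R]_d -> allotment R d) (t x y z : 'rV[R]_d)
  (j k : 'rV[int]_d).

Definition shifted t psi psi' : Prop := forall x,
  psi' (x + t) = map_allotment (translation t) (psi x).

Lemma lattice_opp j : lattice R (- j) = - lattice R j.
Proof. by apply/rowP => i; rewrite !mxE rmorphN. Qed.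

Lemma map_allotmentK t (v : allotment R d) :
  map_allotment (translation (- t)) (map_allotment (translation t) v) = v.
Proof. by case: v => //= c; rewrite /translation addrK. Qed.

Lemma shifted_opp t psi psi' : shifted t psi psi' -> shifted (- t) psi' psi.
Proof.
move=> h x; rewrite -[in RHS](subrK t x) h map_allotmentK //.
Qed.

Lemma vol_shifted t psi psi' (Q Q' : set (allotment R d * 'rV[R]_d)) :
  measurable_fun [set: 'rV[R]_d] psi' -> measurable Q' ->
  shifted t psi psi' ->
  (forall v z, Q' (map_allotment (translation t) v, z + t) <-> Q (v, z)) ->
  vol R d [set z | Q' (psi' z, z)] = vol R d [set z | Q (psi z, z)].
Proof.
move=> mpsi' mQ' sh QQ'; rewrite -(vol_translate t); last exact: measurable_sites.
by congr (vol R d _); apply/seteqP; split => z /=; rewrite sh => /QQ'.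
Qed.

Lemma window_shift (a : R) k j z :
  window a (k + j) (z + lattice R j) <-> window a k z.
Proof.
by split=> h i; have := h i; rewrite !mxE rmorphD opprD addrACA subrr addr0.
Qed.

Lemma Center_shift t (v : allotment R d) (P P' : 'rV[R]_d -> Prop) :
  (forall c, P' (c + t) <-> P c) ->
  (exists2 c, map_allotment (translation t) v = Center c & P' c) <->
  (exists2 c, v = Center c & P c).
Proof.
move=> PP'; split.
  case: v => /= [c||]; [|by case|by case].
  by case=> _ [<-] /PP' Pc; exists c.
by case=> c -> /PP' Pc; exists (c + t).
Qed.

Lemma addrBKr (x y t : 'rV[R]_d) : x + t - (y + t) = x - y.
Proof. by rewrite opprD addrACA subrr addr0. Qed.

Lemma Delta_shift t (v : allotment R d) :
  map_allotment (translation t) v <> Delta <-> v <> Delta.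
Proof. by case: v. Qed.

Lemma unowned_shift t rho v z :
  unowned rho (map_allotment (translation t) v, z + t) <-> unowned rho (v, z).
Proof.
have h := @Center_shift t v (fun c => euclidean_norm (z - c) <= rho)
  (fun c => euclidean_norm (z + t - c) <= rho).
have {}h := h (fun c => ltac:(by rewrite addrBKr)).
by have := Delta_shift t v; rewrite /unowned /=; tauto.
Qed.

Lemma bad_window_shift j psi psi' k : measurable_fun [set: 'rV[R]_d] psi' ->
  shifted (lattice R j) psi psi' -> bad_window psi k -> bad_window psi' (k + j).
Proof.
move=> mpsi' sh bad N; move: (bad N); congr (_ <> _); apply/esym.
apply: (@vol_shifted (lattice R j) psi psi'
  [set p | window 2 k p.2 /\ unowned N%:R p]
  [set p | window 2 (k + j) p.2 /\ unowned N%:R p]) => //.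
- apply: measurableI; last exact: measurable_unowned.
  exact: measurable_preimage measurable_snd (measurable_window _ _).
- by move=> v z; rewrite /= window_shift unowned_shift.
Qed.

Lemma latticeD k j : lattice R (k + j) = lattice R k + lattice R j.
Proof. by apply/rowP => i; rewrite !mxE rmorphD. Qed.

Lemma dominating_shift j psi psi' k : measurable_fun [set: 'rV[R]_d] psi' ->
  shifted (lattice R j) psi psi' -> dominating psi k -> dominating psi' (k + j).
Proof.
rewrite /dominating => mpsi' sh <-.
apply: vol_shifted sh _ => //; first exact: measurable_undominated.
move=> v z; rewrite /undominated /= latticeD addrBKr.
have h := @Center_shift (lattice R j) v (fun c => euclidean_norm (z - c) <=
  euclidean_norm (z - lattice R k) + Num.sqrt d%:R) (fun c =>
  euclidean_norm (z + lattice R j - c) <= euclidean_norm (z - lattice R k) + Num.sqrt d%:R).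
have {}h := h (fun c => ltac:(by rewrite addrBKr)).
by have := Delta_shift (lattice R j) v; tauto.
Qed.

Lemma pinched_shift t psi psi' r e y : measurable_fun [set: 'rV[R]_d] psi' ->
  shifted t psi psi' -> pinched psi' r e (y + t) <-> pinched psi r e y.
Proof.
move=> mpsi' sh; rewrite /pinched.
rewrite (@vol_shifted t psi psi' (pinch_violation r e y)) //.
  exact: measurable_pinch_violation.
by move=> v z; apply: Center_shift => c; rewrite /= !addrBKr.
Qed.

Definition rat_lattice j : 'rV[rat]_d := map_mx intr j.

Lemma rat_rV_lattice q j : rat_rV R (q + rat_lattice j) = rat_rV R q + lattice R j.
Proof. by apply/rowP => i; rewrite !mxE rmorphD /= ratr_int. Qed.

Lemma candidate_shift j psi psi' c rad r m q : measurable_fun [set: 'rV[R]_d] psi' ->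
  shifted (lattice R j) psi psi' ->
  candidate psi' (c + rat_lattice j) rad r m (q + rat_lattice j) <->
  candidate psi c rad r m q.
Proof.
move=> mpsi' sh; rewrite /candidate rat_rV_lattice (pinched_shift _ _ _ mpsi' sh).
by split=> -[h1 h2]; split=> // i; have := h1 i; rewrite !mxE opprD addrACA subrr addr0.
Qed.

(** The selector searches among rational points, and lattice translations permute these. *)
Lemma selector_shift j psi psi' c rad r : measurable_fun [set: 'rV[R]_d] psi' ->
  shifted (lattice R j) psi psi' ->
  selector psi' (c + rat_lattice j) rad r = selector psi c rad r + lattice R j.
Proof.
move=> mpsi' sh; apply/rowP => i; rewrite !mxE -inf_shift; last exact: has_inf_steps.
congr inf; rewrite image_comp; apply: eq_imagel => m _ /=.
rewrite /selector_step -sup_shift; last exact: has_sup_candidates.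
congr sup; rewrite image_comp.
have e q : candidate_coord psi' (c + rat_lattice j) rad r m i (q + rat_lattice j) =
    candidate_coord psi c rad r m i q + (j 0 i)%:~R.
  rewrite /candidate_coord (asbool_equiv_eq (candidate_shift _ _ _ _ _ mpsi' sh)).
  by case: ifP => _; rewrite !mxE ?(addrAC _ _ (- rad)) rmorphD /= ratr_int.
apply/seteqP; split => [_ [q _ <-]|_ [q _ <-]] /=.
  by exists (q - rat_lattice j) => //; rewrite -e subrK.
by exists (q + rat_lattice j) => //; rewrite e.
Qed.

Lemma spread_shift j psi psi' k : measurable_fun [set: 'rV[R]_d] psi' ->
  shifted (lattice R j) psi psi' -> spread psi k -> spread psi' (k + j).
Proof.
move=> mpsi' sh spr N.
(* Remoteness is measured from the origin, so the threshold is raised by the length of the shift. *)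
have [c [rad [r [hN [xi sxi kxi]]]]] := spr (N + Num.bound (euclidean_norm (lattice R j)))%N.
exists (c + rat_lattice j), rad, r; rewrite (selector_shift _ _ _ mpsi' sh); split; last first.
  by exists (xi + lattice R j); [rewrite sh sxi|apply/window_shift].
have := archi_boundP (euclidean_norm_ge0 (lattice R j)).
have := euclidean_normD (selector psi c rad r + lattice R j) (- lattice R j).
rewrite addrK euclidean_normN; move: hN; rewrite natrD; lra.
Qed.

End shifts.

(** * Measurability of the window events *)

Section measurable_events.
Context (R : realType) (d : nat) (dX : measure_display) (X : measurableType dX).
Context (Psi : X * 'rV[R]_d -> allotment R d).
Context (mPsi : measurable_fun [set: X * 'rV[R]_d] Psi).

Let psi x z := Psi (x, z).

Lemma measurable_vol_null (Q : set (allotment R d * 'rV[R]_d)) : measurable Q ->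
  measurable [set x | vol R d [set z | Q (psi x z, z)] = 0%E].
Proof.
move=> mQ; pose D := (fun p => (Psi p, p.2)) @^-1` Q.
have mD : measurable D.
  by apply: measurable_preimage mQ; apply: measurable_fun_pair => //; exact: measurable_snd.
rewrite (_ : mkset _ = (fun x => vol R d (xsection D x)) @^-1` [set 0%E]).
  apply: measurable_preimage; first exact: measurable_fun_xsection.
  exact: emeasurable_set1.
apply/seteqP; split => x /=; rewrite (_ : xsection D x = [set z | Q (psi x z, z)]) //;
  by apply/seteqP; split=> z; rewrite /xsection /= inE.
Qed.

Lemma measurable_bad_window k : measurable [set x | bad_window (psi x) k].
Proof.
rewrite (_ : mkset _ = \bigcap_N ~` [set x | vol R d
    [set z | [set p | window 2 k p.2 /\ unowned N%:R p] (psi x z, z)] = 0%E]).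
  apply: bigcap_measurableType => N _; apply: measurableC; apply: measurable_vol_null.
  apply: measurableI; last exact: measurable_unowned.
  exact: measurable_preimage measurable_snd (measurable_window _ _).
by apply/seteqP; split => x h N; [move=> _|]; exact: h.
Qed.

Lemma measurable_dominating k : measurable [set x | dominating (psi x) k].
Proof. by apply: measurable_vol_null; exact: measurable_undominated. Qed.

Lemma measurable_selector c rad r :
  measurable_fun [set: X] (fun x => selector (psi x) c rad r).
Proof.
pose en n : 'rV[rat]_d := odflt 0 (unpickle n).
have enP q : exists n, en n = q by exists (pickle q); rewrite /en pickleK.
apply: measurable_fun_rV => i.
have mcand m q : measurable_fun [set: X] (fun x => candidate_coord (psi x) c rad r m i q).
  apply: measurable_fun_ifT => //; apply: (measurable_fun_bool true).
  rewrite setTI (_ : _ @^-1` _ = [set x | candidate (psi x) c rad r m q]); last first.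
    by apply/seteqP; split => x /= /asboolP.
  have [h|h] := pselect (forall i, `|q 0 i - c 0 i| <= rad); last first.
    by rewrite (_ : mkset _ = set0) // -subset0 => x [].
  rewrite (_ : mkset _ = [set x | pinched (psi x) (ratr r) (m.+1%:R^-1) (rat_rV R q)]).
    by apply: measurable_vol_null; exact: measurable_pinch_violation.
  by apply/seteqP; split => x //= -[].
have mstep m : measurable_fun [set: X] (fun x => selector_step (psi x) c rad r m i).
  apply: (eq_measurable_fun (fun x =>
    sups (fun n => candidate_coord (psi x) c rad r m i (en n)) 0)).
    move=> x _; rewrite /sups /sdrop; congr sup; apply/seteqP; split => [_ [n _ <-]|_ [q _ <-]].
      by exists (en n).
    by have [n <-] := enP q; exists n.
  apply: measurable_fun_sups => // x _.
  by exists (ratr (c 0 i + `|rad|)) => _ [n _ <-]; exact: candidate_coord_le.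
apply: (eq_measurable_fun (fun x => infs (fun m => selector_step (psi x) c rad r m i) 0)).
  move=> x _; rewrite mxE /infs /sdrop; congr inf; apply/seteqP; split => [_ [n _ <-]|_ [n _ <-]];
  by exists n.
apply: measurable_fun_infs => // x _.
by exists (ratr (c 0 i - rad)) => _ [n _ <-]; exact: step_ge.
Qed.

Lemma measurable_spread k : measurable [set x | spread (psi x) k].
Proof.
pose E (N : nat) (p : 'rV[rat]_d * rat * rat) :=
  [set x | N%:R < euclidean_norm (selector (psi x) p.1.1 p.1.2 p.2)] `&`
  (fun x => Psi (x, selector (psi x) p.1.1 p.1.2 p.2)) @^-1`
    [set v | exists2 xi, v = Center xi & window 1 k xi].
rewrite (_ : mkset _ = \bigcap_N \bigcup_p E N p); last first.
  apply/seteqP; split => x h N.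
    by move=> _; have [c [rad [r [h1 h2]]]] := h N; exists (c, rad, r).
  by have [[[c rad] r] _ [h1 h2]] := h N Logic.I; exists c, rad, r.
apply: bigcap_measurableType => N _.
apply: countable_bigcupT_measurable => [|p]; first exact: countableP.
apply: measurableI.
  apply: measurable_lt_set => //.
  by apply: measurable_euclidean_norm; exact: measurable_selector.
apply: measurable_preimage.
  apply: (measurableT_comp mPsi); apply: measurable_fun_pair => //.
  exact: measurable_selector.
rewrite /measurable /= /allotment_measurable /=.
rewrite (_ : _ @^-1` _ = window 1 k); first exact: measurable_window.
by apply/seteqP; split => [c [_ [<-]]|c kc] //; exists c.
Qed.

End measurable_events.

Section almost_sure_territories.
Context (R : realType) (d : nat) (dOmega : measure_display)
  (Omega : measurableType dOmega) (Pr : probability Omega R)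
  (Pi : {RV Pr >-> point_measure R d}) (invariant_Pi : translation_invariant Pi)
  (alpha : R) (dom : set (point_measure R d))
  (Psi : point_measure R d -> 'rV[R]_d -> allotment R d)
  (sfa : stable_factor_allocation Pi alpha dom Psi).

(** The value [Delta] outside [dom] makes the map measurable on the whole product. *)
Let Psi0 (p : point_measure R d * 'rV[R]_d) : allotment R d :=
  if `[< dom p.1 >] then Psi p.1 p.2 else Delta.

Let mdom : measurable dom.
Proof. by have [[]] := sfa. Qed.

Let mPsi0 : measurable_fun [set: point_measure R d * 'rV[R]_d] Psi0.
Proof.
have [[_ _ mPsi _ _] _] := sfa.
have mdomT : measurable (dom `*` [set: 'rV[R]_d]) by exact: measurableX.
move=> _ Y mY; rewrite setTI.
rewrite (_ : Psi0 @^-1` Y = (dom `*` setT) `&` (fun p => Psi p.1 p.2) @^-1` Y `|`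
    (~` (dom `*` setT) `&` (if `[< Y Delta >] then setT else set0))).
  apply: measurableU; first exact: mPsi.
  by apply: measurableI; [exact: measurableC|case: ifP].
apply/seteqP; split => -[pi z]; rewrite /Psi0 /=.
  case: asboolP => [dpi YPsi|ndpi YD]; first by left.
  by right; split=> [[]//|]; rewrite asboolT.
case=> [[[dpi _] YPsi]|[ndpi]]; first by rewrite asboolT.
by case: asboolP => // YD _; rewrite asboolF // => dpi; apply: ndpi.
Qed.

Let Psi0E pi : dom pi -> (fun z => Psi0 (pi, z)) = Psi pi.
Proof. by move=> dpi; apply/funext => z; rewrite /Psi0 /= asboolT. Qed.

Let mPsi pi : dom pi -> measurable_fun [set: 'rV[R]_d] (Psi pi).
Proof. by have [[_ _ _ h _] _] := sfa => /h[]. Qed.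

Lemma recurrent_ae (P : ('rV[R]_d -> allotment R d) -> 'rV[int]_d -> Prop) :
  (forall k, measurable [set pi | P (fun z => Psi0 (pi, z)) k]) ->
  (forall j psi psi' k, measurable_fun [set: 'rV[R]_d] psi' ->
    shifted (lattice R j) psi psi' -> P psi k -> P psi' (k + j)) ->
  {ae Pr, forall w, dom (Pi w) -> recurrent (P (Psi (Pi w)))}.
Proof.
move=> mP shP.
pose B k := [set pi | dom pi /\ P (Psi pi) k].
have mB k : measurable (B k).
  rewrite (_ : B k = dom `&` [set pi | P (fun z => Psi0 (pi, z)) k]); first exact: measurableI.
  by apply/seteqP; split => pi [/= dpi]; rewrite Psi0E.
have eB j k pi : B (k + j) (translate (lattice R j) pi) <-> B k pi.
  have [[_ _ _ _ eq] _] := sfa; have [dE sh] := eq (lattice R j) pi; split.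
  - move=> [/dE dpi Pk]; split=> //.
    have := sh dpi; rewrite -/(shifted _ _ _) => /shifted_opp.
    rewrite -lattice_opp => sh'.
    by have := shP _ _ _ _ (mPsi dpi) sh' Pk; rewrite addrK.
  - move=> [dpi Pk]; split; first exact/dE.
    have dpi' : dom (translate (lattice R j) pi) by apply/dE.
    exact: shP (mPsi dpi') (sh dpi) Pk.
apply: filterS (orthant_recurrence invariant_Pi mB eB) => w h dw [k Pk] s N.
have [|k' sk' [_ Pk']] := h _ s N; first by exists k.
by exists k'.
Qed.

Lemma dom_ae : {ae Pr, forall w, dom (Pi w)}.
Proof.
have [[_ [N [mN N0 hN]] _ _ _] _] := sfa.
exists (Pi @^-1` N); split=> //; first exact: measurable_preimage.
by move=> w /= nd; exact: hN.
Qed.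

Lemma territories_ae : {ae Pr, forall w,
  (forall xi, centers (Pi w) xi -> bounded_set (territory (Psi (Pi w)) xi)) /\
  (forall B : set 'rV[R]_d, bounded_set B ->
    finite_set [set xi | centers (Pi w) xi /\
                         (B `&` territory (Psi (Pi w)) xi) !=set0])}.
Proof.
have rec1 := recurrent_ae (measurable_bad_window mPsi0) (@bad_window_shift R d).
have rec2 := recurrent_ae (measurable_dominating mPsi0) (@dominating_shift R d).
have rec3 := recurrent_ae (measurable_spread mPsi0) (@spread_shift R d).
have [[_ _ _ allocP _] st] := sfa.
near=> w.
have dw : dom (Pi w) by near: w; exact: dom_ae.
have stw : stable (centers (Pi w)) alpha (Psi (Pi w)) by near: w.
have [dXi mpsi cXi D0 _] := allocP _ dw.
have mD : measurable (Psi (Pi w) @^-1` [set Delta]).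
  apply: measurable_preimage => //.
  rewrite /measurable /= /allotment_measurable /= (_ : _ @^-1` _ = set0) //.
  by rewrite -subset0 => c.
have D0' : (vol R d).-negligible (Psi (Pi w) @^-1` [set Delta]).
  by apply/negligibleP => //; have := D0; rewrite volumeE.
have r1 : dom (Pi w) -> recurrent (bad_window (Psi (Pi w))) by near: w.
have r2 : dom (Pi w) -> recurrent (dominating (Psi (Pi w))) by near: w.
have r3 : dom (Pi w) -> recurrent (spread (Psi (Pi w))) by near: w.
split; first exact: (bounded_territories mpsi cXi dXi D0' stw (r2 dw) (r3 dw)).
exact: (locally_finite_territories mpsi cXi dXi D0' stw (r1 dw)).
Unshelve. all: by end_near. Qed.

End almost_sure_territories.

(** * The Gale-Shapley allocation *)

Section random_centers.
Context (R : realType) (d : nat) (dX : measure_display) (X : measurableType dX).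
Context (u : X -> point_measure R d).

Lemma measurable_count (A : set 'rV[R]_d) : measurable A ->
  measurable_fun [set: point_measure R d] (fun pi : point_measure R d => pi A).
Proof.
move=> mA _ Y mY; rewrite setTI; apply: sub_sigma_algebra; exists A => //.
by exists Y => //; rewrite setTI.
Qed.

Context (mu : measurable_fun [set: X] u).

Let ker (x : X) : {measure set 'rV[R]_d -> \bar R} := point_measure_val (u x).

Let measurable_ker (U : set 'rV[R]_d) : measurable U ->
  measurable_fun [set: X] (ker ^~ U).
Proof. by move=> mU; exact: measurableT_comp (measurable_count mU) mu. Qed.

HB.instance Definition _ := isKernel.Build _ _ _ _ _ ker measurable_ker.

(** The kernel argument for sections is run with finite measures, hence the restriction to a
    ball. *)
Lemma measurable_section_count n (E : set (X * 'rV[R]_d)) : measurable E ->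
  measurable_fun [set: X] (fun x => u x (xsection E x `&` eball 0 n)).
Proof.
have mB := measurable_eball (0 : 'rV[R]_d) n.
have bd : forall x, exists M : R, forall A, measurable A -> (mrestr (ker x) mB A < M%:E)%E.
  move=> x; have [m hm] := point_measure_nat (u x) mB (bounded_eball _ _).
  exists (m%:R + 1) => A mA; apply: (@le_lt_trans _ _ m%:R%:E); last by rewrite lte_fin ltrDl.
  rewrite -hm /mrestr; apply: le_measure; rewrite ?inE //; exact: measurableI.
by move=> mE; have [_] := measurable_prod_subset_xsection_kernel bd mE.
Qed.

End random_centers.

Section exists_center.
Context (R : realType) (d : nat) (dX : measure_display) (X : measurableType dX).
Context (u : X -> point_measure R d).
Context (mu : measurable_fun [set: X] u).

Lemma measurable_rV_eq : measurable [set p : 'rV[R]_d * 'rV[R]_d | p.1 = p.2].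
Proof.
rewrite (_ : mkset _ = [set p | euclidean_norm (p.1 - p.2) = 0]).
  by apply: measurable_eq_set => //; exact: measurable_euclidean_dist.
apply/seteqP; split => [[x y] /= ->|[x y] /= /euclidean_norm_eq0 /eqP].
  by rewrite subrr euclidean_norm0.
by rewrite subr_eq0 => /eqP.
Qed.

Lemma eball_exhaust (x : 'rV[R]_d) : exists n : nat, eball 0 n%:R x.
Proof.
exists (Num.bound (euclidean_norm x)).
by rewrite /eball /= subr0 archi_boundP // euclidean_norm_ge0.
Qed.

(** The mass of a moving point is a section count: the section of the diagonal at (x, z) is the
    singleton of z. *)
Lemma measurable_center_graph :
  measurable [set p : X * 'rV[R]_d | centers (u p.1) p.2].
Proof.
pose v (p : X * 'rV[R]_d) := u p.1.
have mv : measurable_fun [set: X * 'rV[R]_d] v by exact: measurableT_comp mu measurable_fst.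
pose E : set (X * 'rV[R]_d * 'rV[R]_d) := [set q | q.1.2 = q.2].
have mE : measurable E.
  apply: (measurable_preimage (f := fun q : X * 'rV[R]_d * 'rV[R]_d => (q.1.2, q.2)))
    measurable_rV_eq.
  apply: measurable_fun_pair; last exact: measurable_snd.
  exact: measurableT_comp measurable_snd measurable_fst.
have EE p : xsection E p = [set p.2].
  by apply/seteqP; split => z; rewrite /xsection /E /= inE /=.
rewrite (_ : mkset _ = \bigcup_(n : nat)
    [set p | v p (xsection E p `&` eball 0 n%:R) = 1%E]).
  apply: bigcupT_measurable => n.
  exact: measurable_preimage (measurable_section_count mv n%:R mE) (emeasurable_set1 1%E).
apply/seteqP; split => [[x z] /= cz|[x z] /= [n _] /=].
  have [n nz] := eball_exhaust z; exists n => //=.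
  rewrite EE /= (_ : _ `&` _ = [set z]) //.
  by apply/seteqP; split => [y [] //|y ->].
rewrite EE /=; have [nz|nz] := pselect (eball 0 n%:R z).
  rewrite (_ : _ `&` _ = [set z]) //.
  by apply/seteqP; split => [y [] //|y ->].
rewrite (_ : _ `&` _ = set0); last by rewrite -subset0 => y [-> /nz].
by rewrite measure0 => /eqP; rewrite lt_eqF // lte01.
Qed.

(** Existence of a center in a section means that the section of [E], cut down to the centers, has
    positive mass in some ball; this replaces a projection by a count. *)
Lemma measurable_exists_center (E : set (X * 'rV[R]_d)) : measurable E ->
  measurable [set x | exists2 z, centers (u x) z & E (x, z)].
Proof.
move=> mE; pose C := E `&` [set p : X * 'rV[R]_d | centers (u p.1) p.2].
have mC : measurable C by apply: measurableI => //; exact: measurable_center_graph.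
have Csec x z : xsection C x z <-> E (x, z) /\ centers (u x) z.
  by rewrite /xsection /C /= inE.
rewrite (_ : mkset _ = \bigcup_(n : nat)
    [set x | (0 < u x (xsection C x `&` eball 0 n%:R))%E]).
  apply: bigcupT_measurable => n.
  have := emeasurable_fun_o_infty measurableT (measurable_section_count mu n%:R mC) 0%E.
  by rewrite setTI.
apply/seteqP; split => [x [z cz Ez]|x [n _] /=].
  have [n nz] := eball_exhaust z; exists n => //=.
  have mz : measurable [set z].
    rewrite (_ : [set z] = (pair z) @^-1` [set p | p.1 = p.2]); last first.
      by apply/seteqP; split.
    by apply: measurable_preimage measurable_rV_eq; exact: pair1_measurable.
  have cz1 : u x [set z] = 1%E by exact: cz.
  apply: (@lt_le_trans _ _ (u x [set z])); first by rewrite cz1 lte01.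
  apply: le_measure; rewrite ?inE //.
    by apply: measurableI; [exact: measurable_xsection|exact: measurable_eball].
  by move=> _ ->; split=> //; apply/Csec.
move=> h; apply: contrapT => nz; move: h.
rewrite (_ : _ `&` _ = set0) ?measure0 ?ltxx // -subset0 => z [/Csec[Ez cz] _].
by apply: nz; exists z.
Qed.

End exists_center.

Section discrete_sets.
Context (R : realType) (d : nat).
Implicit Types (Xi : set 'rV[R]_d) (x y : 'rV[R]_d).

Lemma discrete_countable Xi : discrete_centers Xi -> countable Xi.
Proof.
move=> dXi; apply: (@sub_countable _ _ Xi (\bigcup_(n : nat) (eball 0 n%:R `&` Xi))).
  by apply: subset_card_le => x Xx; have [n nx] := eball_exhaust x; exists n.
apply: bigcup_countable => // n _; apply: finite_set_countable; apply: dXi.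
exact: bounded_eball.
Qed.

Lemma countable_union_measurable Xi (F : 'rV[R]_d -> set 'rV[R]_d) :
  countable Xi -> (forall y, measurable (F y)) -> measurable (\bigcup_(y in Xi) F y).
Proof.
move=> /pfcard_geP[->|[f]] mF; first by rewrite bigcup_set0.
rewrite (_ : \bigcup_(y in Xi) F y = \bigcup_n F (f n)).
  exact: bigcupT_measurable.
apply/seteqP; split => [x [y Xy Fx]|x [n _ Fx]]; last by exists (f n) => //; exact: funS.
by have [n _ fn] := 'surj_f Xy; exists n => //; rewrite fn.
Qed.

Lemma countable_union_negligible Xi (F : 'rV[R]_d -> set 'rV[R]_d) :
  countable Xi -> (forall y, Xi y -> (vol R d).-negligible (F y)) ->
  (vol R d).-negligible (\bigcup_(y in Xi) F y).
Proof.
move=> /pfcard_geP[->|[f]] nF; first by rewrite bigcup_set0; exact: negligible_set0.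
apply: (@negligibleS _ _ _ _ (\bigcup_n F (f n))); last first.
  by apply: negligible_bigcup => n; apply: nF; exact: funS.
move=> x [y Xy Fx]; have [n _ fn] := 'surj_f Xy.
by exists n => //; rewrite fn.
Qed.

Lemma finite_argmin (F : set 'rV[R]_d) (f : 'rV[R]_d -> R) : finite_set F ->
  F !=set0 -> exists2 y, F y & forall z, F z -> f y <= f z.
Proof.
move=> /finite_seqP[s ->] [x0 /= x0s].
have : s != [::] by case: s x0s.
elim: s {x0 x0s} => // x s IH _.
have [->|s0] := eqVneq s [::].
  by exists x => [|z]; rewrite /= ?inE // => /eqP ->.
have [y /= ys hy] := IH s0; have [xy|yx] := leP (f x) (f y).
  exists x => [|z /=]; first by rewrite /= inE eqxx.
  by rewrite inE => /orP[/eqP->//|/hy]; exact: le_trans.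
exists y => [|z /=]; first by rewrite /= inE ys orbT.
by rewrite inE => /orP[/eqP->|/hy//]; exact: ltW.
Qed.

End discrete_sets.

(** * Acceptance radii, satiation and stability *)

Section gale_shapley.
Context (R : realType) (n : nat).
Local Notation E := 'rV[R]_n.+1.
Implicit Types (Xi : set E) (x y z eta : E) (r : E -> \bar R).

(* Some center other than [y] that would still accept [x], given the
   acceptance radii [r], is at least as close to [x] as [y] is. *)
Definition excluded Xi r y x : Prop := exists2 eta, Xi eta &
  [/\ eta <> y, euclidean_norm (x - eta) <= euclidean_norm (x - y) &
      ((euclidean_norm (x - eta))%:E <= r eta)%E].

Definition reach Xi r y (q : R) : set E :=
  [set x | euclidean_norm (x - y) < q /\ ~ excluded Xi r y x].

(** Restricting to rational radii does not change the supremum and makes it countable. *)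
Definition step Xi (alpha : R) r y : \bar R :=
  ereal_sup [set (ratr q)%:E | q in
    [set q : rat | (vol R n.+1 (reach Xi r y (ratr q)) <= alpha%:E)%E]].

(* Each round of proposals lets every center keep the closest applicants up to
   its appetite; the state is the family of acceptance radii. *)
Fixpoint radii Xi (alpha : R) (k : nat) : E -> \bar R :=
  if k is k'.+1 then step Xi alpha (radii Xi alpha k') else fun=> +oo%E.

Definition acceptance_radius Xi alpha y : \bar R :=
  ereal_inf [set radii Xi alpha k y | k in [set: nat]].

(** Strict for the radius of [y], weak for the exclusion: catchments are disjoint, ties and
    acceptance spheres go to [Delta], and only strict inequalities remain in the description of a
    territory. *)
Definition catchment Xi r y : set E :=
  [set x | ((euclidean_norm (x - y))%:E < r y)%E /\ ~ excluded Xi r y x].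

Definition radial_allocation Xi r x : allotment R n.+1 :=
  match pselect (exists2 y, Xi y & catchment Xi r y x) with
  | left h => Center (s2val (cid2 h))
  | right _ => if `[< forall y, Xi y -> (r y < (euclidean_norm (x - y))%:E)%E >]
               then Unclaimed else Delta
  end.

Definition gale_shapley Xi alpha : E -> allotment R n.+1 :=
  radial_allocation Xi (acceptance_radius Xi alpha).

Lemma catchment_disjoint Xi r x y y' : Xi y -> Xi y' ->
  catchment Xi r y x -> catchment Xi r y' x -> y = y'.
Proof.
move=> Xy Xy' [ry ny] [ry' ny']; apply: contrapT => yy'.
have [h|/ltW h] := leP (euclidean_norm (x - y)) (euclidean_norm (x - y')).
  by apply: ny'; exists y => //; split=> //; exact: ltW.
by apply: ny; exists y' => //; split=> //; [move=> e; apply: yy'|exact: ltW].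
Qed.

Lemma radial_CenterP Xi r x y :
  radial_allocation Xi r x = Center y <-> Xi y /\ catchment Xi r y x.
Proof.
rewrite /radial_allocation; case: pselect => [h|h].
  case: cid2 => z Xz dz /=; split=> [[<-]//|[Xy dy]].
  by rewrite (catchment_disjoint Xz Xy dz dy).
split=> [|[Xy dy]]; first by case: ifP.
by exfalso; apply: h; exists y.
Qed.

Lemma radial_UnclaimedP Xi r x : (forall y, Xi y -> (0 <= r y)%E) ->
  radial_allocation Xi r x = Unclaimed <->
  (forall y, Xi y -> (r y < (euclidean_norm (x - y))%:E)%E).
Proof.
move=> r0; rewrite /radial_allocation; case: pselect => [[y Xy dy]|h].
  case: cid2 => z Xz dz /=; split=> // hr; have [rz _] := dz.
  by have := lt_trans rz (hr z Xz); rewrite ltxx.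
by case: asboolP; split.
Qed.

Lemma excluded_mono Xi r r' y x : (forall z, Xi z -> (r z <= r' z)%E) ->
  excluded Xi r y x -> excluded Xi r' y x.
Proof.
move=> rr' [eta Xeta [h1 h2 h3]]; exists eta => //; split=> //.
exact: le_trans h3 (rr' _ Xeta).
Qed.

Section discrete.
Context (Xi : set E) (alpha : R) (alpha0 : 0 < alpha) (dXi : discrete_centers Xi).

Lemma measurable_excluded r y : measurable [set x | excluded Xi r y x].
Proof.
rewrite (_ : mkset _ = \bigcup_(eta in Xi) [set x | [/\ eta <> y,
    euclidean_norm (x - eta) <= euclidean_norm (x - y) &
    ((euclidean_norm (x - eta))%:E <= r eta)%E]]).
  apply: countable_union_measurable; first exact: discrete_countable.
  move=> eta; have [->|ey] := pselect (eta = y).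
    by rewrite (_ : mkset _ = set0) // -subset0 => x [].
  rewrite (_ : mkset _ =
      [set x | euclidean_norm (x - eta) <= euclidean_norm (x - y)] `&`
      [set x | ((euclidean_norm (x - eta))%:E <= r eta)%E]); last first.
    by apply/seteqP; split => x; [case|case; split].
  apply: measurableI; first by apply: measurable_le_set; exact: measurable_euclidean_dist.
  rewrite -[X in measurable X]setTI; apply: measurable_lee => //.
  by apply/measurable_EFinP; exact: measurable_euclidean_dist.
by apply/seteqP; split.
Qed.

Lemma reachE r y q : reach Xi r y q = eball y q `&` ~` [set x | excluded Xi r y x].
Proof. by []. Qed.

Lemma measurable_reach r y q : measurable (reach Xi r y q).
Proof.
rewrite reachE; apply: measurableI; first exact: measurable_eball.
by apply: measurableC; exact: measurable_excluded.
Qed.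

Lemma vol_reach_fin r y q : (vol R n.+1 (reach Xi r y q) < +oo)%E.
Proof.
apply: le_lt_trans (vol_eball_fin y q); apply: le_measure; rewrite ?inE.
- exact: measurable_reach.
- exact: measurable_eball.
- by move=> x [].
Qed.

Lemma vol_reach_mono r r' y q q' : (forall z, Xi z -> (r' z <= r z)%E) -> q <= q' ->
  (vol R n.+1 (reach Xi r y q) <= vol R n.+1 (reach Xi r' y q'))%E.
Proof.
move=> rr' qq'; apply: le_measure; rewrite ?inE; do ?exact: measurable_reach.
move=> x [xq nx]; split; first exact: lt_le_trans xq qq'.
by move=> /(excluded_mono rr').
Qed.

Lemma step_ge0 r y : (0 <= step Xi alpha r y)%E.
Proof.
apply: ereal_sup_ubound; exists 0; last by rewrite rmorph0.
rewrite /= (_ : reach _ _ _ _ = set0) ?measure0 ?lee_fin ?ltW //.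
by rewrite -subset0 => x []; rewrite rmorph0 ltNge euclidean_norm_ge0.
Qed.

Lemma step_mono r r' y : (forall z, Xi z -> (r' z <= r z)%E) ->
  (step Xi alpha r' y <= step Xi alpha r y)%E.
Proof.
move=> rr'; apply: ereal_sup_le => _ [q /= hq <-]; exists q => //=.
by apply: le_trans hq; exact: vol_reach_mono.
Qed.

Lemma vol_lt_step r y q : (q%:E < step Xi alpha r y)%E ->
  (vol R n.+1 (reach Xi r y q) <= alpha%:E)%E.
Proof.
move=> /ereal_sup_gt[_ [q' /= hq' <-]]; rewrite lte_fin => qq'.
by apply: le_trans hq'; apply: vol_reach_mono => //; exact: ltW.
Qed.

Lemma vol_gt_step r y q : (step Xi alpha r y < q%:E)%E ->
  (alpha%:E < vol R n.+1 (reach Xi r y q))%E.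
Proof.
move=> sq; have s0 := step_ge0 r y.
have [t st] : exists t, step Xi alpha r y = t%:E.
  by case: (step Xi alpha r y) sq s0 => [t _ _|//|//]; exists t.
have [q'] : exists q' : rat, ratr q' \in `]t, q[.
  by apply: rat_in_itvoo; rewrite -lte_fin -st.
rewrite in_itv /= => /andP[tq' q'q].
rewrite ltNge; apply/negP => hq; move: tq'; rewrite ltNge => /negP; apply.
rewrite -lee_fin -st; apply: ereal_sup_ubound; exists q' => //=.
by apply: le_trans hq; apply: vol_reach_mono => //; exact: ltW.
Qed.

Lemma radii_decr k y : (radii Xi alpha k.+1 y <= radii Xi alpha k y)%E.
Proof.
elim: k y => [|k IH] y; first exact: leey.
by apply: step_mono => z _; exact: IH.
Qed.

Lemma radii_decreasing k l y : (k <= l)%N ->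
  (radii Xi alpha l y <= radii Xi alpha k y)%E.
Proof.
move=> /subnK <-; elim: (l - k)%N => [|m IH] //.
by apply: le_trans (radii_decr _ _) IH.
Qed.

Lemma radius_le k y : (acceptance_radius Xi alpha y <= radii Xi alpha k y)%E.
Proof. by apply: ereal_inf_lbound; exists k. Qed.

Lemma radius_ge0 y : (0 <= acceptance_radius Xi alpha y)%E.
Proof.
apply: le_ereal_inf_tmp => _ [[|k] _ <-]; first exact: leey.
exact: step_ge0.
Qed.

(** Continuity of the iteration. A site excluded at every stage is excluded infinitely often by one
    and the same center, only finitely many being close enough; the radii decrease, so this center
    excludes it in the limit. *)
Lemma reach_radius y q :
  reach Xi (acceptance_radius Xi alpha) y q = \bigcup_k reach Xi (radii Xi alpha k) y q.
Proof.
apply/seteqP; split => [x [xq nx]|x [k _ [xq nx]]]; last first.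
  by split=> // ex; apply: nx; apply: excluded_mono ex => z _; exact: radius_le.
apply: contrapT => nk.
have /choice[f hf] : forall k, exists eta, [/\ Xi eta, eta <> y,
    euclidean_norm (x - eta) <= euclidean_norm (x - y) &
    ((euclidean_norm (x - eta))%:E <= radii Xi alpha k eta)%E].
  move=> k; apply: contrapT => h; apply: nk; exists k => //; split=> //.
  by case=> eta Xeta [h1 h2 h3]; apply: h; exists eta.
have finF : finite_set (eball x (euclidean_norm (x - y) + 1) `&` Xi).
  by apply: dXi; exact: bounded_eball.
have F k : (eball x (euclidean_norm (x - y) + 1) `&` Xi) (f k).
  have [h1 _ h2 _] := hf k; split=> //; rewrite /eball /= (euclidean_distC (f k)).
  by apply: le_lt_trans h2 _; rewrite ltrDl.
have [eta _ heta] := infinitely_often_finite finF F.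
have [k0 _ fk0] := heta 0%N; have [X0 e0 d0 _] := hf k0.
apply: nx; exists eta; rewrite -fk0 //; split=> //; rewrite fk0.
apply: le_ereal_inf_tmp => _ [k _ <-].
have [l kl fl] := heta k; have [_ _ _] := hf l; rewrite fl => h.
exact: le_trans h (radii_decreasing _ kl).
Qed.

(** For q strictly between the two sides, the reach for the limit radii would have volume above
    [alpha], although it is an increasing limit of reaches of volume at most [alpha]. *)
Lemma radius_fixpoint y : step Xi alpha (acceptance_radius Xi alpha) y = acceptance_radius Xi alpha y.
Proof.
apply/eqP; rewrite eq_le; apply/andP; split.
  apply: le_ereal_inf_tmp => _ [k _ <-]; apply: le_trans (radii_decr k y).
  by apply: step_mono => z _; exact: radius_le.
rewrite leNgt; apply/negP => lt_sr.
have [q sq qr] : exists2 q : R, (step Xi alpha (acceptance_radius Xi alpha) y < q%:E)%E &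
    (q%:E < acceptance_radius Xi alpha y)%E.
  have := step_ge0 (acceptance_radius Xi alpha) y.
  case: (step _ _ _ _) lt_sr => [s lt_sr _|lt_sr _|//]; last first.
    by rewrite ltNge leey in lt_sr.
  case: (acceptance_radius Xi alpha y) lt_sr => [t|_|//].
    by rewrite lte_fin => st; exists ((s + t) / 2); rewrite lte_fin midf_lt.
  by exists (s + 1); rewrite ?ltry // lte_fin ltrDl.
have := vol_gt_step sq; rewrite reach_radius ltNge => /negP; apply.
have cvg : (vol R n.+1 \o (fun k => reach Xi (radii Xi alpha k) y q)) k @[k --> \oo] -->
    vol R n.+1 (\bigcup_k reach Xi (radii Xi alpha k) y q).
  apply: nondecreasing_cvg_mu.
  - by move=> k; exact: measurable_reach.
  - by apply: bigcupT_measurable => k; exact: measurable_reach.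
  - move=> k l kl; apply/subsetPset => x [xq nx]; split=> // ex; apply: nx.
    by apply: excluded_mono ex => z _; exact: radii_decreasing.
rewrite -(cvg_lim _ cvg) //; apply: lime_le; first by apply/cvg_ex; eexists; exact: cvg.
near=> k; apply: vol_lt_step; apply: lt_le_trans qr _.
(* The reach under the radii of stage k is controlled by the radius of stage k + 1. *)
exact: (radius_le k.+1).
Unshelve. all: by end_near. Qed.

Lemma vol_bigcup_le (F : nat -> set E) (a : \bar R) : (forall k, measurable (F k)) ->
  {homo F : k l / (k <= l)%N >-> k `<=` l} ->
  (forall k, (vol R n.+1 (F k) <= a)%E) -> (vol R n.+1 (\bigcup_k F k) <= a)%E.
Proof.
move=> mF ndF Fa.
have cvg : (vol R n.+1 \o F) k @[k --> \oo] --> vol R n.+1 (\bigcup_k F k).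
  apply: nondecreasing_cvg_mu => //; first exact: bigcupT_measurable.
  by move=> k l kl; apply/subsetPset; exact: ndF.
rewrite -(cvg_lim _ cvg) //; apply: lime_le; first by apply/cvg_ex; eexists; exact: cvg.
by near=> k; exact: Fa.
Unshelve. all: by end_near. Qed.

Let r := acceptance_radius Xi alpha.

Lemma measurable_catchment y : measurable (catchment Xi r y).
Proof.
rewrite (_ : catchment Xi r y = [set x | ((euclidean_norm (x - y))%:E < r y)%E] `&`
  ~` [set x | excluded Xi r y x]) //.
apply: measurableI; last by apply: measurableC; exact: measurable_excluded.
rewrite -[X in measurable X]setTI; apply: measurable_lte => //.
by apply/measurable_EFinP; exact: measurable_euclidean_dist.
Qed.

Lemma vol_catchment_le y : (vol R n.+1 (catchment Xi r y) <= alpha%:E)%E.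
Proof.
have := radius_ge0 y; rewrite -/r; case ry : (r y) => [rho||//] r0.
- rewrite (_ : catchment Xi r y = \bigcup_k reach Xi r y (rho - k.+1%:R^-1)).
    apply: vol_bigcup_le => [k|k l kl|k].
    + exact: measurable_reach.
    + move=> x [xk nx]; split=> //; apply: lt_le_trans xk _.
      by rewrite lerD2l lerN2 lef_pV2 ?posrE // ler_nat ltnS.
    + apply: vol_lt_step => //; rewrite radius_fixpoint // -/r ry lte_fin.
      by rewrite ltrBlDr ltrDl invr_gt0.
  apply/seteqP; split => [x [xr nx]|x [k _ [xk nx]]]; last first.
    split=> //; rewrite ry lte_fin; apply: lt_trans xk _.
    by rewrite ltrBlDr ltrDl invr_gt0.
  rewrite ry lte_fin in xr.
  have e0 : 0 < rho - euclidean_norm (x - y) by rewrite subr_gt0.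
  exists (Num.bound (rho - euclidean_norm (x - y))^-1) => //; split=> //.
  rewrite ltrBrDr addrC -ltrBrDr invf_plt ?posrE //.
  apply: lt_le_trans (archi_boundP _) _; first by rewrite invr_ge0 ltW.
  by rewrite ler_nat leqW.
- rewrite (_ : catchment Xi r y = \bigcup_(k : nat) reach Xi r y k%:R).
    apply: vol_bigcup_le => [k|k l kl|k].
    + exact: measurable_reach.
    + by move=> x [xk nx]; split=> //; apply: lt_le_trans xk _; rewrite ler_nat.
    + by apply: vol_lt_step => //; rewrite radius_fixpoint // -/r ry ltry.
  apply/seteqP; split => [x [xr nx]|x [k _ [xk nx]]]; last by split=> //; rewrite ry ltry.
  exists (Num.bound (euclidean_norm (x - y))) => //; split=> //.
  exact: archi_boundP (euclidean_norm_ge0 _).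
Qed.

(** Every radius above a finite [r y] overfills the appetite, and the limit of these reaches exceeds
    the catchment by at most a sphere, which is null. *)
Lemma vol_catchment_eq y : (r y < +oo)%E -> vol R n.+1 (catchment Xi r y) = alpha%:E.
Proof.
move=> ryoo; apply/eqP; rewrite eq_le vol_catchment_le /=.
have [rho ry] : exists rho, r y = rho%:E.
  by have := radius_ge0 y; rewrite -/r; case: (r y) ryoo => [t _ _|//|//]; exists t.
pose F k := reach Xi r y (rho + k.+1%:R^-1).
have mF k : measurable (F k) by exact: measurable_reach.
have mG : measurable (\bigcap_k F k) by apply: bigcap_measurableType.
have cvg : (vol R n.+1 \o F) k @[k --> \oo] --> vol R n.+1 (\bigcap_k F k).
  apply: nonincreasing_cvg_mu => //; first exact: vol_reach_fin.
  move=> k l kl; apply/subsetPset => x [xk nx]; split=> //; apply: lt_le_trans xk _.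
  by rewrite lerD2l lef_pV2 ?posrE // ler_nat ltnS.
have : (alpha%:E <= vol R n.+1 (\bigcap_k F k))%E.
  rewrite -(cvg_lim _ cvg) //; apply: lime_ge; first by apply/cvg_ex; eexists; exact: cvg.
  near=> k; apply/ltW/vol_gt_step => //.
  by rewrite radius_fixpoint // -/r ry lte_fin ltrDl invr_gt0.
move=> h; apply: le_trans h _.
have mS : measurable [set x : E | euclidean_norm (x - y) = rho].
  by apply: measurable_eq_set => //; exact: measurable_euclidean_dist.
apply: (@le_trans _ _ (vol R n.+1 (catchment Xi r y `|` [set x | euclidean_norm (x - y) = rho]))).
  apply: le_measure; rewrite ?inE //.
    by apply: measurableU => //; exact: measurable_catchment.
  move=> x xF; have [_ nx] := xF 0%N Logic.I.
  have [xr|] := ltP (euclidean_norm (x - y)) rho; first by left; split=> //; rewrite ry lte_fin.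
  rewrite le_eqVlt => /orP[/eqP xr|xr]; first by right.
  exfalso; have e0 : 0 < euclidean_norm (x - y) - rho by rewrite subr_gt0.
  have [+ _] := xF (Num.bound (euclidean_norm (x - y) - rho)^-1) Logic.I.
  rewrite ltNge => /negP; apply; rewrite addrC -lerBrDr.
  rewrite ltW // invf_plt ?posrE //.
  apply: lt_le_trans (archi_boundP _) _; first by rewrite invr_ge0 ltW.
  by rewrite ler_nat leqW.
rewrite -[leRHS]adde0 -(vol_sphere y rho).
by apply: measureU2 => //; exact: measurable_catchment.
Unshelve. all: by end_near. Qed.

Lemma territory_gale_shapley y : Xi y ->
  territory (gale_shapley Xi alpha) y = catchment Xi r y.
Proof.
move=> Xy; apply/seteqP; split => x; rewrite /territory /=.
  by move=> /radial_CenterP[].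
by move=> dx; apply/radial_CenterP.
Qed.

(** A center that covets [x] has [x] strictly inside its acceptance radius, since an unsated center
    has infinite radius. It then excludes [x] from every farther center and prevents [x] from being
    unclaimed. *)
Lemma stable_gale_shapley : stable Xi alpha (gale_shapley Xi alpha).
Proof.
move=> x xi [Xxi xxi _ des cov].
have r0 y : Xi y -> (0 <= r y)%E by move=> _; exact: radius_ge0.
have rx : ((euclidean_norm (x - xi))%:E < r xi)%E.
  case: cov => [[x' /radial_CenterP[_ [x'r _]] lt_x]|unsat].
    by apply: lt_trans x'r; rewrite lte_fin.
  suff -> : r xi = +oo%E by exact: ltry.
  apply/eqP; rewrite -leye_eq leNgt; apply/negP => /vol_catchment_eq h; apply: unsat.
  rewrite /sated volumeE; last by rewrite territory_gale_shapley //; exact: measurable_catchment.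
  by rewrite territory_gale_shapley.
case: des => [[eta /radial_CenterP[Xeta [_ nex]] lt_x]|/(radial_UnclaimedP _ r0)/(_ xi Xxi)].
  apply: nex; exists xi => //; split; last exact: ltW.
    by move=> e; move: lt_x; rewrite e ltxx.
  exact: ltW.
by move=> /(lt_trans rx); rewrite ltxx.
Qed.

(** Take the closest center that accepts such a site: the site is either on its acceptance sphere or
    equidistant from another accepting center. *)
Lemma Delta_gale_shapley :
  (vol R n.+1).-negligible (gale_shapley Xi alpha @^-1` [set Delta]).
Proof.
have cXi := discrete_countable dXi.
pose S y := [set x : E | (euclidean_norm (x - y))%:E = r y].
pose B y y' := [set x : E | y <> y' /\ euclidean_norm (x - y) = euclidean_norm (x - y')].
apply: (@negligibleS _ _ _ _ ((\bigcup_(y in Xi) S y) `|`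
    (\bigcup_(y in Xi) \bigcup_(y' in Xi) B y y'))); last first.
  apply: negligibleU.
    apply: countable_union_negligible => // y _; rewrite /S.
    case: (r y) => [rho||].
    - apply: (@negligibleS _ _ _ _ [set x | euclidean_norm (x - y) = rho]).
        by move=> x [].
      apply/negligibleP; last exact: vol_sphere.
      by apply: measurable_eq_set => //; exact: measurable_euclidean_dist.
    - by apply: negligibleS (negligible_set0 _) => x.
    - by apply: negligibleS (negligible_set0 _) => x.
  apply: countable_union_negligible => // y _.
  apply: countable_union_negligible => // y' _.
  have [<-|yy'] := pselect (y = y').
    by apply: negligibleS (negligible_set0 _) => x [].
  apply: (@negligibleS _ _ _ _ [set x | euclidean_norm (x - y) = euclidean_norm (x - y')]).
    by move=> x [].
  apply/negligibleP; last by apply: vol_bisector; apply/eqP.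
  by apply: measurable_eq_set => //; exact: measurable_euclidean_dist.
move=> x xD.
pose F := [set eta | Xi eta /\ ((euclidean_norm (x - eta))%:E <= r eta)%E].
have [eta0 [Xeta0 xeta0]] : F !=set0.
  apply: contrapT => h.
  have : gale_shapley Xi alpha x = Unclaimed.
    apply/radial_UnclaimedP => [y _|y Xy]; first exact: radius_ge0.
    by rewrite ltNge; apply/negP => hy; apply: h; exists y.
  by rewrite xD.
have finF' : finite_set (F `&` [set eta | euclidean_norm (x - eta) <= euclidean_norm (x - eta0)]).
  apply: (@sub_finite_set _ _ (eball x (euclidean_norm (x - eta0) + 1) `&` Xi)).
    move=> eta [[Xeta _] /= h]; split=> //; rewrite /eball /= (euclidean_distC eta).
    by apply: le_lt_trans h _; rewrite ltrDl.
  by apply: dXi; exact: bounded_eball.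
have [|y [[Xy xy] /= yeta0] ymin] := finite_argmin (fun eta => euclidean_norm (x - eta)) finF'.
  by exists eta0; split=> //=.
have {}ymin eta : Xi eta -> ((euclidean_norm (x - eta))%:E <= r eta)%E ->
    euclidean_norm (x - y) <= euclidean_norm (x - eta).
  move=> Xeta xeta; have [h|h] := leP (euclidean_norm (x - eta)) (euclidean_norm (x - eta0)).
    by apply: ymin.
  exact: le_trans yeta0 (ltW h).
move: xy; rewrite le_eqVlt => /orP[/eqP xy|xy]; first by left; exists y.
right.
have [eta Xeta [ey h1 h2]] : excluded Xi r y x.
  apply: contrapT => nex.
  have : gale_shapley Xi alpha x = Center y by apply/radial_CenterP.
  by rewrite xD.
exists y => //; exists eta => //; split; first by move=> e; case: ey.
by apply: le_anti; rewrite h1 (ymin _ Xeta h2).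
Qed.

End discrete.
End gale_shapley.

Section isometry_equivariance.
Context (R : realType) (n : nat).
Local Notation E := 'rV[R]_n.+1.
Context (T : E -> E) (hT : Defs.isometry T) (Xi Xi' : set E).
Context (dXi' : discrete_centers Xi').
Context (XiT : forall z, Xi' (T z) <-> Xi z).
Implicit Types (x y z : E) (r : E -> \bar R).

Lemma excluded_isometry r r' y x : (forall z, r' (T z) = r z) ->
  excluded Xi' r' (T y) (T x) <-> excluded Xi r y x.
Proof.
move=> rr'; split=> [[eta']|[eta Xeta [h1 h2 h3]]].
  have [eta <-] := isometry_surj hT eta'.
  move=> /XiT Xeta [h1 h2 h3]; exists eta => //; split.
  - by move=> e; apply: h1; rewrite e.
  - by rewrite -(hT x eta) -(hT x y).
  - by rewrite -(hT x eta) -rr'.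
exists (T eta); first exact/XiT; split.
- by move=> /(isometry_inj hT).
- by rewrite !hT.
- by rewrite hT rr'.
Qed.

(** The only place where the invariance of volume under rotations and reflections enters. *)
Lemma step_isometry alpha r r' y : (forall z, r' (T z) = r z) ->
  step Xi' alpha r' (T y) = step Xi alpha r y.
Proof.
move=> rr'; rewrite /step; congr ereal_sup; congr image.
apply/funext => q /=; congr (_ <= _)%E.
rewrite -(vol_isometry hT); last exact: measurable_reach.
congr (vol R n.+1 _); apply/seteqP; split=> x [/= xq nx]; split; rewrite ?hT // in xq *;
  by move=> /(excluded_isometry _ _ rr').
Qed.

Lemma radii_isometry alpha k y : radii Xi' alpha k (T y) = radii Xi alpha k y.
Proof. by elim: k y => // k IH y; exact: step_isometry. Qed.

Lemma radius_isometry alpha y : acceptance_radius Xi' alpha (T y) = acceptance_radius Xi alpha y.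
Proof.
by congr ereal_inf; apply: eq_imagel => k _; exact: radii_isometry.
Qed.

Lemma gale_shapley_isometry alpha x : 0 < alpha ->
  gale_shapley Xi' alpha (T x) = map_allotment T (gale_shapley Xi alpha x).
Proof.
move=> alpha0.
have r0 (Z : set E) y : Z y -> (0 <= acceptance_radius Z alpha y)%E by move=> _; exact: radius_ge0.
have dE y : catchment Xi' (acceptance_radius Xi' alpha) (T y) (T x) <-> catchment Xi (acceptance_radius Xi alpha) y x.
  rewrite /catchment /= hT radius_isometry.
  by have := @excluded_isometry _ _ y x (radius_isometry alpha); tauto.
have CE y : gale_shapley Xi' alpha (T x) = Center (T y) <-> gale_shapley Xi alpha x = Center y.
  split=> /radial_CenterP[h1 h2]; apply/radial_CenterP.
    by split; [exact/XiT|exact/dE].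
  by split; [exact/XiT|exact/dE].
have UE : gale_shapley Xi' alpha (T x) = Unclaimed <-> gale_shapley Xi alpha x = Unclaimed.
  split=> /(radial_UnclaimedP _ (r0 _)) h; apply/(radial_UnclaimedP _ (r0 _)) => y Xy.
    by have := h (T y); rewrite hT radius_isometry; apply; exact/XiT.
  have [z zy] := isometry_surj hT y; rewrite -zy hT radius_isometry.
  by apply: h; apply/XiT; rewrite zy.
case g : (gale_shapley Xi alpha x) => [y||] /=; [exact/CE|exact/UE|].
case g' : (gale_shapley Xi' alpha (T x)) => [y'||] //.
  have [y yy'] := isometry_surj hT y'; rewrite -yy' in g'.
  by move/CE : g'; rewrite g.
by move/UE : g'; rewrite g.
Qed.

End isometry_equivariance.

(** * Joint measurability in the point measure and the site *)

Section joint_measurability.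
Context (R : realType) (n : nat) (alpha : R).
Local Notation E := 'rV[R]_n.+1.
Local Notation X := (point_measure R n.+1).

Lemma measurable_excluded_joint (r : X * E -> \bar R) :
  measurable_fun [set: X * E] r ->
  measurable [set q : X * E * E |
    excluded (centers q.1.1) (fun z => r (q.1.1, z)) q.1.2 q.2].
Proof.
move=> mr; pose D : set (X * E * E * E) := [set p | [/\ p.2 <> p.1.1.2,
  euclidean_norm (p.1.2 - p.2) <= euclidean_norm (p.1.2 - p.1.1.2) &
  ((euclidean_norm (p.1.2 - p.2))%:E <= r (p.1.1.1, p.2))%E]].
have m0 : measurable_fun [set: X * E * E * E] (fun p => p.1.1.1).
  exact: measurableT_comp measurable_fst (measurableT_comp measurable_fst measurable_fst).
have m1 : measurable_fun [set: X * E * E * E] (fun p => p.1.1.2).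
  exact: measurableT_comp measurable_snd (measurableT_comp measurable_fst measurable_fst).
have m2 : measurable_fun [set: X * E * E * E] (fun p => p.1.2).
  exact: measurableT_comp measurable_snd measurable_fst.
have m3 : measurable_fun [set: X * E * E * E] (fun p => p.2) by exact: measurable_snd.
have mD : measurable D.
  rewrite (_ : D = ~` ((fun p => (p.2, p.1.1.2)) @^-1` [set p : E * E | p.1 = p.2]) `&`
    [set p | euclidean_norm (p.1.2 - p.2) <= euclidean_norm (p.1.2 - p.1.1.2)] `&`
    [set p | ((euclidean_norm (p.1.2 - p.2))%:E <= r (p.1.1.1, p.2))%E]); last first.
    by apply/seteqP; split => p; [case|case=> -[]].
  apply: measurableI; first apply: measurableI.
  - apply: measurableC; apply: measurable_preimage (@measurable_rV_eq R n.+1).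
    exact: measurable_fun_pair.
  - by apply: measurable_le_set; exact: measurable_euclidean_dist.
  - rewrite -[X in measurable X]setTI; apply: measurable_lee => //.
      by apply/measurable_EFinP; exact: measurable_euclidean_dist.
    by apply: (measurableT_comp mr); exact: measurable_fun_pair.
have mu : measurable_fun [set: X * E * E] (fun q => q.1.1).
  exact: measurableT_comp measurable_fst measurable_fst.
have h := measurable_exists_center mu mD.
rewrite (_ : mkset _ = [set q | exists2 z, centers q.1.1 z & D (q, z)]) //.
Qed.

Lemma measurable_step_joint (r : X * E -> \bar R) :
  measurable_fun [set: X * E] r ->
  measurable_fun [set: X * E]
    (fun p => step (centers p.1) alpha (fun z => r (p.1, z)) p.2).
Proof.
move=> mr; apply: (measurability _ (ErealGenOInfty.measurableE R)) => _ [_ [c ->] <-].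
rewrite setTI.
pose D q : set (X * E * E) := [set p | euclidean_norm (p.2 - p.1.2) < ratr q] `&`
  ~` [set p : X * E * E | excluded (centers p.1.1) (fun z => r (p.1.1, z)) p.1.2 p.2].
have mD q : measurable (D q).
  apply: measurableI; last by apply: measurableC; exact: measurable_excluded_joint.
  apply: measurable_lt_set => //; apply: measurable_euclidean_dist.
    exact: measurable_snd.
  exact: measurableT_comp measurable_snd measurable_fst.
have DE q p : xsection (D q) p = reach (centers p.1) (fun z => r (p.1, z)) p.2 (ratr q).
  by apply/seteqP; split => z; rewrite /xsection /= inE.
rewrite (_ : _ @^-1` _ = \bigcup_(q : rat) (if `[< (c < ratr q) >] then
    [set p | (vol R n.+1 (xsection (D q) p) <= alpha%:E)%E] else set0)).
  apply: bigcupT_measurable_rat => q; case: ifP => // _.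
  rewrite -[X in measurable X]setTI; apply: measurable_lee => //.
  exact: measurable_fun_xsection.
apply/seteqP; split => [p /=|p [q _]].
  rewrite in_itv /= andbT => /ereal_sup_gt[_ [q /= hq <-]]; rewrite lte_fin => cq.
  by exists q => //; rewrite asboolT //= DE.
case: asboolP => // cq /=; rewrite DE in_itv /= andbT => hq.
apply: (@lt_le_trans _ _ (ratr q)%:E); first by rewrite lte_fin.
by apply: ereal_sup_ubound; exists q.
Qed.

Lemma measurable_radii_joint k : measurable_fun [set: X * E]
  (fun p => radii (centers p.1) alpha k p.2).
Proof.
elim: k => [|k IH]; first exact: measurable_cst.
exact: measurable_step_joint IH.
Qed.

Lemma measurable_radius_joint : measurable_fun [set: X * E]
  (fun p => acceptance_radius (centers p.1) alpha p.2).
Proof.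
apply: (eq_measurable_fun (fun p => einfs (fun k => radii (centers p.1) alpha k p.2) 0)).
  move=> p _; rewrite /einfs /sdrop; congr ereal_inf.
  by apply/seteqP; split => _ [k _ <-]; exists k.
by apply: measurable_fun_einfs => k; exact: measurable_radii_joint.
Qed.

Lemma measurable_radius_center : measurable_fun [set: X * E * E]
  (fun q => acceptance_radius (centers q.1.1) alpha q.2).
Proof.
have m1 : measurable_fun [set: X * E * E] (fun q => (q.1.1, q.2)).
  apply: measurable_fun_pair; last exact: measurable_snd.
  exact: measurableT_comp measurable_fst measurable_fst.
exact: measurableT_comp measurable_radius_joint m1.
Qed.

Lemma measurable_catchment_joint : measurable [set p : X * E * E |
  catchment (centers p.1.1) (acceptance_radius (centers p.1.1) alpha) p.2 p.1.2].
Proof.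
rewrite (_ : mkset _ =
  [set p : X * E * E | ((euclidean_norm (p.1.2 - p.2))%:E < acceptance_radius (centers p.1.1) alpha p.2)%E] `&`
  ~` ((fun p => (p.1.1, p.2, p.1.2)) @^-1` [set q : X * E * E |
    excluded (centers q.1.1) (acceptance_radius (centers q.1.1) alpha) q.1.2 q.2])) //.
have m1 : measurable_fun [set: X * E * E] (fun p => p.1.1).
  exact: measurableT_comp measurable_fst measurable_fst.
have m2 : measurable_fun [set: X * E * E] (fun p => p.1.2).
  exact: measurableT_comp measurable_snd measurable_fst.
have m3 : measurable_fun [set: X * E * E] (fun p => p.2) by exact: measurable_snd.
apply: measurableI.
  rewrite -[X in measurable X]setTI; apply: measurable_lte => //.
    by apply/measurable_EFinP; exact: measurable_euclidean_dist.
  exact: measurable_radius_center.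
apply: measurableC; apply: measurable_preimage.
  by apply: measurable_fun_pair => //; exact: measurable_fun_pair.
exact: measurable_excluded_joint measurable_radius_joint.
Qed.

Context (alpha0 : 0 < alpha).

Lemma measurable_gale_shapley_joint : measurable_fun [set: X * E]
  (fun p => gale_shapley (centers p.1) alpha p.2).
Proof.
move=> _ Y mY; rewrite setTI.
pose C := [set p : X * E | exists2 y, centers p.1 y &
  ([set q : X * E * E | catchment (centers q.1.1) (acceptance_radius (centers q.1.1) alpha) q.2 q.1.2] `&`
   (fun q => q.2) @^-1` (@Center R n.+1 @^-1` Y)) (p, y)].
pose U := [set p : X * E | exists2 y, centers p.1 y & [set q : X * E * E |
  ((euclidean_norm (q.1.2 - q.2))%:E <= acceptance_radius (centers q.1.1) alpha q.2)%E] (p, y)].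
have mC : measurable C.
  apply: measurable_exists_center; first exact: measurable_fst.
  apply: measurableI; first exact: measurable_catchment_joint.
  by apply: measurable_preimage; [exact: measurable_snd|exact: mY].
have m1 : measurable_fun [set: X * E * E] (fun p => p.1.1).
  exact: measurableT_comp measurable_fst measurable_fst.
have m2 : measurable_fun [set: X * E * E] (fun p => p.1.2).
  exact: measurableT_comp measurable_snd measurable_fst.
have m3 : measurable_fun [set: X * E * E] (fun p => p.2) by exact: measurable_snd.
have mU : measurable U.
  apply: measurable_exists_center; first exact: measurable_fst.
  rewrite -[X in measurable X]setTI; apply: measurable_lee => //.
    by apply/measurable_EFinP; exact: measurable_euclidean_dist.
  exact: measurable_radius_center.
pose A := [set p : X * E | exists2 y, centers p.1 y &
  [set q : X * E * E | catchment (centers q.1.1) (acceptance_radius (centers q.1.1) alpha) q.2 q.1.2] (p, y)].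
have mA : measurable A.
  by apply: measurable_exists_center measurable_catchment_joint; exact: measurable_fst.
have r0 (Z : set E) y : Z y -> (0 <= acceptance_radius Z alpha y)%E by move=> _; exact: radius_ge0.
have UP p : ~ U p <-> gale_shapley (centers p.1) alpha p.2 = Unclaimed.
  rewrite (radial_UnclaimedP _ (r0 _)); split=> [nU y cy|h [y cy /=]].
    by rewrite ltNge; apply/negP => hy; apply: nU; exists y.
  by rewrite leNgt h.
have AP p : A p <-> exists y, gale_shapley (centers p.1) alpha p.2 = Center y.
  by split=> [[y cy dy]|[y /radial_CenterP[cy dy]]]; exists y => //; apply/radial_CenterP.
rewrite (_ : _ @^-1` Y = C `|` (~` U `&` (if `[< Y Unclaimed >] then setT else set0)) `|`
    (U `&` ~` A `&` (if `[< Y Delta >] then setT else set0))).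
  apply: measurableU; first apply: measurableU => //.
    by apply: measurableI; [exact: measurableC|case: ifP].
  apply: measurableI; last by case: ifP.
  by apply: measurableI => //; exact: measurableC.
apply/seteqP; split => p /=.
  case g : (gale_shapley (centers p.1) alpha p.2) => [y||] Yv.
  - by left; left; move/radial_CenterP : g => [cy dy]; exists y.
  - by left; right; split; [exact/UP|rewrite asboolT].
  - right; rewrite asboolT //; split=> //; split.
      by apply: contrapT => /UP; rewrite g.
    by move=> /AP[y]; rewrite g.
case=> [[[y cy [dy Yy]]|[/UP -> ]]|[[Up nAp]]].
- have -> : gale_shapley (centers p.1) alpha p.2 = Center y by apply/radial_CenterP.
  exact: Yy.
- by case: asboolP.
- case: asboolP => // YD _; case g : (gale_shapley _ _ _) => [y||] //.
    by exfalso; apply: nAp; apply/AP; exists y.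
  by move/UP : g => /(_ Up).
Qed.

End joint_measurability.

Section gale_shapley_factor.
Context (R : realType) (n : nat) (alpha : R) (alpha0 : 0 < alpha).
Local Notation E := 'rV[R]_n.+1.

(** If a cube of mass m contained infinitely many centers, m + 1 of them would already outweigh
    it. *)
Lemma discrete_point_measure (pi : point_measure R n.+1) : discrete_centers (centers pi).
Proof.
move=> B /bounded_cube[k k0 Bk].
apply: (@sub_finite_set _ _ (cube k `&` centers pi)); first by move=> x [/Bk].
apply: contrapT => /infiniteP/pcard_leP[f].
have bk : bounded_set (@cube R n.+1 k).
  exists k; split; first exact: num_real.
  by move=> M kM x xk; apply: le_trans (ltW kM); apply/norm_le_coordP => [|i];
    [exact: ltW|rewrite ler_norml; exact: xk].
have [m hm] := point_measure_nat pi (@measurable_cube R n.+1 k) bk.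
have m1 (x : E) : measurable [set x].
  rewrite (_ : [set x] = (pair x) @^-1` [set p | p.1 = p.2]); last by apply/seteqP; split.
  by apply: measurable_preimage (@measurable_rV_eq R n.+1); exact: pair1_measurable.
have fc i : (cube k `&` centers pi) (f i) by exact: funS.
have tf : trivIset setT (fun i => [set f i]).
  apply/trivIsetP => i j _ _ ij; rewrite -subset0 => x [/= -> fij].
  by move/eqP : ij; apply; apply: (inj : {in setT &, injective f}); rewrite ?inE.
have mUf : measurable (\bigcup_i [set f i]) by apply: bigcupT_measurable => i; exact: m1.
have hsum := measure_semi_bigcup pi (fun i => m1 (f i)) tf mUf.
have : (pi (\bigcup_i [set f i]) <= pi (cube k))%E.
  apply: le_measure; rewrite ?inE.
  - exact: mUf.
  - exact: measurable_cube.
  - by move=> x [i _ ->]; have [] := fc i.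
rewrite hm hsum; apply/negP; rewrite -ltNge.
apply: (@lt_le_trans _ _ (\sum_(0 <= i < m.+1) pi [set f i])%E).
  rewrite (eq_bigr (fun=> 1%:E)); last by move=> i _; have [_ ->] := fc i.
  by rewrite sumEFin sumr_const_nat subn0 lte_fin ltr_nat.
exact: nneseries_lim_ge.
Qed.

Definition gale_shapley_factor (pi : point_measure R n.+1) : E -> allotment R n.+1 :=
  gale_shapley (centers pi) alpha.

Lemma centers_image (T : E -> E) (hT : Defs.isometry T) (pi : point_measure R n.+1) z :
  centers (image_point_measure hT pi) (T z) <-> centers pi z.
Proof.
rewrite /centers /= /pushforward (_ : T @^-1` [set T z] = [set z]) //.
by apply/seteqP; split => [x /= /(isometry_inj hT)|x ->].
Qed.

Lemma isometry_equivariant_gale_shapley :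
  isometry_equivariant [set: point_measure R n.+1] gale_shapley_factor.
Proof.
move=> T hT pi; split=> // _ x; apply: gale_shapley_isometry => //.
  exact: discrete_point_measure.
exact: centers_image.
Qed.

Lemma measurable_gale_shapley (pi : point_measure R n.+1) :
  measurable_fun [set: E] (gale_shapley_factor pi).
Proof.
exact: measurableT_comp (measurable_gale_shapley_joint alpha0) (pair1_measurable pi).
Qed.

Lemma allocation_gale_shapley (pi : point_measure R n.+1) :
  allocation (centers pi) alpha (gale_shapley_factor pi).
Proof.
have dpi := discrete_point_measure pi; split => //.
- exact: measurable_gale_shapley.
- by move=> x xi /radial_CenterP[].
- have mD : measurable (gale_shapley_factor pi @^-1` [set Delta]).
    apply: measurable_preimage; first exact: measurable_gale_shapley.
    rewrite /measurable /= /allotment_measurable /= (_ : _ @^-1` _ = set0) //.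
    by rewrite -subset0 => c.
  rewrite volumeE //; apply/negligibleP => //.
  exact: Delta_gale_shapley.
- move=> xi cxi; rewrite territory_gale_shapley // volumeE; last exact: measurable_catchment.
  exact: vol_catchment_le.
Qed.

Lemma stable_factor_gale_shapley (dOmega : measure_display)
    (Omega : measurableType dOmega) (Pr : probability Omega R)
    (Pi : {RV Pr >-> point_measure R n.+1}) :
  stable_factor_allocation Pi alpha [set: point_measure R n.+1] gale_shapley_factor.
Proof.
split; last first.
  by apply: aeW => w; apply: stable_gale_shapley => //; exact: discrete_point_measure.
split=> //.
- exact: aeW.
- by rewrite setXTT; exact: measurable_gale_shapley_joint.
- by move=> pi _; exact: allocation_gale_shapley.
- by move=> t; exact: isometry_equivariant_gale_shapley.
Qed.

End gale_shapley_factor.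

(** * Components of quadratic systems *)

Section finite_unions.
Context (X : topologicalType).
Implicit Types A B U : set X.

Lemma finite_union_of_open_connected0 :
  finite_union_of_open_connected (set0 : set X).
Proof. by exists set0; split=> //; rewrite bigcup_set0. Qed.

Lemma finite_union_of_open_connectedU A B : finite_union_of_open_connected A ->
  finite_union_of_open_connected B -> finite_union_of_open_connected (A `|` B).
Proof.
move=> [F [fF hF ->]] [G [fG hG ->]]; exists (F `|` G); split.
- by rewrite finite_setU.
- by move=> U [/hF|/hG].
- by rewrite bigcup_setU.
Qed.

End finite_unions.

Section paths.
Context (R : realType) (d : nat).
Implicit Types (x y p u v w : 'rV[R]_d) (U : set 'rV[R]_d).

Lemma connected_component_path (f : R -> 'rV[R]_d) U :
  {in `[0, 1]%classic, continuous f} -> (forall t, 0 <= t <= 1 -> U (f t)) ->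
  connected_component U (f 0) (f 1).
Proof.
move=> cf Uf.
have h t : 0 <= t <= 1 -> (f @` `[0, 1]%classic) (f t).
  by move=> t01; exists t => //=; rewrite in_itv.
have /connected_component_max : (f @` `[0, 1]%classic) (f 0).
  by apply: h; rewrite lexx ler01.
apply; last by apply: h; rewrite lexx ler01.
- by move=> _ [t + <-]; rewrite /= in_itv /=; exact: Uf.
- apply: connected_continuous_connected; first exact: segment_connected.
  exact: continuous_in_subspaceT.
Qed.

Lemma continuous_segment u w : continuous (fun t : R => u + t *: w).
Proof.
move=> t; apply: cvgD; first exact: cvg_cst.
by apply: cvgZ; [exact: cvg_id|exact: cvg_cst].
Qed.

Lemma open_connected_component U x : open U -> open (connected_component U x).
Proof.
move=> oU; rewrite openE => y xy.
have Uy := connected_component_sub xy.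
have /nbhs_ballP[e e0 he] : nbhs y U by exact: open_nbhs_nbhs.
apply/nbhs_ballP; exists e => // z /=; rewrite -ball_normE /= => yz.
apply: connected_component_trans xy _.
have -> : z = y + 1 *: (z - y) by rewrite scale1r addrC subrK.
have {1}-> : y = y + 0 *: (z - y) by rewrite scale0r addr0.
apply: (@connected_component_path (fun t => y + t *: (z - y))).
  by move=> t _; exact: continuous_segment.
move=> t /andP[t0 t1]; apply: he; rewrite -ball_normE /= opprD addNKr.
rewrite normrN normrZ ger0_norm // distrC; apply: le_lt_trans yz.
by rewrite ler_piMl.
Qed.

Lemma continuous_sqr_norm : continuous (fun x => dotp x x).
Proof.
move=> x; apply: (@cvg_big _ _ _ _ _ _ _ (nbhs x)) => [|i _]; first exact: add_continuous.
by apply: cvgM; exact: coord_continuous.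
Qed.

End paths.

Lemma bounded_subset (R : realType) (V : pseudoMetricNormedZmodType R) (A B : set V) :
  A `<=` B -> bounded_set B -> bounded_set A.
Proof. by move=> AB [M [Mr hB]]; exists M; split=> // N /hB hN x /AB; exact: hN. Qed.

Section quadratic_systems.
Context (R : realType) (d : nat).
Local Notation E := 'rV[R]_d.
Implicit Types (x y p u v w : E) (q : R * E * R) (qs : seq (R * E * R)).

Definition quad q x : R := q.1.1 * dotp x x + dotp q.1.2 x + q.2.

Definition system qs : set E := [set x | forall q, q \in qs -> 0 < quad q x].

Lemma continuous_quad q : continuous (quad q).
Proof.
move=> x; apply: (@cvgD _ _ _ (nbhs x)); last exact: cvg_cst.
apply: (@cvgD _ _ _ (nbhs x)); last exact: continuous_dotp.
by apply: (@cvgM _ _ (nbhs x)); [exact: cvg_cst|exact: continuous_sqr_norm].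
Qed.

Lemma near_quad q p : quad q p != 0 ->
  \forall x \near p, (0 < quad q x) = (0 < quad q p).
Proof.
move=> qp0; have cq : quad q x @[x --> p] --> quad q p := @continuous_quad q p.
have [qp|qp] := ltP 0 (quad q p).
  by near=> x; apply/idP; near: x; exact: (cvgr_gt (quad q p)).
have {}qp : quad q p < 0 by rewrite lt_neqAle qp0.
near=> x; apply/negbTE; rewrite -leNgt ltW //; near: x.
exact: (cvgr_lt (quad q p)).
Unshelve. all: end_near. Qed.

Lemma near_eball p (P : set E) : (\forall x \near p, P x) ->
  exists2 e : R, 0 < e & eball p e `<=` P.
Proof.
move=> /nbhs_ballP[e e0 he]; exists e => // x px; apply: he.
rewrite -ball_normE /= distrC; exact: le_lt_trans (norm_le_euclidean_norm _) px.
Qed.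

Lemma eball_center p (e : R) : 0 < e -> eball p e p.
Proof. by move=> e0; rewrite /eball /= subrr euclidean_norm0. Qed.

Lemma near_system qs p : exists2 e : R, 0 < e & forall x q,
  eball p e x -> q \in qs -> quad q p != 0 -> (0 < quad q x) = (0 < quad q p).
Proof.
elim: qs => [|q qs [e e0 IH]]; first by exists 1.
have [e' e'0 he'] : exists2 e' : R, 0 < e' & forall x, eball p e' x ->
    quad q p != 0 -> (0 < quad q x) = (0 < quad q p).
  have [->|qp0] := eqVneq (quad q p) 0; first by exists 1 => // x _; rewrite ?eqxx.
  by have [e' e'0 h] := near_eball (near_quad qp0); exists e' => // x /h.
exists (Num.min e e'); first by rewrite lt_min e0.
move=> x q'; rewrite /eball /= lt_min => /andP[xe xe'].
by rewrite inE => /orP[/eqP->|]; [exact: he'|exact: IH].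
Qed.

Lemma open_system qs : open (system qs).
Proof.
rewrite openE => p pq; have [e e0 he] := near_system qs p.
have : nbhs p (eball p e) by apply: open_nbhs_nbhs; split;
  [exact: open_eball|exact: eball_center].
rewrite /interior; apply: filterS => x xe q qqs.
by rewrite (he x q xe qqs) ?pq // gt_eqF // pq.
Qed.

(** Parametrized by the vector [v], whose large values give points close to [p]. *)
Definition inversion p v : E := p + (dotp v v)^-1 *: v.

Lemma inversionK p x : x != p ->
  inversion p ((dotp (x - p) (x - p))^-1 *: (x - p)) = x.
Proof.
rewrite -subr_eq0 => /dotpp_gt0; set u := x - p => u0.
rewrite /inversion dotpZl dotpZr scalerA -invfM.
rewrite mulVf ?gt_eqF // mulr1 mulVf ?gt_eqF //.
by rewrite invr1 scale1r addrC subrK.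
Qed.

(** Expanded at [p], the polynomial has no constant term. After substituting v / |v|^2 and
    multiplying by |v|^2, its linear part stays linear and its quadratic part becomes constant. *)
Lemma quad_inversion q p v : quad q p = 0 -> v != 0 ->
  (0 < quad q (inversion p v)) =
  (0 < dotp ((2 * q.1.1) *: p + q.1.2) v + q.1.1).
Proof.
move=> qp0 /dotpp_gt0 v0.
have -> : quad q (inversion p v) =
    (dotp ((2 * q.1.1) *: p + q.1.2) v + q.1.1) / dotp v v.
  move: qp0; rewrite /quad /inversion => qp0.
  rewrite -[RHS]add0r -qp0 !dotpDr !dotpDl !dotpZr !dotpZl (dotpC v p).
  by field; rewrite gt_eqF.
by rewrite pmulr_lgt0 // invr_gt0.
Qed.

Lemma dotp_segment v v' (t : R) :
  dotp (v + t *: (v' - v)) (v + t *: (v' - v)) =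
  (1 - t) ^+ 2 * dotp v v + 2 * t * (1 - t) * dotp v v' + t ^+ 2 * dotp v' v'.
Proof. by rewrite !dotpDl !dotpDr !dotpZl !dotpZr !dotpBl !dotpBr (dotpC v' v); ring. Qed.

(* Inverting at [p] turns the constraints that vanish at [p] into affine ones,
   hence segments into admissible paths; the orthant condition keeps the segment
   away from the origin, hence the path close to [p]. *)
Lemma system_connect qs p (e : R) x x' : 0 < e ->
  (forall z q, eball p e z -> q \in qs -> quad q p != 0 ->
    (0 < quad q z) = (0 < quad q p)) ->
  system qs x -> system qs x' -> eball p (e / 2) x -> eball p (e / 2) x' ->
  x != p -> x' != p -> 0 <= dotp (x - p) (x' - p) ->
  connected_component (system qs) x x'.
Proof.
move=> e0 he Ux Ux' xe xe' xp xp' xx'.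
pose inv z := (dotp (z - p) (z - p))^-1 *: (z - p).
have inv_gt z : eball p (e / 2) z -> z != p -> 4 / e ^+ 2 < dotp (inv z) (inv z).
  rewrite -subr_eq0 => ze /dotpp_gt0 z0; rewrite /inv dotpZl dotpZr mulVf ?gt_eqF // mulr1.
  rewrite -[ltLHS]invrK ltf_pV2 ?posrE ?invr_gt0 ?divr_gt0 ?exprn_gt0 //.
  rewrite invf_div -sqr_euclidean_norm.
  rewrite (_ : _ / 4 = (e / 2) ^+ 2); last by field.
  by rewrite ltr_pXn2r ?nnegrE ?euclidean_norm_ge0 // divr_ge0 // ltW.
set v := inv x; set v' := inv x'.
have vv' : 0 <= dotp v v'.
  by rewrite /v /v' /inv dotpZl dotpZr !mulr_ge0 // invr_ge0 dotpp_ge0.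
pose w t := v + t *: (v' - v).
have e2 : 0 < e ^+ 2 by rewrite exprn_gt0.
(* On the segment |w t|^2 >= (4 / e^2) ((1 - t)^2 + t^2) >= 2 / e^2; this is why the endpoints are
   taken in the ball of radius e / 2. *)
have w_gt t : 0 <= t <= 1 -> (e ^+ 2)^-1 < dotp (w t) (w t).
  move=> /andP[t0 t1]; rewrite /w dotp_segment.
  have := inv_gt x xe xp; have := inv_gt x' xe' xp'; rewrite -/v -/v'.
  have : 0 < (e ^+ 2)^-1 by rewrite invr_gt0.
  set k := _^-1 => k0 hB hA.
  have hC : 0 <= 2 * t * (1 - t) * dotp v v' by rewrite !mulr_ge0 // subr_ge0.
  have hA' : (1 - t) ^+ 2 * (4 * k) <= (1 - t) ^+ 2 * dotp v v.
    by rewrite ler_wpM2l ?sqr_ge0 // ltW.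
  have hB' : t ^+ 2 * (4 * k) <= t ^+ 2 * dotp v' v'.
    by rewrite ler_wpM2l ?sqr_ge0 // ltW.
  have : 0 <= (1 - 2 * t) ^+ 2 * k by rewrite mulr_ge0 ?sqr_ge0 // ltW.
  nra.
have w0 t : 0 <= t <= 1 -> w t != 0.
  move=> /w_gt; apply: contraTneq => ->; rewrite dot0p -leNgt invr_ge0 ltW //.
have f0 : x = inversion p (w 0) by rewrite /w scale0r addr0 inversionK.
have f1 : x' = inversion p (w 1) by rewrite /w scale1r addrC subrK inversionK.
rewrite [X in connected_component _ X]f0 [X in connected_component _ _ X]f1.
apply: (@connected_component_path _ _ (fun t => inversion p (w t))).
  move=> t; rewrite inE /= in_itv /= => t01.
  have cw := @continuous_segment _ _ v (v' - v) t.
  apply: (@cvgD _ _ _ (nbhs t)); first exact: cvg_cst.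
  apply: (@cvgZ _ _ _ (nbhs t)); last exact: cw.
  apply: (@cvgV _ _ (nbhs t)); first by rewrite gt_eqF // dotpp_gt0 // w0.
  exact: cvg_comp cw (@continuous_sqr_norm R d (w t)).
move=> t t01 q qqs; have [qp|qp] := eqVneq (quad q p) 0; last first.
  have near_p z : eball p (e / 2) z -> eball p e z.
    by rewrite /eball /= => /lt_trans; apply; rewrite ltr_pdivrMr // ltr_pMr // ltr1n.
  rewrite he // -?(he x) //; first exact: Ux; first exact: near_p.
  rewrite /eball /= -(@ltr_pXn2r _ 2) ?nnegrE ?euclidean_norm_ge0 ?(ltW e0) //.
  rewrite sqr_euclidean_norm /inversion addrC addKr dotpZl dotpZr.
  rewrite mulVf ?gt_eqF ?dotpp_gt0 ?w0 // mulr1.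
  by rewrite -[ltRHS]invrK ltf_pV2 ?posrE ?invr_gt0 ?dotpp_gt0 ?w0 ?w_gt.
have v0 : v != 0 by have := w0 0; rewrite /w scale0r addr0; apply; rewrite lexx ler01.
have v'0 : v' != 0.
  by have := w0 1; rewrite /w scale1r addrC subrK; apply; rewrite lexx ler01.
have := Ux q qqs; have := Ux' q qqs.
rewrite -[X in quad q X](inversionK xp') -[X in _ -> 0 < quad q X -> _](inversionK xp).
rewrite !quad_inversion // ?w0 // -/(inv x) -/(inv x') -/v -/v'.
set l := _ *: p + q.1.2.
have -> : dotp l (w t) = dotp l v + t * (dotp l v' - dotp l v).
  by rewrite -dotpBr -dotpZr -dotpDr.
move: (dotp l v) (dotp l v') q.1.1 => a b c hb ha.
case/andP: t01 => t0 t1.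
have : 0 <= t * (b + c) by rewrite mulr_ge0 // ltW.
have : 0 <= (1 - t) * (a + c) by rewrite mulr_ge0 ?subr_ge0 // ltW.
have [->|tn1] := eqVneq t 1; first by lra.
have : 0 < (1 - t) * (a + c) by rewrite mulr_gt0 // subr_gt0 lt_neqAle tn1.
lra.
Qed.

Lemma dotp_sign x x' :
  [ffun i => 0 <= x 0 i] = [ffun i => 0 <= x' 0 i] -> 0 <= dotp x x'.
Proof.
move=> /ffunP sxx'; apply: sumr_ge0 => i _; have := sxx' i; rewrite !ffunE.
have [x0 /esym x'0|x0 /esym/negbT] := leP 0 (x 0 i); first by rewrite mulr_ge0.
by rewrite -ltNge => x'0; rewrite mulr_le0 // ltW.
Qed.

(** One representative for each sign pattern of x - p, together with [p] itself: vectors with equal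
    sign patterns have a nonnegative dot product, as [system_connect] requires. *)
Lemma system_local_components qs p : exists e : R, exists S : set E,
  [/\ 0 < e, finite_set S & forall x, system qs x -> eball p e x ->
    exists2 s, S s & connected_component (system qs) s x].
Proof.
have [e e0 he] := near_system qs p.
pose sgn x := [ffun i : 'I_d => 0 <= (x - p) 0 i].
pose near_in x := [/\ system qs x, eball p (e / 2) x & x != p].
pose rep s := xget p [set x | near_in x /\ sgn x = s].
exists (e / 2), (p |` range rep); split; first exact: divr_gt0.
  rewrite finite_setU; split; first exact: finite_set1.
  exact: finite_image.
move=> x Ux xe; have [xp|xp] := eqVneq x p.
  by exists p; [left|rewrite -xp; exact: connected_component_refl].
exists (rep (sgn x)); first by right; exists (sgn x).
have [[Ur re rp] sr] : [set y | near_in y /\ sgn y = sgn x] (rep (sgn x)).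
  by apply: (xgetPex p); exists x; split.
exact: (system_connect e0 he Ur Ux re xe rp xp (dotp_sign sr)).
Qed.

(** The local bound is applied at all points of a cube around the system, including boundary points
    outside the system, so components cannot accumulate there. *)
Lemma bounded_system_finite_union qs : bounded_set (system qs) ->
  finite_union_of_open_connected (system qs).
Proof.
move=> bU; have [k k0 Uk] := bounded_cube bU.
have cK : compact (cube k : set E).
  have := @rV_compact R d _ (fun=> @segment_compact R (- k) k).
  by congr compact; apply/seteqP; split => x /= h i; have := h i; rewrite in_itv.
have [e /choice[S hS]] := choice (system_local_components qs).
move: cK; rewrite compact_cover => /(_ _ setT (fun p => eball p (e p))).
case=> [p _|x _|D _ KD]; first exact: open_eball.
  by exists x => //; apply: eball_center; have [] := hS x.
exists [set connected_component (system qs) s | s in \bigcup_(p in [set` D]) S p]; split.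
- apply: finite_image; apply: bigcup_finite => // p _; by have [] := hS p.
- move=> _ [s _ <-]; split; last exact: component_connected.
  by apply: open_connected_component; exact: open_system.
- apply/seteqP; split => [x Ux|x [_ [s _ <-]]]; last exact: connected_component_sub.
  have [p pD xp] := KD x (Uk x Ux); have [_ _ /(_ x Ux xp)[s ps sx]] := hS p.
  by exists (connected_component (system qs) s) => //; exists s => //; exists p.
Qed.

End quadratic_systems.

(** * Bounded catchments as finite unions of quadratic systems *)

Section catchments.
Context (R : realType) (n : nat).
Local Notation E := 'rV[R]_n.+1.
Implicit Types (Xi : set E) (x y eta : E) (r : E -> \bar R).

Let inner (y : E) (a : R) : R * E * R := (- 1, 2 *: y, a ^+ 2 - dotp y y).
Let outer (y : E) (a : R) : R * E * R := (1, - (2 *: y), dotp y y - a ^+ 2).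
Let closer (y z : E) : R * E * R := (0, 2 *: (y - z), dotp z z - dotp y y).

Let quad_innerE y a x : 0 <= a ->
  (0 < quad (inner y a) x) = (euclidean_norm (x - y) < a).
Proof.
move=> a0; rewrite -[RHS](@ltr_pXn2r _ 2) ?nnegrE ?euclidean_norm_ge0 //.
rewrite sqr_euclidean_norm dotpp_sum_sqr /quad /= dotpZl (dotpC y x).
by apply/idP/idP => h; lra.
Qed.

Let quad_outerE y a x : 0 <= a ->
  (0 < quad (outer y a) x) = (a < euclidean_norm (x - y)).
Proof.
move=> a0; rewrite -[RHS](@ltr_pXn2r _ 2) ?nnegrE ?euclidean_norm_ge0 //.
rewrite sqr_euclidean_norm dotpp_sum_sqr /quad /= dotpNl dotpZl (dotpC y x).
by apply/idP/idP => h; lra.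
Qed.

Let quad_closerE y z x :
  (0 < quad (closer y z) x) = (euclidean_norm (x - y) < euclidean_norm (x - z)).
Proof.
rewrite euclidean_norm_ltE !dotpp_sum_sqr /quad /= dotpZl dotpBl !(dotpC _ x).
by apply/idP/idP => h; lra.
Qed.

Let constrained r y (qs : seq (R * E * R)) (s : seq E) : set E :=
  [set x | system qs x /\ forall eta, eta \in s ->
    (r eta < (euclidean_norm (x - eta))%:E)%E \/
    euclidean_norm (x - y) < euclidean_norm (x - eta)].

(** Each center in [s] contributes a disjunction of two strict quadratic inequalities. Expanding one
    disjunction at a time splits the set into two subsets, which inherit boundedness; an infinite
    radius empties the first branch. *)
Let constrained_finite_union r y qs s : (forall eta, (0 <= r eta)%E) ->
  bounded_set (constrained r y qs s) ->
  finite_union_of_open_connected (constrained r y qs s).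
Proof.
move=> r0; elim: s qs => [|eta s IH] qs.
  rewrite (_ : constrained _ _ _ _ = system qs); first exact: bounded_system_finite_union.
  by apply/seteqP; split => [x []|x ?].
have systemE q x : system (q :: qs) x <-> 0 < quad q x /\ system qs x.
  split=> [h|[h1 h2] q']; last by rewrite inE => /orP[/eqP->|/h2].
  by split=> [|q' q's]; apply: h; rewrite inE ?eqxx // q's orbT.
have consE (P : E -> Prop) : (forall z, z \in eta :: s -> P z) <->
    P eta /\ forall z, z \in s -> P z.
  split=> [h|[h1 h2] z]; last by rewrite inE => /orP[/eqP->|/h2].
  by split=> [|z zs]; apply: h; rewrite inE ?eqxx // zs orbT.
pose far : set E := if r eta is a%:E then constrained r y (outer eta a :: qs) s else set0.
have -> : constrained r y qs (eta :: s) = far `|` constrained r y (closer y eta :: qs) s.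
  have farE x : far x <-> (r eta < (euclidean_norm (x - eta))%:E)%E /\
      constrained r y qs s x.
    rewrite /far; have := r0 eta; case: (r eta) => [a||] // a0.
    - rewrite lte_fin /constrained /= systemE quad_outerE //; tauto.
    - by split=> // -[]; rewrite ltNge leey.
  apply/seteqP; split => x.
  + move=> [Ux /consE[[h|h] hs]]; [left; exact/farE|right].
    by split=> //; apply/systemE; rewrite quad_closerE.
  + move=> [/farE[h [Ux hs]]|[/systemE[]]]; first by split=> //; apply/consE; split=> //; left.
    by rewrite quad_closerE => h Ux hs; split=> //; apply/consE; split=> //; right.
move=> b; apply: finite_union_of_open_connectedU; last first.
  by apply: IH; apply: bounded_subset b => x; right.
have {b} : bounded_set far by apply: bounded_subset b => x; left.
rewrite /far; case: (r eta) => [a||] b; first exact: IH.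
- exact: finite_union_of_open_connected0.
- exact: finite_union_of_open_connected0.
Qed.

Lemma finite_union_catchment Xi r y : discrete_centers Xi ->
  (forall eta, (0 <= r eta)%E) -> bounded_set (catchment Xi r y) ->
  finite_union_of_open_connected (catchment Xi r y).
Proof.
move=> dXi r0 bC.
have [k k0 Ck] : exists2 k, 0 < k & catchment Xi r y `<=` eball y k.
  have [M [_ hM]] := bC; pose k := Num.sqrt n.+1%:R * (`|M| + 1 + `|y|).
  have k0 : 0 <= k by rewrite mulr_ge0 ?sqrtr_ge0 ?addr_ge0.
  exists (k + 1) => [|x Cx]; first by rewrite ltr_wpDl.
  rewrite /eball /= ltr_pwDr //; apply: le_trans (euclidean_norm_le_norm _) _.
  rewrite ler_wpM2l ?sqrtr_ge0 //; apply: le_trans (ler_normB _ _) _.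
  by rewrite lerD2r; apply: (hM _ _ x Cx); rewrite (le_lt_trans (ler_norm M)) ?ltrDl.
(* A center that excludes a site within [k] of [y] is within [k] of that site, hence within 2 k of
   [y]. *)
have [s hs] : exists s : seq E,
    [set eta | Xi eta /\ eta <> y] `&` eball y (2 * k) = [set` s].
  apply/finite_seqP; apply: sub_finite_set (dXi _ (bounded_eball y (2 * k))).
  by move=> eta [[]].
(* The radius of [y] may be infinite; truncating it at [k] loses no site and makes the constraint
   quadratic. *)
have [a a0 aE] : exists2 a : R, 0 <= a & a%:E = Order.min (r y) k%:E.
  have := r0 y; case: (r y) => [a||] // a0; last by exists k; rewrite ?min_r ?leey ?ltW.
  exists (Num.min a k); first by rewrite le_min -lee_fin a0 ltW.
  by rewrite EFin_min.
have ball_a x : euclidean_norm (x - y) < a <->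
    ((euclidean_norm (x - y))%:E < r y)%E /\ euclidean_norm (x - y) < k.
  by rewrite -lte_fin aE lt_min lte_fin; split=> /andP.
suff CE : catchment Xi r y = constrained r y [:: inner y a] s.
  by rewrite CE; apply: constrained_finite_union => //; rewrite -CE.
have innerP x : system [:: inner y a] x <-> euclidean_norm (x - y) < a.
  rewrite -quad_innerE //; split=> [|h q]; first by apply; rewrite inE.
  by rewrite inE => /eqP->.
have sP eta : eta \in s <-> (Xi eta /\ eta <> y) /\ euclidean_norm (eta - y) < 2 * k.
  by move: hs => /seteqP[h1 h2]; split=> [/h2|/h1].
apply/seteqP; split => [x Cx|x [/innerP/ball_a[xr xk] hx]].
  have [xr nx] := Cx; split; first by apply/innerP/ball_a; split=> //; exact: Ck.
  move=> eta /sP[[Xeta etay] _].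
  have [h|h] := ltP (euclidean_norm (x - y)) (euclidean_norm (x - eta)); first by right.
  by left; rewrite ltNge; apply/negP => reta; apply: nx; exists eta.
split=> // -[eta Xeta [etay h reta]]; have : eta \in s.
  apply/sP; split=> //; apply: le_lt_trans (euclidean_dist_triangle _ x _) _.
  by rewrite (euclidean_distC eta x); lra.
by move=> /hx[|]; [rewrite ltNge reta|rewrite ltNge h].
Qed.

End catchments.

Theorem theorem5 (R : realType) (d : nat) (hd : (1 <= d)%N)
    (dOmega : measure_display) (Omega : measurableType dOmega)
    (Pr : probability Omega R) (Pi : {RV Pr >-> point_measure R d})
    (simple_Pi : simple_process Pi)
    (invariant_Pi : translation_invariant Pi)
    (lambda : R) (lambda_gt0 : 0 < lambda)
    (intensity_Pi : intensity Pi = lambda%:E)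
    (alpha : R) (alpha_gt0 : 0 < alpha) :
  (forall (dom : set (point_measure R d))
      (Psi : point_measure R d -> 'rV[R]_d -> allotment R d),
    stable_factor_allocation Pi alpha dom Psi ->
    {ae Pr, forall w, forall xi, centers (Pi w) xi ->
       bounded_set (territory (Psi (Pi w)) xi)} /\
    {ae Pr, forall w, forall B : set 'rV[R]_d, bounded_set B ->
       finite_set [set xi | centers (Pi w) xi /\
                            (B `&` territory (Psi (Pi w)) xi) !=set0]}) /\
  (exists (dom : set (point_measure R d))
      (Psi : point_measure R d -> 'rV[R]_d -> allotment R d),
    [/\ stable_factor_allocation Pi alpha dom Psi,
        isometry_equivariant dom Psi &
        {ae Pr, forall w, forall xi, centers (Pi w) xi ->
           finite_union_of_open_connected (territory (Psi (Pi w)) xi)}]).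
Proof.
split=> [dom Psi sfa|].
  have ae_territories := territories_ae invariant_Pi sfa.
  by split; move: ae_territories; apply: filterS => w [].
(* Positive dimension is what makes spheres null; in dimension 0 the sphere of radius 0 has mass
   1. *)
case: d hd Pi simple_Pi invariant_Pi intensity_Pi => // n _ Pi' _ inv' _.
have sfa := stable_factor_gale_shapley alpha_gt0 Pi'.
exists [set: point_measure R n.+1], (gale_shapley_factor alpha); split=> //.
  exact: isometry_equivariant_gale_shapley.
have := territories_ae inv' sfa; apply: filterS => w [bw _] xi cxi.
have dw := discrete_point_measure (Pi' w).
have := bw xi cxi; rewrite /gale_shapley_factor territory_gale_shapley // => b.
by apply: finite_union_catchment => // eta; exact: radius_ge0.
Qed.
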